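(* Let $\mathfrak a,\mathfrak b,\mathfrak c,\mathfrak d$ be $C^*$-bases, where $\mathfrak b=(\mathfrak K,\mathfrak B,\mathfrak B^\dagger)$. Let $\mathcal H={}_\alpha H_\beta$, $\mathcal H^1,\mathcal H^2$ be $C^*$-$(\mathfrak a^\dagger,\mathfrak b)$-modules, $\mathcal K={}_\gamma K_\delta$, $\mathcal K^1,\mathcal K^2$ be $C^*$-$(\mathfrak b^\dagger,\mathfrak c)$-modules, and $\mathcal L={}_\epsilon L_\phi$ a $C^*$-$(\mathfrak c^\dagger,\mathfrak d)$-module. (i) For all morphisms $S\in\mathcal L(\mathcal H^1,\mathcal H^2)$ and $T\in\mathcal L(\mathcal K^1,\mathcal K^2)$, the operator $S\otimes_{\mathfrak b}T$ is a morphism in $\mathcal L(\mathcal H^1\otimes_{\mathfrak b}\mathcal K^1,\mathcal H^2\otimes_{\mathfrak b}\mathcal K^2)$. (ii) The canonical identification of $(H\otimes_{\mathfrak b}K)\otimes_{\mathfrak c}L$ and $H\otimes_{\mathfrak b}(K\otimes_{\mathfrak c}L)$, i.e. the unitary determined by $|\theta\rangle_2|\xi\rangle_1\omega\mapsto|\xi\rangle_1|\theta\rangle_2\omega$ for $\xi\in\beta$, $\omega\in K$, $\theta\in\epsilon$, is an isomorphism of $C^*$-$(\mathfrak a^\dagger,\mathfrak d)$-modules $(\mathcal H\otimes_{\mathfrak b}\mathcal K)\otimes_{\mathfrak c}\mathcal L\to\mathcal H\otimes_{\mathfrak b}(\mathcal K\otimes_{\mathfrak c}\mathcal L)$. (iii)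 Let $\mathcal U:={}_{\mathfrak B^\dagger}\mathfrak K_{\mathfrak B}$. There exist isomorphisms of $C^*$-$(\mathfrak a^\dagger,\mathfrak b)$-modules, respectively $C^*$-$(\mathfrak b^\dagger,\mathfrak c)$-modules, $$\mathcal H\otimes_{\mathfrak b}\mathcal U\to\mathcal H,\ \ \xi\otimes\zeta\otimes b^\dagger\mapsto\xi b^\dagger\zeta=\rho_\beta(b^\dagger)\xi\zeta,\qquad \mathcal U\otimes_{\mathfrak b}\mathcal K\to\mathcal K,\ \ b\otimes\zeta\otimes\eta\mapsto\eta b\zeta=\rho_\gamma(b)\eta\zeta .$$ (iv) Let $(\mathcal H^i)_i$ be a family of $C^*$-$(\mathfrak a^\dagger,\mathfrak b)$-modules and $(\mathcal K^j)_j$ a family of $C^*$-$(\mathfrak b^\dagger,\mathfrak c)$-modules, with canonical inclusions $\iota^i_{\mathcal H}:\mathcal H^i\to\boxplus_{i'}\mathcal H^{i'}$, $\iota^j_{\mathcal K}:\mathcal K^j\to\boxplus_{j'}\mathcal K^{j'}$ and projections $\pi^i_{\mathcal H}:\boxplus_{i'}\mathcal H^{i'}\to\mathcal H^i$, $\pi^j_{\mathcal K}:\boxplus_{j'}\mathcal K^{j'}\to\mathcal K^j$. Then there exist mutually inverse isomorphisms $\boxplus_{i,j}(\mathcal H^i\otimes_{\mathfrak b}\mathcal K^j)\leftrightarrows(\boxplus_i\mathcal H^i)\otimes_{\mathfrak b}(\boxplus_j\mathcal K^j)$ given by $(\omega_{i,j})_{i,j}\mapsto\sum_{i,j}(\iota^i_{\mathcal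 H}\otimes_{\mathfrak b}\iota^j_{\mathcal K})(\omega_{i,j})$ and $\omega\mapsto\big((\pi^i_{\mathcal H}\otimes_{\mathfrak b}\pi^j_{\mathcal K})(\omega)\big)_{i,j}$.
   Context: Notation: $[Y]$ is the closed linear span of a subset $Y$ of a normed space; for sets of operators, $XY=\{xy\}$, $X^*=\{x^*\}$, and $X'$ is the commutant. A $C^*$-base $\mathfrak b=(\mathfrak K,\mathfrak B,\mathfrak B^\dagger)$ consists of a Hilbert space $\mathfrak K$ and two nondegenerate $C^*$-algebras $\mathfrak B,\mathfrak B^\dagger\subseteq\mathcal L(\mathfrak K)$ that commute elementwise; its opposite is $\mathfrak b^\dagger=(\mathfrak K,\mathfrak B^\dagger,\mathfrak B)$. Write $\mathfrak a=(\mathfrak H,\mathfrak A,\mathfrak A^\dagger)$, $\mathfrak c=(\mathfrak L,\mathfrak C,\mathfrak C^\dagger)$. A $C^*$-$\mathfrak b$-module $H_\beta=(H,\beta)$ is a Hilbert space $H$ with a closed subspace $\beta\subseteq\mathcal L(\mathfrak K,H)$ such that $[\beta\mathfrak K]=H$, $[\beta\mathfrak B]=\beta$, $[\beta^*\beta]=\mathfrak B$. There is a unique normal unital faithful representation $\rho_\beta:\mathfrak B'\to\mathcal L(H)$ with $\rho_\beta(x)\xi\zeta=\xi x\zeta$ for $x\in\mathfrak B'$, $\xi\in\beta$, $\zeta\in\mathfrak K$. A morphism $T\in\mathcal L(H_\beta,K_\gamma)$ of $C^*$-$\mathfrak b$-modules is $T\in\mathcal L(H,K)$ with $T\beta\subseteq\gamma$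 and $T^*\gamma\subseteq\beta$. A $C^*$-$(\mathfrak a^\dagger,\mathfrak b)$-module ${}_\alpha H_\beta=(H,\alpha,\beta)$ is a Hilbert space $H$ such that $(H,\alpha)$ is a $C^*$-$\mathfrak a^\dagger$-module, $(H,\beta)$ is a $C^*$-$\mathfrak b$-module, $[\rho_\alpha(\mathfrak A)\beta]=\beta$ and $[\rho_\beta(\mathfrak B^\dagger)\alpha]=\alpha$. Morphisms are operators that are morphisms for both module structures; isomorphisms are unitary morphisms. E.g. ${}_{\mathfrak B^\dagger}\mathfrak K_{\mathfrak B}$ is a $C^*$-$(\mathfrak b^\dagger,\mathfrak b)$-module. Direct sums: for $\mathcal H^i=(H_i,\alpha_i,\beta_i)$, $\boxplus_i\mathcal H^i=(\bigoplus_iH_i,\boxplus_i\alpha_i,\boxplus_i\beta_i)$, where $\bigoplus_i H_i$ is the Hilbert space direct sum and $\boxplus_i\alpha_i\subseteq\mathcal L(\mathfrak H,\bigoplus_iH_i)$ is the norm-closed span of the operators $\zeta\mapsto(\xi_i\zeta)_i$ with $(\xi_i)_i$ in the algebraic direct sum of the $\alpha_i$; similarly $\boxplus_i\beta_i$. Relative tensor product: for a $C^*$-$\mathfrak b$-module $H_\beta$ and a $C^*$-$\mathfrak b^\dagger$-module $K_\gamma$, $H\otimes_{\mathfrak b}K$ (depending on $\beta,\gamma$) is the Hilbert space obtained as separated completion of $\beta\odot\mathfrak K\odot\gamma$ with respect to $\langle\xi\odot\zeta\odot\eta|\xi'\odot\zeta'\odot\eta'\rangle=\langle\zeta|\xi^*\xi'\eta^*\eta'\zeta'\rangle$,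 with elementary tensors $\xi\otimes\zeta\otimes\eta$. For $\xi\in\beta$, $\eta\in\gamma$ there are bounded operators $|\xi\rangle_1:K\to H\otimes_{\mathfrak b}K$, $\eta\zeta\mapsto\xi\otimes\zeta\otimes\eta$, and $|\eta\rangle_2:H\to H\otimes_{\mathfrak b}K$, $\xi\zeta\mapsto\xi\otimes\zeta\otimes\eta$. For morphisms $S,T$, $S\otimes_{\mathfrak b}T$ is the bounded operator $\xi\otimes\zeta\otimes\eta\mapsto S\xi\otimes\zeta\otimes T\eta$. For $\mathcal H={}_\alpha H_\beta$ and $\mathcal K={}_\gamma K_\delta$ as in the claim, $\mathcal H\otimes_{\mathfrak b}\mathcal K$ is the $C^*$-$(\mathfrak a^\dagger,\mathfrak c)$-module $(H\otimes_{\mathfrak b}K,\ \alpha\lhd\gamma,\ \beta\rhd\delta)$ with $\alpha\lhd\gamma=[|\gamma\rangle_2\alpha]$ and $\beta\rhd\delta=[|\beta\rangle_1\delta]$, where $|\beta\rangle_1=\{|\xi\rangle_1:\xi\in\beta\}$, $|\gamma\rangle_2=\{|\eta\rangle_2:\eta\in\gamma\}$. *)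

(* Defs.v *)
From HB Require Import structures.
From mathcomp Require Import all_boot all_order all_algebra finmap complex.
From mathcomp Require Import all_classical all_reals all_analysis.
From mathcomp Require Import summability ring lra.

(* Scalars are R[i] for R : realType, so norms take values in R[i].  Inner
   products are linear in their second argument.

   Bounded operators that are determined by an equation (adjoints, rho_beta(x),
   |xi>_1, |eta>_2 and the tensor product of operators) are introduced by xget:
   they denote the solution of the equation, or 0 if there is none. *)

Set Implicit Arguments.
Unset Strict Implicit.
Unset Printing Implicit Defensive.
Import Order.TTheory GRing.Theory Num.Theory.
Import numFieldNormedType.Exports.
Local Open Scope classical_set_scope.
Local Open Scope ring_scope.

HB.instance Definition _ (R : realType) := NormedModule.copy R[i] R[i]^o.

HB.mixin Record NormedModule_isPreHilbert (R : realType) V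
    & NormedModule R[i] V := {
  inner : V -> V -> R[i];
  innerDr : forall x y z, inner x (y + z) = inner x y + inner x z;
  innerZr : forall a x y, inner x (a *: y) = a * inner x y;
  innerC : forall x y, inner y x = (inner x y)^*;
  inner_norm : forall x, inner x x = `|x| ^+ 2
}.

#[short(type="prehilbertType")]
HB.structure Definition PreHilbert (R : realType) :=
  {V of NormedModule_isPreHilbert R V & NormedModule R[i] V}.

#[short(type="hilbertType")]
HB.structure Definition Hilbert (R : realType) :=
  {V of PreHilbert R V & CompleteNormedModule R[i] V}.

Section semi_inner.
Variables (C : numClosedFieldType) (V : lmodType C) (s : V -> V -> C).
Hypothesis sDr : forall x y z, s x (y + z) = s x y + s x z.
Hypothesis sZr : forall a x y, s x (a *: y) = a * s x y.
Hypothesis sC : forall x y, s y x = (s x y)^*.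
Hypothesis s_ge0 : forall x, 0 <= s x x.

Lemma semiDl x y z : s (x + y) z = s x z + s y z.
Proof. by rewrite (sC z) sDr rmorphD/= -(sC z x) -(sC z y). Qed.
Lemma semiZl a x y : s (a *: x) y = a^* * s x y.
Proof. by rewrite (sC y) sZr rmorphM/= -(sC y x). Qed.
Lemma semi0r x : s x 0 = 0.
Proof. by rewrite -(scale0r 0) sZr mul0r. Qed.
Lemma semiNr x y : s x (- y) = - s x y.
Proof. by rewrite -scaleN1r sZr mulN1r. Qed.
Lemma semiNl x y : s (- x) y = - s x y.
Proof. by rewrite -scaleN1r semiZl rmorphN1 mulN1r. Qed.

Lemma semi_expand a b x y : s (a *: x + b *: y) (a *: x + b *: y) =
  a * a^* * s x x + b * b^* * s y y + a^* * b * s x y + a * b^* * (s x y)^*.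
Proof. by rewrite sDr !semiDl !sZr !semiZl (sC x y); ring. Qed.

Lemma semi_CS x y : `|s x y| ^+ 2 <= s x x * s y y.
Proof.
have nE : `|s x y| ^+ 2 = s x y * (s x y)^* by rewrite normCK.
have rx : (s x x)^* = s x x by apply: conj_Creal; apply: ger0_real.
have ry : (s y y)^* = s y y by apply: conj_Creal; apply: ger0_real.
have := s_ge0 y; rewrite le_eqVlt => /predU1P[y0|ypos].
- have := s_ge0 x; rewrite le_eqVlt => /predU1P[x0|xpos].
  + have := s_ge0 (1 *: x + (- (s x y)^*) *: y).
    rewrite semi_expand -x0 -y0 rmorph1 rmorphN /= conjCK.
    rewrite [leRHS](_ : _ = - (`|s x y| ^+ 2 *+ 2)); last first.
      by rewrite nE; ring.
    rewrite oppr_ge0 pmulrn_lle0// => h.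
    by rewrite mulr0.
  + have := s_ge0 ((- s x y) *: x + (s x x) *: y).
    rewrite semi_expand rmorphN /= rx.
    rewrite [leRHS](_ : _ = s x x * (s x x * s y y - `|s x y| ^+ 2)); last first.
      by rewrite nE; ring.
    by rewrite pmulr_rge0// subr_ge0.
- have := s_ge0 (s y y *: x + (- (s x y)^*) *: y).
  rewrite semi_expand rmorphN /= ry conjCK.
  rewrite [leRHS](_ : _ = s y y * (s x x * s y y - `|s x y| ^+ 2)); last first.
    by rewrite nE; ring.
  by rewrite pmulr_rge0// subr_ge0.
Qed.

Definition semi_norm x := sqrtC (s x x).

Lemma semi_norm_ge0 x : 0 <= semi_norm x.
Proof. by rewrite sqrtC_ge0. Qed.

Lemma semi_normK x : semi_norm x ^+ 2 = s x x.
Proof. by rewrite sqrtCK. Qed.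

Lemma semi_norm_CS x y : `|s x y| <= semi_norm x * semi_norm y.
Proof.
rewrite -(@ler_pXn2r _ 2)// ?nnegrE ?mulr_ge0 ?semi_norm_ge0//.
by rewrite exprMn !semi_normK semi_CS.
Qed.

Lemma semi_normD x y : semi_norm (x + y) <= semi_norm x + semi_norm y.
Proof.
rewrite -(@ler_pXn2r _ 2)// ?nnegrE ?addr_ge0 ?semi_norm_ge0//.
rewrite sqrrD !semi_normK sDr !semiDl (sC x y).
rewrite [leLHS](_ : _ = s x x + (s x y + (s x y)^*) + s y y); last by ring.
rewrite lerD2r lerD2l.
have -> : s x y + (s x y)^* = 'Re (s x y) *+ 2.
  by rewrite ReE -mulr_natr divfK ?pnatr_eq0.
rewrite lerMn2r/=; apply: le_trans (semi_norm_CS x y).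
apply: le_trans (leif_normC_Re_Creal (s x y)).1.
by rewrite real_ler_norm ?Creal_Re.
Qed.

Lemma semi_normZ a x : semi_norm (a *: x) = `|a| * semi_norm x.
Proof.
rewrite /semi_norm sZr semiZl mulrA -normCK sqrtCM ?nnegrE ?exprn_ge0//.
by rewrite sqrCK.
Qed.

End semi_inner.

HB.factory Record Lmodule_isPreHilbert (R : realType) V & GRing.Lmodule R[i] V := {
  inner : V -> V -> R[i];
  innerDr : forall x y z, inner x (y + z) = inner x y + inner x z;
  innerZr : forall a x y, inner x (a *: y) = a * inner x y;
  innerC : forall x y, inner y x = (inner x y)^*;
  inner_ge0 : forall x, 0 <= inner x x;
  inner_eq0 : forall x, inner x x = 0 -> x = 0
}.

HB.builders Context R V & Lmodule_isPreHilbert R V.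

Let norm := semi_norm inner.
Let normD x y : norm (x + y) <= norm x + norm y.
Proof. exact: (semi_normD innerDr innerZr innerC inner_ge0). Qed.
Let normZ l x : norm (l *: x) = `|l| * norm x.
Proof. exact: (semi_normZ innerZr innerC inner_ge0). Qed.
Let norm_eq0 x : norm x = 0 -> x = 0.
Proof. by move=> /eqP; rewrite sqrtC_eq0 => /eqP /inner_eq0. Qed.

HB.instance Definition _ := Lmodule_isNormed.Build R[i] V normD normZ norm_eq0.

Let normE (x : V) : inner x x = `|x| ^+ 2.
Proof. by rewrite -[X in X ^+ 2]/(norm x) /norm semi_normK. Qed.

HB.instance Definition _ := NormedModule_isPreHilbert.Build R V
  innerDr innerZr innerC normE.
HB.end.

Lemma complex_small (R : realType) (e : R[i]) : 0 < e ->
  exists N, forall n, (N <= n)%N -> n.+1%:R ^-1 < e.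
Proof.
move=> e0; have er : e \is Num.real by apply: gtr0_real.
move: er => /complex_realP[r re]; subst e.
have r0 : 0 < r by rewrite -ltcR.
have ir : 0 <= r^-1 by rewrite invr_ge0 ltW.
exists (Num.bound r^-1) => n Nn.
have rn : r^-1 < n.+1%:R.
  apply: lt_le_trans (archi_boundP ir) _.
  by rewrite ler_nat ltnW.
rewrite invf_plt ?posrE ?ltcR//.
have -> : (n.+1%:R : R[i]) = (n.+1%:R)%:C%C by rewrite rmorph_nat.
by rewrite -fmorphV ltcR.
Qed.

HB.factory Record PreHilbert_isHilbert (R : realType) V & PreHilbert R V := {
  cauchy_seq_cvg : forall u : nat -> V,
    (forall e : R[i], 0 < e -> exists N, forall m n,
       (N <= m)%N -> (N <= n)%N -> `|u m - u n| < e) ->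
    exists l, forall e : R[i], 0 < e -> exists N, forall n,
       (N <= n)%N -> `|u n - l| < e
}.

HB.builders Context R V & PreHilbert_isHilbert R V.

Let complete (F : set_system V) : ProperFilter F -> cauchy F -> cvg F.
Proof.
move=> FF /cauchy_ballP cF.
have ex (n : nat) : exists x : V, F (ball x (n.+1%:R ^-1 : R[i])).
  apply: (cauchyP _).1; first exact/cauchy_ballP.
  by rewrite invr_gt0.
have [x xP] := choice ex.
have xmn m n : `|x m - x n| < (m.+1%:R ^-1 + n.+1%:R ^-1 : R[i]).
  have Fmn : F (ball (x m) (m.+1%:R ^-1 : R[i]) `&` ball (x n) (n.+1%:R ^-1 : R[i])).
    exact: filterI.
  have [z []] := filter_ex Fmn; rewrite -!ball_normE/= => h1 h2.
  rewrite (_ : x m - x n = (x m - z) + (z - x n)); last by rewrite addrA subrK.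
  by apply: le_lt_trans (ler_normD _ _) _; rewrite ltrD// distrC.
have [l lP] : exists l, forall e : R[i], 0 < e -> exists N, forall n, (N <= n)%N ->
    `|x n - l| < e.
  apply: cauchy_seq_cvg => e e0.
  have e20 : 0 < e / 2 by rewrite divr_gt0.
  have [N NP] := complex_small e20.
  exists N => m n Nm Nn; apply: lt_trans (xmn m n) _.
  by rewrite [ltRHS]splitr; apply: ltrD; apply: NP.
apply: (@cvgP _ F l); apply/fcvgrPdist_lt => e e0.
have e20 : 0 < e / 2 by rewrite divr_gt0.
have [N1 N1P] := complex_small e20.
have [N2 N2P] := lP _ e20.
pose n := maxn N1 N2.
have h2 := N2P n (leq_maxr _ _).
have h1 := N1P n (leq_maxl _ _).
apply: filterS (xP n) => z; rewrite -ball_normE/= => hz.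
rewrite (_ : l - z = (l - x n) + (x n - z)); last by rewrite addrA subrK.
apply: le_lt_trans (ler_normD _ _) _.
by rewrite [ltRHS]splitr; apply: ltrD; [rewrite distrC | apply: lt_trans hz _].
Qed.

HB.instance Definition _ := Uniform_isComplete.Build V complete.
HB.end.

Record bop (R : realType) (H K : hilbertType R) := Bop {
  bop_fun :> H -> K;
  bop_linear : linear bop_fun;
  bop_continuous : continuous bop_fun
}.
Arguments bop_linear {R H K}.
Arguments bop_continuous {R H K}.

HB.instance Definition _ (R : realType) (H K : hilbertType R) (T : bop H K) :=
  GRing.isLinear.Build R[i] H K *:%R (bop_fun T) (@bop_linear R H K T).
HB.instance Definition _ (R : realType) (H K : hilbertType R) :=
  gen_eqMixin (bop H K).
HB.instance Definition _ (R : realType) (H K : hilbertType R) :=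
  gen_choiceMixin (bop H K).

Section bop_lmodule.
Variables (R : realType) (H K : hilbertType R).
Implicit Types S T : bop H K.

Lemma bopP S T : (forall x, S x = T x) -> S = T.
Proof.
case: S T => [f f1 f2] [g g1 g2] /= fg.
have e : f = g by apply/funext.
by subst g; congr Bop; exact: Prop_irrelevance.
Qed.

Fact bop0_linear : linear (fun _ : H => 0 : K).
Proof. by move=> a x y; rewrite scaler0 addr0. Qed.
Definition bop0 := Bop bop0_linear (@cst_continuous H K 0).

Fact bopD_linear S T : linear (fun x => S x + T x).
Proof. by move=> a x y; rewrite !linearP scalerDr addrACA. Qed.
Fact bopD_continuous S T : continuous (fun x => S x + T x).
Proof. by move=> x; apply: cvgD; exact: bop_continuous. Qed.
Definition bopD S T := Bop (@bopD_linear S T) (@bopD_continuous S T).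

Fact bopZ_linear c T : linear (fun x => c *: T x).
Proof. by move=> a x y; rewrite linearP scalerDr !scalerA mulrC. Qed.
Fact bopZ_continuous c T : continuous (fun x => c *: T x).
Proof. by move=> x; apply: cvgZr; exact: bop_continuous. Qed.
Definition bopZ c T := Bop (@bopZ_linear c T) (@bopZ_continuous c T).

Fact bopN_linear T : linear (fun x => - T x).
Proof. by move=> a x y; rewrite linearP opprD scalerN. Qed.
Fact bopN_continuous T : continuous (fun x => - T x).
Proof. by move=> x; apply: cvgN; exact: bop_continuous. Qed.
Definition bopN T := Bop (@bopN_linear T) (@bopN_continuous T).

Fact bopDA : associative bopD.
Proof. by move=> S T U; apply: bopP => x /=; rewrite addrA. Qed.
Fact bopDC : commutative bopD.
Proof. by move=> S T; apply: bopP => x /=; rewrite addrC. Qed.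
Fact bop0D : left_id bop0 bopD.
Proof. by move=> T; apply: bopP => x /=; rewrite add0r. Qed.
Fact bopND : left_inverse bop0 bopN bopD.
Proof. by move=> T; apply: bopP => x /=; rewrite addNr. Qed.
HB.instance Definition _ :=
  GRing.isZmodule.Build (bop H K) bopDA bopDC bop0D bopND.

Fact bopZA a b T : bopZ a (bopZ b T) = bopZ (a * b) T.
Proof. by apply: bopP => x /=; rewrite scalerA. Qed.
Fact bop1Z : left_id 1 bopZ.
Proof. by move=> T; apply: bopP => x /=; rewrite scale1r. Qed.
Fact bopZDr : right_distributive bopZ +%R.
Proof. by move=> a S T; apply: bopP => x /=; rewrite scalerDr. Qed.
Fact bopZDl T : {morph bopZ^~ T : a b / a + b}.
Proof. by move=> a b; apply: bopP => x /=; rewrite scalerDl. Qed.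
HB.instance Definition _ :=
  GRing.Zmodule_isLmodule.Build R[i] (bop H K) bopZA bop1Z bopZDr bopZDl.

Definition opnorm T : R[i] :=
  (sup [set complex.Re `|T x| | x in [set x | `|x| <= 1]])%:C%C.

Lemma bop_bounded T : exists2 M : R, 0 <= M &
  forall x, `|T x| <= M%:C%C * `|x|.
Proof.
have /linear_bounded_continuous/linear_boundedP/pinfty_ex_gt0[r r0 rP] :
  continuous (bop_fun T : {linear H -> K}) by exact: bop_continuous.
have rE : (complex.Re r)%:C%C = r by apply: RRe_real; exact: gtr0_real.
exists (complex.Re r); first by rewrite -lecR rE ltW.
by rewrite rE.
Qed.

Lemma opnorm_has_sup T :
  has_sup [set complex.Re `|T x| | x in [set x | `|x| <= 1]].
Proof.
split; first by exists (complex.Re `|T 0|), 0 => //=; rewrite normr0.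
have [M M0 MP] := bop_bounded T; exists M => _ [x /= x1 <-].
rewrite -lecR RRe_real ?normr_real//; apply: le_trans (MP x) _.
by rewrite ler_piMr// lecR.
Qed.

Lemma opnorm_ge T x : `|x| <= 1 -> `|T x| <= opnorm T.
Proof.
move=> x1; rewrite -(@RRe_real _ `|T x|) ?normr_real// lecR.
by apply: (sup_upper_bound (opnorm_has_sup T)); exists x.
Qed.

Lemma opnorm_ge0 T : 0 <= opnorm T.
Proof. by apply: le_trans (@opnorm_ge T 0 _); rewrite ?normr0. Qed.

Lemma opnormP T x : `|T x| <= opnorm T * `|x|.
Proof.
have [->|x0] := eqVneq x 0; first by rewrite linear0 !normr0 mulr0.
rewrite -ler_pdivrMr ?normr_gt0//.
have := @opnorm_ge T (`|x|^-1 *: x).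
rewrite normrZ normfV normr_id mulVf ?normr_eq0// => /(_ (lexx _)).
by rewrite linearZ normrZ normfV normr_id mulrC.
Qed.

Lemma opnorm_le T M : 0 <= M -> (forall x, `|x| <= 1 -> `|T x| <= M) -> opnorm T <= M.
Proof.
move=> M0 MP; rewrite -(@RRe_real _ M) ?ger0_real// lecR.
apply: ge_sup; first by have [] := opnorm_has_sup T.
by move=> _ [x /= x1 <-]; rewrite -lecR !RRe_real ?normr_real ?ger0_real ?MP.
Qed.

Fact opnormD S T : opnorm (S + T) <= opnorm S + opnorm T.
Proof.
apply: opnorm_le => [|x x1]; first by rewrite addr_ge0 ?opnorm_ge0.
by apply: le_trans (ler_normD _ _) _; rewrite lerD ?opnorm_ge.
Qed.

Fact opnormZ a T : opnorm (a *: T) = `|a| * opnorm T.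
Proof.
have le b S : opnorm (b *: S) <= `|b| * opnorm S.
  apply: opnorm_le => [|x x1]; first by rewrite mulr_ge0 ?opnorm_ge0.
  by rewrite normrZ ler_wpM2l ?opnorm_ge.
apply/eqP; rewrite eq_le le/=.
have [->|a0] := eqVneq a 0; first by rewrite normr0 mul0r opnorm_ge0.
rewrite -ler_pdivlMl ?normr_gt0// -normfV.
by apply: le_trans (le _ _); rewrite scalerA mulVf// scale1r.
Qed.

Fact opnorm_eq0 T : opnorm T = 0 -> T = 0.
Proof.
move=> T0; apply: bopP => x; apply/eqP; rewrite -normr_le0.
by have := opnormP T x; rewrite T0 mul0r.
Qed.

HB.instance Definition _ :=
  Lmodule_isNormed.Build R[i] (bop H K) opnormD opnormZ opnorm_eq0.

End bop_lmodule.

Section comp.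
Variables (R : realType) (H K L : hilbertType R) (S : bop K L) (T : bop H K).
Fact bop_comp_linear : linear (S \o T).
Proof. by move=> a x y /=; rewrite !linearP. Qed.
Fact bop_comp_continuous : continuous (S \o T).
Proof.
by move=> x; apply: continuous_comp; exact: bop_continuous.
Qed.
Definition bop_comp := Bop bop_comp_linear bop_comp_continuous.
End comp.

Definition bop_id (R : realType) (H : hilbertType R) : bop H H.
Proof. by exists id => // x; exact: cvg_id. Defined.

Definition adjoint (R : realType) (H K : hilbertType R) (T : bop H K) : bop K H :=
  xget 0 [set S : bop K H | forall x y, inner (S y) x = inner y (T x)].

Section complex_limits.
Variable R : realType.
Implicit Types x y : R[i].

Lemma Im_le_norm x : `|complex.Im x|%:C%C <= `|x|.
Proof.
rewrite normc_def lecR -sqrtr_sqr ler_wsqrtr//.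
by rewrite lerDr sqr_ge0.
Qed.

Lemma Re_le_norm x : `|complex.Re x|%:C%C <= `|x|.
Proof. exact: normc_ge_Re. Qed.

Lemma norm_le_ReIm x : `|x| <= (`|complex.Re x| + `|complex.Im x|)%:C%C.
Proof.
rewrite [X in `|X|]complexE rmorphD/=; apply: le_trans (ler_normD _ _) _.
by rewrite normrM !normc_def/= !expr0n/= !(addr0,add0r) expr1n sqrtr1 mul1r !sqrtr_sqr.
Qed.

Lemma complex_complete (F : set_system R[i]) : ProperFilter F -> cauchy F -> cvg F.
Proof.
move=> FF cF'.
have cF (e : R[i]) : 0 < e -> exists x, F (ball x e) by exact: (cauchyP _).1.
have aux (g : R[i] -> R) : (forall x y, g (x - y) = g x - g y) ->
    (forall x, `|g x|%:C%C <= `|x|) -> cvg (g @ F).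
  move=> gB gle; apply: cauchy_cvg; apply: cauchy_exP => e e0.
  have e0' : 0 < (e%:C)%C :> R[i] by rewrite ltcR.
  have [x xF] := cF _ e0'; exists (g x); rewrite /nbhs/=; apply: filterS xF => y.
  rewrite -!ball_normE/= => xy; rewrite -gB -ltcR.
  exact: le_lt_trans (gle _) xy.
have /cvg_ex[a Fa] : cvg (@complex.Re R @ F).
  by apply: aux => [x y|]; [rewrite raddfB | exact: Re_le_norm].
have /cvg_ex[b Fb] : cvg (@complex.Im R @ F).
  by apply: aux => [x y|]; [rewrite raddfB | exact: Im_le_norm].
apply: (@cvgP _ F (Complex a b)); apply/fcvgrPdist_lt => e e0.
have er : e \is Num.real by apply: gtr0_real.
move: er => /complex_realP[r re]; subst e.
have r0 : 0 < r / 2 by rewrite divr_gt0// -ltcR.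
move/cvgrPdist_lt : Fa => /(_ _ r0) Fa; move/cvgrPdist_lt : Fb => /(_ _ r0) Fb.
apply: filterS2 Fa Fb => y ya yb.
apply: le_lt_trans (norm_le_ReIm _) _; rewrite ltcR [ltRHS]splitr.
by case: y ya yb => c d /= ya yb; apply: ltrD.
Qed.

Lemma complex_approx_ge0 x :
  (forall e : R[i], 0 < e -> exists2 y, 0 <= y & `|x - y| < e) -> 0 <= x.
Proof.
move=> h.
have hr (e : R) : 0 < e -> exists2 y, 0 <= y & `|x - y| < e%:C%C.
  by move=> e0; apply: h; rewrite ltcR.
have [hI|hI] := eqVneq (complex.Im x) 0; last first.
  have [|y y0] := hr `|complex.Im x|; first by rewrite normr_gt0.
  move=> /(le_lt_trans (Im_le_norm _)); rewrite raddfB/= (ger0_Im y0) subr0.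
  by rewrite ltxx.
have xE : x = (complex.Re x)%:C%C by rewrite [LHS]complexE hI rmorph0 mulr0 addr0.
rewrite xE ler0c leNgt; apply/negP => x0.
have [|y y0] := hr (- complex.Re x); first by rewrite oppr_gt0.
move=> /(le_lt_trans (Re_le_norm _)); rewrite raddfB/= ltcR.
have yE : 0 <= complex.Re y by move: y0; rewrite lecE => /andP[].
rewrite ltr0_norm; last by lra.
lra.
Qed.

Lemma complex_lim_le (T : Type) (F : set_system T) (f : T -> R[i]) l M :
  ProperFilter F -> f @ F --> l -> (\forall t \near F, f t <= M) -> l <= M.
Proof.
move=> FF /cvgrPdist_lt fl fM; rewrite -subr_ge0; apply: complex_approx_ge0 => e e0.
have [t [ft fMt]] := filter_ex (filterI (fl e e0) fM).
exists (M - f t); first by rewrite subr_ge0.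
by rewrite (_ : M - l - (M - f t) = - (l - f t)) ?normrN//; ring.
Qed.

End complex_limits.

#[global] Existing Instance totally_filter.

Section prehilbert_theory.
Variables (R : realType) (H : prehilbertType R).
Implicit Types x y : H.

Lemma inner_ge0 x : 0 <= inner x x.
Proof. by rewrite inner_norm exprn_ge0. Qed.

Lemma inner_CS x y : `|inner x y| <= `|x| * `|y|.
Proof.
have := semi_norm_CS innerDr innerZr innerC inner_ge0 x y.
by rewrite /semi_norm !inner_norm !sqrCK.
Qed.

End prehilbert_theory.

Lemma hilbert_cvg (R : realType) (H : hilbertType R) (u : nat -> H) :
  (forall e : R[i], 0 < e -> exists N, forall m n, (N <= m)%N -> (N <= n)%N ->
     `|u m - u n| < e) -> exists l : H, u @ \oo --> l.
Proof.
move=> h; apply/cvg_ex; apply: cauchy_cvg; apply: cauchy_exP => e e0.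
have [N NP] := h e e0; exists (u N), N => // n /= Nn.
by rewrite -ball_normE/=; exact: NP.
Qed.

Section fset_sums.
Variables (K : numDomainType) (I : choiceType).
Implicit Types (A B : {fset I}).

Lemma fset_sum_split (V : zmodType) (f : I -> V) A B : (A `<=` B)%fset ->
  \sum_(i <- B) f i = \sum_(i <- A) f i + \sum_(i <- (B `\` A)%fset) f i.
Proof.
move=> AB; rewrite (big_fsetID _ (mem A))/=; congr (_ + _).
  apply: eq_fbigl => i; rewrite !inE/= andbC.
  by case: (boolP (i \in A)) => //= iA; rewrite (fsubsetP AB).
by apply: eq_fbigl => i; rewrite !inE/= andbC.
Qed.

Lemma fset_sum_le (f : I -> K) A B : (forall i, 0 <= f i) -> (A `<=` B)%fset ->
  \sum_(i <- A) f i <= \sum_(i <- B) f i.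
Proof.
by move=> f0 AB; rewrite (fset_sum_split f AB) lerDl sumr_ge0.
Qed.

Lemma partial_sumE (V : zmodType) (f : I -> V) A :
  partial_sum f A = \sum_(i <- A) f i.
Proof. by rewrite /partial_sum big_seq_fsetE. Qed.
End fset_sums.

Section absolutely_summable.
Variables (R : realType) (I : choiceType).

Lemma abs_sum_cvg (f : I -> R[i]) (M : R[i]) :
  (forall A : {fset I}, \sum_(i <- A) `|f i| <= M) ->
  cvg (partial_sum f A @[A --> totally]).
Proof.
move=> fM; apply: complex_complete.
pose g (A : {fset I}) : R := complex.Re (\sum_(i <- A) `|f i|).
have gE (A : {fset I}) : (g A)%:C%C = \sum_(i <- A) `|f i|.
  by rewrite RRe_real// ger0_real// sumr_ge0.
have hs : has_sup (range g).
  split; first by exists (g fset0), fset0.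
  exists (complex.Re M) => _ [A _ <-]; rewrite -lecR gE RRe_real ?fM//.
  by apply: ger0_real; apply: le_trans (fM fset0); rewrite sumr_ge0.
apply: cauchy_exP => e e0.
have er : e \is Num.real by apply: gtr0_real.
move: er => /complex_realP[r re]; subst e.
have r0 : 0 < r by rewrite -ltcR.
have [_ [A _ <-] gA] := sup_adherent r0 hs.
exists (partial_sum f A); exists A => // B /= AB.
rewrite -ball_normE/= !partial_sumE (fset_sum_split f AB) opprD addrA subrr sub0r normrN.
apply: le_lt_trans (ler_norm_sum _ _ _) _.
rewrite (_ : \sum_(i <- (B `\` A)%fset) `|f i| = (g B - g A)%:C%C); last first.
  by rewrite rmorphB/= !gE (fset_sum_split _ AB) addrAC subrr add0r.
rewrite ltcR ltrBlDr; apply: le_lt_trans (_ : sup (range g) < _).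
  by apply: (sup_upper_bound hs); exists B.
by rewrite addrC -ltrBlDr.
Qed.
End absolutely_summable.

Section direct_sum.
Variables (R : realType) (I : choiceType) (H : I -> hilbertType R).

Record dsum := DSum {
  dsum_fun :> forall i, H i;
  dsum_bounded : exists M : R[i],
    forall A : {fset I}, \sum_(i <- A) `|dsum_fun i| ^+ 2 <= M
}.

HB.instance Definition _ := gen_eqMixin dsum.
HB.instance Definition _ := gen_choiceMixin dsum.

Implicit Types x y z : dsum.

Lemma dsumP x y : (forall i, x i = y i) -> x = y.
Proof.
case: x y => [f fb] [g gb] /= fg.
have e : f = g by apply: functional_extensionality_dep.
by subst g; congr DSum; exact: Prop_irrelevance.
Qed.

Fact dsum0_bounded : exists M : R[i],
  forall A : {fset I}, \sum_(i <- A) `|0 : H i| ^+ 2 <= M.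
Proof. by exists 0 => A; rewrite big1// => i _; rewrite normr0 expr0n. Qed.
Definition dsum0 := DSum dsum0_bounded.

Lemma sqr_normD_le (V : normedModType R[i]) (u v : V) :
  `|u + v| ^+ 2 <= 2%:R * (`|u| ^+ 2 + `|v| ^+ 2).
Proof.
have h : `|u + v| ^+ 2 <= (`|u| + `|v|) ^+ 2.
  by rewrite ler_pXn2r ?nnegrE ?addr_ge0// ler_normD.
apply: le_trans h _; rewrite -subr_ge0.
rewrite (_ : _ - _ = (`|u| - `|v|) ^+ 2); last by ring.
by rewrite real_exprn_even_ge0// realB ?normr_real.
Qed.

Fact dsumD_bounded x y : exists M : R[i],
  forall A : {fset I}, \sum_(i <- A) `|x i + y i| ^+ 2 <= M.
Proof.
have [M MP] := dsum_bounded x; have [N NP] := dsum_bounded y.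
exists (2%:R * (M + N)) => A.
apply: le_trans (_ : \sum_(i <- A) 2%:R * (`|x i| ^+ 2 + `|y i| ^+ 2) <= _).
  by apply: ler_sum => i _; exact: sqr_normD_le.
by rewrite -mulr_sumr big_split/= ler_pM2l// lerD.
Qed.
Definition dsumD x y := DSum (dsumD_bounded x y).

Fact dsumZ_bounded a x : exists M : R[i],
  forall A : {fset I}, \sum_(i <- A) `|a *: x i| ^+ 2 <= M.
Proof.
have [M MP] := dsum_bounded x.
exists (`|a| ^+ 2 * M) => A.
under eq_bigr do rewrite normrZ exprMn.
by rewrite -mulr_sumr ler_wpM2l ?exprn_ge0.
Qed.
Definition dsumZ a x := DSum (dsumZ_bounded a x).

Fact dsumN_bounded x : exists M : R[i],
  forall A : {fset I}, \sum_(i <- A) `|- x i| ^+ 2 <= M.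
Proof.
have [M MP] := dsum_bounded x; exists M => A.
by under eq_bigr do rewrite normrN.
Qed.
Definition dsumN x := DSum (dsumN_bounded x).

Fact dsumDA : associative dsumD.
Proof. by move=> x y z; apply: dsumP => i /=; rewrite addrA. Qed.
Fact dsumDC : commutative dsumD.
Proof. by move=> x y; apply: dsumP => i /=; rewrite addrC. Qed.
Fact dsum0D : left_id dsum0 dsumD.
Proof. by move=> x; apply: dsumP => i /=; rewrite add0r. Qed.
Fact dsumND : left_inverse dsum0 dsumN dsumD.
Proof. by move=> x; apply: dsumP => i /=; rewrite addNr. Qed.
HB.instance Definition _ := GRing.isZmodule.Build dsum dsumDA dsumDC dsum0D dsumND.

Fact dsumZA a b x : dsumZ a (dsumZ b x) = dsumZ (a * b) x.
Proof. by apply: dsumP => i /=; rewrite scalerA. Qed.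
Fact dsum1Z : left_id 1 dsumZ.
Proof. by move=> x; apply: dsumP => i /=; rewrite scale1r. Qed.
Fact dsumZDr : right_distributive dsumZ +%R.
Proof. by move=> a x y; apply: dsumP => i /=; rewrite scalerDr. Qed.
Fact dsumZDl x : {morph dsumZ^~ x : a b / a + b}.
Proof. by move=> a b; apply: dsumP => i /=; rewrite scalerDl. Qed.
HB.instance Definition _ :=
  GRing.Zmodule_isLmodule.Build R[i] dsum dsumZA dsum1Z dsumZDr dsumZDl.

Definition dsum_inner x y : R[i] := sum (fun i => inner (x i) (y i)).

Lemma dsum_inner_cvg x y :
  partial_sum (fun i => inner (x i) (y i)) A @[A --> totally] --> dsum_inner x y.
Proof.
have [M MP] := dsum_bounded x; have [N NP] := dsum_bounded y.
apply: (@abs_sum_cvg _ _ _ (M + N)) => A.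
apply: le_trans (_ : \sum_(i <- A) (`|x i| ^+ 2 + `|y i| ^+ 2) <= _); last first.
  by rewrite big_split/= lerD.
apply: ler_sum => i _; apply: le_trans (inner_CS _ _) _.
have s0 : 0 <= (`|x i| - `|y i|) ^+ 2.
  by rewrite real_exprn_even_ge0// realB ?normr_real.
have m0 : 0 <= `|x i| * `|y i| by rewrite mulr_ge0.
rewrite -subr_ge0 (_ : _ - _ = (`|x i| - `|y i|) ^+ 2 + `|x i| * `|y i|); last by ring.
exact: addr_ge0.
Qed.

Lemma dsum_innerP x y l :
  partial_sum (fun i => inner (x i) (y i)) A @[A --> totally] --> l ->
  dsum_inner x y = l.
Proof. by move=> h; apply: (@cvg_lim R[i]) => //; exact: norm_hausdorff. Qed.

Fact dsum_innerDr x y z : dsum_inner x (y + z) = dsum_inner x y + dsum_inner x z.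
Proof.
apply: dsum_innerP; rewrite (_ : partial_sum _ = fun A =>
  partial_sum (fun i => inner (x i) (y i)) A +
  partial_sum (fun i => inner (x i) (z i)) A).
  exact: cvgD (@dsum_inner_cvg x y) (@dsum_inner_cvg x z).
apply/funext => A; rewrite !partial_sumE -big_split/=.
by apply: eq_bigr => i _; rewrite innerDr.
Qed.

Fact dsum_innerZr a x y : dsum_inner x (a *: y) = a * dsum_inner x y.
Proof.
apply: dsum_innerP; rewrite (_ : partial_sum _ = fun A =>
  a * partial_sum (fun i => inner (x i) (y i)) A).
  exact: cvgMr (@dsum_inner_cvg x y).
apply/funext => A; rewrite !partial_sumE mulr_sumr.
by apply: eq_bigr => i _; rewrite innerZr.
Qed.

Fact dsum_innerC x y : dsum_inner y x = (dsum_inner x y)^*.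
Proof.
apply: dsum_innerP; have /cvgrPdist_lt h := @dsum_inner_cvg x y.
apply/cvgrPdist_lt => e e0; apply: filterS (h e e0) => A.
rewrite !partial_sumE -norm_conjC rmorphB/= rmorph_sum/=.
by under eq_bigr do rewrite -innerC.
Qed.

Lemma dsum_inner_ge x (A : {fset I}) :
  \sum_(i <- A) `|x i| ^+ 2 <= dsum_inner x x.
Proof.
rewrite -lerN2; apply: complex_lim_le (cvgN (@dsum_inner_cvg x x)) _.
exists A => // B /= AB; rewrite lerN2 partial_sumE.
under [leRHS]eq_bigr do rewrite inner_norm.
by apply: fset_sum_le => // i; exact: exprn_ge0.
Qed.

Lemma dsum_inner_le x (M : R[i]) :
  (forall A : {fset I}, \sum_(i <- A) `|x i| ^+ 2 <= M) -> dsum_inner x x <= M.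
Proof.
move=> h; apply: complex_lim_le (@dsum_inner_cvg x x) _.
apply: nearW => A; rewrite partial_sumE.
by under eq_bigr do rewrite inner_norm.
Qed.

Fact dsum_inner_ge0 x : 0 <= dsum_inner x x.
Proof. by apply: le_trans (dsum_inner_ge x fset0); rewrite big_seq_fset0. Qed.

Lemma dsum_coord_le x i : `|x i| ^+ 2 <= dsum_inner x x.
Proof. by have := dsum_inner_ge x [fset i]%fset; rewrite big_seq_fset1. Qed.

Fact dsum_inner_eq0 x : dsum_inner x x = 0 -> x = 0.
Proof.
move=> x0; apply: dsumP => i; apply/eqP.
have : `|x i| ^+ 2 == 0 by rewrite eq_le exprn_ge0// andbT -x0 dsum_coord_le.
by rewrite expf_eq0/= normr_eq0.
Qed.

HB.instance Definition _ := Lmodule_isPreHilbert.Build R dsum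
  dsum_innerDr dsum_innerZr dsum_innerC dsum_inner_ge0 dsum_inner_eq0.

Lemma dsum_normK x : `|x| ^+ 2 = dsum_inner x x.
Proof. by rewrite -inner_norm. Qed.

Fact dsum_complete (u : nat -> dsum) :
  (forall e : R[i], 0 < e -> exists N, forall m n, (N <= m)%N -> (N <= n)%N ->
     `|u m - u n| < e) ->
  exists l, forall e : R[i], 0 < e -> exists N, forall n, (N <= n)%N ->
     `|u n - l| < e.
Proof.
move=> cu.
have ex i : {l : H i | (fun n => u n i) @ \oo --> l}.
  apply: cid; apply: hilbert_cvg => e e0.
  have [N NP] := cu _ e0; exists N => m n Nm Nn.
  apply: le_lt_trans (NP m n Nm Nn); rewrite -(@ler_pXn2r _ 2)// ?nnegrE//.
  by rewrite dsum_normK; exact: (@dsum_coord_le (u m - u n) i).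
pose l i := sval (ex i); have lP i := svalP (ex i).
have key (e : R[i]) N : 0 < e -> (forall m n, (N <= m)%N -> (N <= n)%N ->
     `|u m - u n| < e) ->
   forall n, (N <= n)%N -> forall A : {fset I},
     \sum_(i <- A) `|u n i - l i| ^+ 2 <= e ^+ 2.
  move=> e0 NP n Nn A.
  have : \sum_(i <- A) `|u n i - u m i| ^+ 2 @[m --> \oo] -->
         \sum_(i <- A) `|u n i - l i| ^+ 2.
    apply: (@cvg_big R[i] I +%R) => [|i _]; first exact: add_continuous.
    have h : `|u n i - u m i| @[m --> \oo] --> `|u n i - l i|.
      by apply: cvg_norm; apply: cvgB; [exact: cvg_cst | exact: lP].
    by rewrite expr2; under eq_fun do rewrite expr2; exact: cvgM.
  move/complex_lim_le; apply; exists N => // m /= Nm.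
  apply: le_trans (dsum_inner_ge (u n - u m) A) _.
  by rewrite -dsum_normK ler_pXn2r ?nnegrE ?(ltW e0)//; exact/ltW/NP.
have lb : exists M : R[i], forall A : {fset I}, \sum_(i <- A) `|l i| ^+ 2 <= M.
  have [N NP] := cu 1 ltr01.
  have [M MP] := dsum_bounded (u N).
  exists (2%:R * (1 + M)) => A.
  apply: le_trans (_ : \sum_(i <- A) 2%:R * (`|u N i - l i| ^+ 2 + `|u N i| ^+ 2) <= _).
    apply: ler_sum => i _.
    have := sqr_normD_le (l i - u N i) (u N i).
    by rewrite subrK distrC.
  rewrite -mulr_sumr big_split/= ler_pM2l// lerD//.
  by rewrite -(expr1n _ 2); exact: (key 1 N).
exists (DSum lb) => e e0; have e20 : 0 < e / 2 by rewrite divr_gt0.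
have [N NP] := cu _ e20; exists N => n Nn.
apply: (@le_lt_trans _ _ (e / 2)); last first.
  by rewrite ltr_pdivrMr// ltr_pMr// ltr1n.
rewrite -(@ler_pXn2r _ 2) ?nnegrE ?(ltW e20)// dsum_normK.
by apply: dsum_inner_le => A; exact: (key _ N).
Qed.

HB.instance Definition _ := PreHilbert_isHilbert.Build R dsum dsum_complete.
End direct_sum.

Record semi_space (R : realType) := SemiSpace {
  semi_car :> choiceType;
  semi_zero : semi_car;
  semi_add : semi_car -> semi_car -> semi_car;
  semi_scale : R[i] -> semi_car -> semi_car;
  semi_form : semi_car -> semi_car -> R[i];
  semi_form0 : forall u, semi_form u semi_zero = 0;
  semi_formD : forall u v w,
    semi_form u (semi_add v w) = semi_form u v + semi_form u w;
  semi_formZ : forall a u v, semi_form u (semi_scale a v) = a * semi_form u v;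
  semi_formC : forall u v, semi_form v u = (semi_form u v)^*;
  semi_form_ge0 : forall u, 0 <= semi_form u u
}.

Section separation.
Variables (R : realType) (W : semi_space R).
Implicit Types u v w : W.

(* By Cauchy-Schwarz, u and v are equivalent iff u - v has norm zero. *)
Definition semi_eq u v : bool := `[< forall w, semi_form w u = semi_form w v >].

Fact semi_eq_refl : reflexive semi_eq.
Proof. by move=> u; apply/asboolP. Qed.
Fact semi_eq_sym : symmetric semi_eq.
Proof. by move=> u v; apply/asboolP/asboolP => h w; rewrite h. Qed.
Fact semi_eq_trans : transitive semi_eq.
Proof. by move=> u v w /asboolP h1 /asboolP h2; apply/asboolP => z; rewrite h1. Qed.

Definition semi_equiv := EquivRel semi_eq semi_eq_refl semi_eq_sym semi_eq_trans.

Definition separated := {eq_quot semi_equiv}%qT.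
HB.instance Definition _ := EqQuotient.on separated.
HB.instance Definition _ := Choice.on separated.

Definition sep_class u : separated := (\pi_separated u)%qT.
Definition sep_inner (x y : separated) : R[i] := semi_form (repr x) (repr y).

Lemma sep_classP u v :
  sep_class u = sep_class v <-> forall w, semi_form w u = semi_form w v.
Proof.
by split=> [/eqmodP/asboolP//|h]; apply/eqmodP/asboolP.
Qed.

Lemma sep_ind (P : separated -> Prop) : (forall u, P (sep_class u)) -> forall x, P x.
Proof. by move=> h x; rewrite -[x]reprK; exact: h. Qed.

Lemma sep_innerE u v : sep_inner (sep_class u) (sep_class v) = semi_form u v.
Proof.
have h w : sep_class (repr (sep_class w)) = sep_class w by rewrite /sep_class reprK.
have /sep_classP hu := h u; have /sep_classP hv := h v.
by rewrite /sep_inner hv semi_formC hu -semi_formC.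
Qed.

Definition sep0 : separated := sep_class (semi_zero W).
Definition sep_add (x y : separated) := sep_class (semi_add (repr x) (repr y)).
Definition sep_scale a (x : separated) := sep_class (semi_scale a (repr x)).
Definition sep_opp (x : separated) := sep_scale (- 1) x.

Lemma sep_reprE w u : semi_form w (repr (sep_class u)) = semi_form w u.
Proof. by move: w; apply/sep_classP; rewrite /sep_class reprK. Qed.

Lemma sep_ext (x y : separated) :
  (forall w, semi_form w (repr x) = semi_form w (repr y)) -> x = y.
Proof. by move=> /sep_classP; rewrite /sep_class !reprK. Qed.

Let simp := (sep_reprE, semi_formD, semi_formZ, semi_form0).

Fact sep_addA : associative sep_add.
Proof. by move=> x y z; apply: sep_ext => w; rewrite !simp addrA. Qed.
Fact sep_addC : commutative sep_add.
Proof. by move=> x y; apply: sep_ext => w; rewrite !simp addrC. Qed.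
Fact sep_add0 : left_id sep0 sep_add.
Proof. by move=> x; apply: sep_ext => w; rewrite !simp add0r. Qed.
Fact sep_addN : left_inverse sep0 sep_opp sep_add.
Proof. by move=> x; apply: sep_ext => w; rewrite !simp mulN1r addNr. Qed.
HB.instance Definition _ :=
  GRing.isZmodule.Build separated sep_addA sep_addC sep_add0 sep_addN.

Fact sep_scaleA a b x : sep_scale a (sep_scale b x) = sep_scale (a * b) x.
Proof. by apply: sep_ext => w; rewrite !simp mulrA. Qed.
Fact sep_scale1 : left_id 1 sep_scale.
Proof. by move=> x; apply: sep_ext => w; rewrite !simp mul1r. Qed.
Fact sep_scaleDr : right_distributive sep_scale +%R.
Proof. by move=> a x y; apply: sep_ext => w; rewrite !simp mulrDr. Qed.
Fact sep_scaleDl x : {morph sep_scale^~ x : a b / a + b}.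
Proof. by move=> a b; apply: sep_ext => w; rewrite !simp mulrDl. Qed.
HB.instance Definition _ := GRing.Zmodule_isLmodule.Build R[i] separated
  sep_scaleA sep_scale1 sep_scaleDr sep_scaleDl.

Fact sep_innerDr x y z : sep_inner x (y + z) = sep_inner x y + sep_inner x z.
Proof. by rewrite /sep_inner !simp. Qed.
Fact sep_innerZr a x y : sep_inner x (a *: y) = a * sep_inner x y.
Proof. by rewrite /sep_inner !simp. Qed.
Fact sep_innerC x y : sep_inner y x = (sep_inner x y)^*.
Proof. exact: semi_formC. Qed.
Fact sep_inner_ge0 x : 0 <= sep_inner x x.
Proof. exact: semi_form_ge0. Qed.
Fact sep_inner_eq0 x : sep_inner x x = 0 -> x = 0.
Proof.
move=> x0; apply: sep_ext => w; rewrite !simp.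
have := semi_CS sep_innerDr sep_innerZr sep_innerC sep_inner_ge0 (sep_class w) x.
rewrite x0 mulr0 => h; have : `|sep_inner (sep_class w) x| ^+ 2 == 0.
  by rewrite eq_le h exprn_ge0.
have -> : sep_inner (sep_class w) x = semi_form w (repr x).
  by rewrite /sep_inner semi_formC sep_reprE -semi_formC.
by rewrite expf_eq0/= normr_eq0 => /eqP.
Qed.

HB.instance Definition _ := Lmodule_isPreHilbert.Build R separated
  sep_innerDr sep_innerZr sep_innerC sep_inner_ge0 sep_inner_eq0.

End separation.

Section completion.
Variables (R : realType) (V : prehilbertType R).

Record cauchy_seq := CauchySeq {
  cauchy_fun :> nat -> V;
  cauchy_seqP : forall e : R[i], 0 < e -> exists N, forall m n,
    (N <= m)%N -> (N <= n)%N -> `|cauchy_fun m - cauchy_fun n| < e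
}.

HB.instance Definition _ := gen_eqMixin cauchy_seq.
HB.instance Definition _ := gen_choiceMixin cauchy_seq.
Implicit Types u v w : cauchy_seq.

Fact cst_cauchy (x : V) (e : R[i]) : 0 < e -> exists N, forall m n,
  (N <= m)%N -> (N <= n)%N -> `|x - x| < e.
Proof. by move=> e0; exists 0 => m n _ _; rewrite subrr normr0. Qed.
Definition cauchy_cst x := CauchySeq (@cst_cauchy x).

Fact add_cauchy u v (e : R[i]) : 0 < e -> exists N, forall m n,
  (N <= m)%N -> (N <= n)%N -> `|(u m + v m) - (u n + v n)| < e.
Proof.
move=> e0; have e20 : 0 < e / 2 by rewrite divr_gt0.
have [N1 P1] := cauchy_seqP u e20; have [N2 P2] := cauchy_seqP v e20.
exists (maxn N1 N2) => m n; rewrite !geq_max => /andP[m1 m2] /andP[n1 n2].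
rewrite opprD addrACA; apply: le_lt_trans (ler_normD _ _) _.
by rewrite [ltRHS]splitr ltrD// ?P1 ?P2.
Qed.
Definition cauchy_add u v := CauchySeq (@add_cauchy u v).

Fact scale_cauchy a u (e : R[i]) : 0 < e -> exists N, forall m n,
  (N <= m)%N -> (N <= n)%N -> `|a *: u m - a *: u n| < e.
Proof.
move=> e0; have a0 : 0 < `|a| + 1 by rewrite ltr_wpDl.
have e20 : 0 < e / (`|a| + 1) by rewrite divr_gt0.
have [N NP] := cauchy_seqP u e20; exists N => m n Nm Nn.
rewrite -scalerBr normrZ; apply: (@le_lt_trans _ _ ((`|a| + 1) * `|u m - u n|)).
  by rewrite ler_wpM2r// lerDl.
by rewrite mulrC -ltr_pdivlMr// NP.
Qed.
Definition cauchy_scale a u := CauchySeq (@scale_cauchy a u).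

Lemma cauchy_seq_bounded u : exists2 M : R[i], 0 < M & forall n, `|u n| <= M.
Proof.
have [N NP] := cauchy_seqP u (@ltr01 R[i]).
exists (1 + \sum_(i < N.+1) `|u i|); first by rewrite ltr_wpDr ?sumr_ge0.
move=> n; have [nN|Nn] := ltnP n N.+1.
  rewrite (bigD1 (Ordinal nN))//= addrCA lerDl addr_ge0// sumr_ge0//.
rewrite (bigD1 (@ord_max N))//=.
apply: (@le_trans _ _ (1 + `|u N|)); last by rewrite lerD2l lerDl sumr_ge0.
rewrite -[u n](subrK (u N)); apply: le_trans (ler_normD _ _) _.
by rewrite lerD2r ltW// NP// ltnW.
Qed.

Definition cauchy_form u v : R[i] := lim (inner (u n) (v n) @[n --> \oo]).

Lemma cauchy_form_cvg u v : inner (u n) (v n) @[n --> \oo] --> cauchy_form u v.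
Proof.
apply: complex_complete; apply: cauchy_exP => e e0.
have [M M0 MP] := cauchy_seq_bounded u; have [L L0 LP] := cauchy_seq_bounded v.
have eM : 0 < e / (2 * M) by rewrite divr_gt0// mulr_gt0.
have eL : 0 < e / (2 * L) by rewrite divr_gt0// mulr_gt0.
have [N1 P1] := cauchy_seqP u eL; have [N2 P2] := cauchy_seqP v eM.
pose N := maxn N1 N2; exists (inner (u N) (v N)); exists N => //= n Nn.
rewrite -ball_normE/=.
have -> : inner (u N) (v N) - inner (u n) (v n) =
    inner (u N - u n) (v N) + inner (u n) (v N - v n).
  rewrite (semiDl innerDr innerC) (semiNl innerZr innerC) innerDr (semiNr innerZr).
  by rewrite addrA subrK.
apply: le_lt_trans (ler_normD _ _) _; rewrite [ltRHS]splitr.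
have N1n : (N1 <= n)%N by apply: leq_trans Nn; rewrite leq_maxl.
have N2n : (N2 <= n)%N by apply: leq_trans Nn; rewrite leq_maxr.
apply: ltrD; apply: le_lt_trans (inner_CS _ _) _.
  apply: le_lt_trans (_ : `|u N - u n| * L < _); first by rewrite ler_wpM2l.
  rewrite -ltr_pdivlMr//; apply: lt_le_trans (P1 _ _ (leq_maxl _ _) N1n) _.
  by rewrite invfM mulrA.
apply: le_lt_trans (_ : M * `|v N - v n| < _); first by rewrite ler_wpM2r.
rewrite mulrC -ltr_pdivlMr//; apply: lt_le_trans (P2 _ _ (leq_maxr _ _) N2n) _.
by rewrite invfM mulrA.
Qed.

Lemma cauchy_formP u v l :
  inner (u n) (v n) @[n --> \oo] --> l -> cauchy_form u v = l.
Proof. by move=> h; apply: (@cvg_lim R[i]) => //; exact: norm_hausdorff. Qed.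

Fact cauchy_form0 u : cauchy_form u (cauchy_cst 0) = 0.
Proof.
apply: cauchy_formP => /=; under eq_fun do rewrite (semi0r innerZr).
exact: cvg_cst.
Qed.

Fact cauchy_formD u v w :
  cauchy_form u (cauchy_add v w) = cauchy_form u v + cauchy_form u w.
Proof.
apply: cauchy_formP => /=; under eq_fun do rewrite innerDr.
by apply: cvgD; exact: cauchy_form_cvg.
Qed.

Fact cauchy_formZ a u v :
  cauchy_form u (cauchy_scale a v) = a * cauchy_form u v.
Proof.
apply: cauchy_formP => /=; under eq_fun do rewrite innerZr.
by apply: cvgMr; exact: cauchy_form_cvg.
Qed.

Fact cauchy_formC u v : cauchy_form v u = (cauchy_form u v)^*.
Proof.
apply: cauchy_formP; have /cvgrPdist_lt h := @cauchy_form_cvg u v.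
apply/cvgrPdist_lt => e e0; apply: filterS (h e e0) => n.
by rewrite (innerC (u n)) -rmorphB norm_conjC.
Qed.

Fact cauchy_form_ge0 u : 0 <= cauchy_form u u.
Proof.
rewrite -oppr_le0; apply: complex_lim_le (cvgN (@cauchy_form_cvg u u)) _.
by apply: nearW => n; rewrite oppr_le0 inner_ge0.
Qed.

Definition cauchy_semi_space : semi_space R :=
  @SemiSpace R cauchy_seq (cauchy_cst 0) cauchy_add cauchy_scale cauchy_form
    cauchy_form0 cauchy_formD cauchy_formZ cauchy_formC cauchy_form_ge0.

Definition completion := separated cauchy_semi_space.
HB.instance Definition _ := PreHilbert.on completion.

Definition completion_in (x : V) : completion :=
  @sep_class R cauchy_semi_space (cauchy_cst x).

Lemma completion_norm_le u v (M : R[i]) : 0 <= M ->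
  (\forall n \near \oo, `|u n - v n| <= M) ->
  `|(@sep_class R cauchy_semi_space u : completion) - @sep_class R cauchy_semi_space v| <= M.
Proof.
move=> M0 uv; rewrite -(@ler_pXn2r _ 2)// ?nnegrE// -inner_norm.
have -> : (@sep_class R cauchy_semi_space u : completion) -
          @sep_class R cauchy_semi_space v =
          @sep_class R cauchy_semi_space (cauchy_add u (cauchy_scale (-1) v)).
  apply/sep_ext => w; rewrite !(sep_reprE, semi_formD, semi_formZ).
  by [].
rewrite [leLHS]sep_innerE.
apply: complex_lim_le (@cauchy_form_cvg _ _) _.
apply: filterS uv => n /= h; rewrite inner_norm scaleN1r.
by rewrite ler_pXn2r ?nnegrE.
Qed.

Fact completion_cauchy_seq_cvg (X : nat -> completion) :
  (forall e : R[i], 0 < e -> exists N, forall m n, (N <= m)%N -> (N <= n)%N ->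
     `|X m - X n| < e) ->
  exists l, forall e : R[i], 0 < e -> exists N, forall n, (N <= n)%N ->
     `|X n - l| < e.
Proof.
move=> cX; pose u n : cauchy_seq := repr (X n).
have uX n : X n = @sep_class R cauchy_semi_space (u n) by rewrite /sep_class reprK.
have ex n : exists k, forall j, (k <= j)%N -> `|u n j - u n k| <= n.+1%:R^-1.
  have [|N NP] := cauchy_seqP (u n) (_ : 0 < n.+1%:R^-1); first by rewrite invr_gt0.
  by exists N => j Nj; apply/ltW/NP.
have [k kP] := choice ex.
pose v n := u n (k n).
have Xv n : `|X n - completion_in (v n)| <= n.+1%:R^-1.
  rewrite uX; apply: completion_norm_le; first by rewrite invr_ge0.
  by exists (k n) => // j /=; exact: kP.
have in_norm x y : `|x - y| <= `|completion_in x - completion_in y|.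
  rewrite -(@ler_pXn2r _ 2)// ?nnegrE// -!inner_norm.
  have -> : completion_in x - completion_in y = completion_in (x - y).
    apply/sep_ext => w; rewrite !(sep_reprE, semi_formD, semi_formZ)/= mulN1r.
    apply/esym/cauchy_formP => /=; under eq_fun do rewrite innerDr (semiNr innerZr).
    by apply: cvgB; exact: cauchy_form_cvg.
  rewrite [leRHS]sep_innerE/= -lerN2.
  by apply: complex_lim_le (cvgN (@cauchy_form_cvg _ _)) _; exact: nearW.
have cv (e : R[i]) : 0 < e -> exists N, forall m n, (N <= m)%N -> (N <= n)%N ->
    `|v m - v n| < e.
  move=> e0; have e30 : 0 < e / 3%:R by rewrite divr_gt0.
  have [N1 P1] := cX _ e30; have [N2 P2] := complex_small e30.
  exists (maxn N1 N2) => m n; rewrite !geq_max => /andP[m1 m2] /andP[n1 n2].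
  apply: le_lt_trans (in_norm _ _) _.
  have -> : completion_in (v m) - completion_in (v n) =
    (completion_in (v m) - X m) + (X m - X n) + (X n - completion_in (v n)).
    by rewrite !addrA !subrK.
  have -> : e = e / 3%:R + e / 3%:R + e / 3%:R by field.
  apply: le_lt_trans (ler_normD _ _) _; apply: ltrD.
    apply: le_lt_trans (ler_normD _ _) _; apply: ltrD; last exact: P1.
    by rewrite distrC; apply: le_lt_trans (Xv m) _; exact: P2.
  by apply: le_lt_trans (Xv n) _; exact: P2.
exists (@sep_class R cauchy_semi_space (CauchySeq cv)) => e e0.
have e20 : 0 < e / 2 by rewrite divr_gt0.
have [N1 P1] := complex_small e20; have [N2 P2] := cv _ e20.
exists (maxn N1 N2) => n; rewrite geq_max => /andP[n1 n2].
rewrite -[X n](subrK (completion_in (v n))) -addrA.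
apply: le_lt_trans (ler_normD _ _) _; rewrite [ltRHS]splitr; apply: ltr_leD.
  by apply: le_lt_trans (Xv n) _; exact: P1.
apply: completion_norm_le; first exact: ltW.
by exists N2 => // j /= Nj; apply/ltW/P2.
Qed.

HB.instance Definition _ :=
  PreHilbert_isHilbert.Build R completion completion_cauchy_seq_cvg.

End completion.

Section positive_kernel.
Variables (R : realType) (T : choiceType) (k : T -> T -> R[i]).

(* The sesquilinear extension of k to formal linear combinations, given as
   lists of pairs (coefficient, element of T). *)
Definition formal_form (u v : seq (R[i] * T)) : R[i] :=
  \sum_(p <- u) \sum_(q <- v) (p.1)^* * q.1 * k p.2 q.2.

Definition positive_kernel : Prop :=
  (forall x y, k y x = (k x y)^*) /\ (forall u, 0 <= formal_form u u).
End positive_kernel.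

Section kernel_space.
Variables (R : realType) (T : choiceType) (k : T -> T -> R[i]).

Definition kernel_or0 : T -> T -> R[i] :=
  if pselect (positive_kernel k) then k else fun _ _ => 0.

Fact kernel_or0_positive : positive_kernel kernel_or0.
Proof.
rewrite /kernel_or0; case: pselect => [|np] //; split=> [x y|u]; first by rewrite rmorph0.
by rewrite /formal_form big1// => p _; rewrite big1// => q _; rewrite mulr0.
Qed.

Let formal := seq (R[i] * T).
Let form : formal -> formal -> R[i] := formal_form kernel_or0.
Definition formal_scale a (u : formal) : formal := [seq (a * p.1, p.2) | p <- u].

Fact formal_form0 u : form u [::] = 0.
Proof. by rewrite /form /formal_form big1// => p _; rewrite big_nil. Qed.

Fact formal_formD u v w : form u (v ++ w) = form u v + form u w.
Proof.
by rewrite /form /formal_form -big_split/=; apply: eq_bigr => p _; rewrite big_cat.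
Qed.

Fact formal_formZ a u v : form u (formal_scale a v) = a * form u v.
Proof.
rewrite /form /formal_form mulr_sumr; apply: eq_bigr => p _.
rewrite mulr_sumr big_map; apply: eq_bigr => q _ /=.
by rewrite !mulrA (mulrC a).
Qed.

Fact formal_formC u v : form v u = (form u v)^*.
Proof.
rewrite /form /formal_form rmorph_sum/=; under [RHS]eq_bigr do rewrite rmorph_sum/=.
rewrite exchange_big/=; apply: eq_bigr => p _; apply: eq_bigr => q _.
by rewrite !rmorphM/= conjCK (kernel_or0_positive.1 p.2) (mulrC q.1^*).
Qed.

Fact formal_form_ge0 u : 0 <= form u u.
Proof. exact: kernel_or0_positive.2. Qed.

Definition formal_space : semi_space R :=
  @SemiSpace R formal [::] (@cat _) formal_scale form
    formal_form0 formal_formD formal_formZ formal_formC formal_form_ge0.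

(* The separated completion of the formal linear combinations of elements of T
   with respect to the sesquilinear extension of k, which must be positive
   semidefinite (otherwise k is replaced by 0). *)
Definition kernel_space : hilbertType R := completion (separated formal_space).

Definition kernel_point (t : T) : kernel_space :=
  completion_in (@sep_class R formal_space [:: (1, t)]).

Lemma kernel_point_inner s t : positive_kernel k ->
  inner (kernel_point s) (kernel_point t) = k s t.
Proof.
move=> kP; rewrite [LHS]sep_innerE/=.
apply: cauchy_formP => /=; rewrite [X in X @ _ --> _](_ : _ = cst (k s t)).
  exact: cvg_cst.
apply/funext => n /=; rewrite [LHS]sep_innerE/= /form /formal_form.
by rewrite !big_seq1/= rmorph1 !mul1r /kernel_or0; case: pselect.
Qed.

End kernel_space.

Section closed_span.
Variables (K : numFieldType) (V : normedModType K).

Definition lspan (Y : set V) : set V :=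
  [set x | exists n (c : 'I_n -> K) (y : 'I_n -> V),
    (forall i, Y (y i)) /\ x = \sum_(i < n) c i *: y i].

Definition cspan (Y : set V) : set V := closure (lspan Y).

Definition closed_subspace (Y : set V) : Prop :=
  [/\ closed Y, Y 0 & forall c x y, Y x -> Y y -> Y (c *: x + y)].
End closed_span.

Section operator_sets.
Variable R : realType.

Definition set_app (H K : hilbertType R) (X : set (bop H K)) : set K :=
  [set (T : bop H K) x | T in X & x in [set: H]].

Definition set_comp (H K L : hilbertType R) (X : set (bop K L))
    (Y : set (bop H K)) : set (bop H L) :=
  [set bop_comp S T | S in X & T in Y].

Definition set_adj (H K : hilbertType R) (X : set (bop H K)) : set (bop K H) :=
  [set adjoint T | T in X].

Definition commutant (H : hilbertType R) (X : set (bop H H)) : set (bop H H) :=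
  [set S | forall T, X T -> bop_comp S T = bop_comp T S].

Definition is_cstar_algebra (H : hilbertType R) (B : set (bop H H)) : Prop :=
  [/\ closed_subspace B,
      forall S T, B S -> B T -> B (bop_comp S T) &
      forall T, B T -> B (adjoint T)].

Definition nondegenerate (H : hilbertType R) (B : set (bop H H)) : Prop :=
  cspan (set_app B) = setT.

Definition unitary (H K : hilbertType R) (T : bop H K) : Prop :=
  bop_comp (adjoint T) T = bop_id H /\ bop_comp T (adjoint T) = bop_id K.
End operator_sets.

Record cbase (R : realType) := CBase {
  cb_space :> hilbertType R;
  cb_alg : set (bop cb_space cb_space);
  cb_dag : set (bop cb_space cb_space);
  cb_alg_cstar : is_cstar_algebra cb_alg;
  cb_dag_cstar : is_cstar_algebra cb_dag;
  cb_alg_nondeg : nondegenerate cb_alg;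
  cb_dag_nondeg : nondegenerate cb_dag;
  cb_commute : forall x y, cb_alg x -> cb_dag y -> bop_comp x y = bop_comp y x
}.

Arguments cb_alg {R} c _.
Arguments cb_dag {R} c _.

Definition cbase_op (R : realType) (b : cbase R) : cbase R :=
  CBase (cb_dag_cstar b) (cb_alg_cstar b) (cb_dag_nondeg b) (cb_alg_nondeg b)
    (fun x y hx hy => esym (cb_commute hy hx)).

Definition is_cmodule (R : realType) (b : cbase R) (H : hilbertType R)
    (beta : set (bop b H)) : Prop :=
  [/\ closed_subspace beta,
      cspan (set_app beta) = setT,
      cspan (set_comp beta (cb_alg b)) = beta &
      cspan (set_comp (set_adj beta) beta) = cb_alg b].

(* rho_beta(x), for x in the commutant of cb_alg b; the operator is unique
   because the vectors xi zeta span a dense subspace of H. *)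
Definition rho (R : realType) (b : cbase R) (H : hilbertType R)
    (beta : set (bop b H)) (x : bop b b) : bop H H :=
  xget 0 [set T : bop H H | forall xi zeta, beta xi -> T (xi zeta) = xi (x zeta)].

(* The data (H, alpha, beta) underlying a C*-(a^dagger, b)-module; note that
   a^dagger and a have the same Hilbert space.  Morphisms, tensor products and
   direct sums only involve these data. *)
Record bimod (R : realType) (a b : cbase R) := BiMod {
  bm_space :> hilbertType R;
  bm_left : set (bop a bm_space);
  bm_right : set (bop b bm_space)
}.

Arguments bm_left {R a b} _ _.
Arguments bm_right {R a b} _ _.

Section cbimodule.
Variables (R : realType) (a b : cbase R).

Definition rho_left (M : bimod a b) (x : bop a a) : bop M M :=
  @rho R (cbase_op a) M (bm_left M) x.
Definition rho_right (M : bimod a b) (y : bop b b) : bop M M :=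
  rho (bm_right M) y.

Definition is_cbimodule (M : bimod a b) : Prop :=
  [/\ @is_cmodule R (cbase_op a) M (bm_left M),
      is_cmodule (bm_right M),
      cspan (set_comp (rho_left M @` cb_alg a) (bm_right M)) = bm_right M &
      cspan (set_comp (rho_right M @` cb_dag b) (bm_left M)) = bm_left M].

Record cbimod := CBiMod {
  cbimod_data :> bimod a b;
  cbimodP : is_cbimodule cbimod_data
}.
End cbimodule.

Section relative_tensor.
Variables (R : realType) (Z H K : hilbertType R).
Variables (beta : set (bop Z H)) (gamma : set (bop Z K)).

Definition rt_kernel (s t : beta * Z * gamma) : R[i] :=
  let: (xi, zeta, eta) := s in let: (xi', zeta', eta') := t in
  inner zeta
    (adjoint (val xi) (val xi' (adjoint (val eta) (val eta' zeta')))).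

(* The relations of the algebraic tensor product hold up to vectors of norm 0,
   so beta (.) Z (.) gamma and the free vector space on beta * Z * gamma have
   the same separated completion.  The kernel is positive for C*-modules. *)
Definition rtensor : hilbertType R := kernel_space rt_kernel.

(* The elementary tensor; 0 unless xi is in beta and eta is in gamma. *)
Definition rt_elem (xi : bop Z H) (zeta : Z) (eta : bop Z K) : rtensor :=
  if (insub xi, insub eta) is (Some xi', Some eta')
  then kernel_point rt_kernel (xi' : beta, zeta, eta' : gamma) else 0.

Definition rt_ket1 (xi : bop Z H) : bop K rtensor :=
  xget 0 [set X : bop K rtensor |
    forall zeta eta, gamma eta -> X (eta zeta) = rt_elem xi zeta eta].

Definition rt_ket2 (eta : bop Z K) : bop H rtensor :=
  xget 0 [set X : bop H rtensor |
    forall xi zeta, beta xi -> X (xi zeta) = rt_elem xi zeta eta].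
End relative_tensor.

Section morphisms.
Variables (R : realType) (a b : cbase R) (M N : bimod a b).

Definition is_morphism (T : bop M N) : Prop :=
  [/\ forall xi, bm_left M xi -> bm_left N (bop_comp T xi),
      forall xi, bm_left N xi -> bm_left M (bop_comp (adjoint T) xi),
      forall xi, bm_right M xi -> bm_right N (bop_comp T xi) &
      forall xi, bm_right N xi -> bm_right M (bop_comp (adjoint T) xi)].

Definition is_isomorphism (T : bop M N) : Prop := unitary T /\ is_morphism T.
End morphisms.

Section tensor.
Variables (R : realType) (a b c : cbase R) (M : bimod a b) (N : bimod b c).

Let tensor_space : hilbertType R := rtensor (bm_right M) (bm_left N).

Definition elem (xi : bop b M) (zeta : b) (eta : bop b N) : tensor_space :=
  rt_elem (bm_right M) (bm_left N) xi zeta eta.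
Definition ket1 (xi : bop b M) : bop N tensor_space :=
  rt_ket1 (bm_right M) (bm_left N) xi.
Definition ket2 (eta : bop b N) : bop M tensor_space :=
  rt_ket2 (bm_right M) (bm_left N) eta.

Definition tensor : bimod a c :=
  @BiMod R a c tensor_space
    (cspan (set_comp (ket2 @` bm_left N) (bm_left M)))
    (cspan (set_comp (ket1 @` bm_right M) (bm_right N))).
End tensor.

Arguments elem {R a b c} M N xi zeta eta.
Arguments ket1 {R a b c} M N xi.
Arguments ket2 {R a b c} M N eta.

Section op_tensor.
Variables (R : realType) (a b c : cbase R).
Variables (M1 M2 : bimod a b) (N1 N2 : bimod b c).
Variables (S : bop M1 M2) (T : bop N1 N2).

Definition is_op_tensor (X : bop (tensor M1 N1) (tensor M2 N2)) : Prop :=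
  forall xi zeta eta, bm_right M1 xi -> bm_left N1 eta ->
    X (elem M1 N1 xi zeta eta) = elem M2 N2 (bop_comp S xi) zeta (bop_comp T eta).

Definition op_tensor : bop (tensor M1 N1) (tensor M2 N2) := xget 0 is_op_tensor.
End op_tensor.

Arguments is_op_tensor {R a b c M1 M2 N1 N2} S T X.
Arguments op_tensor {R a b c M1 M2 N1 N2} S T.

Definition unit_bimod (R : realType) (b : cbase R) : bimod b b :=
  @BiMod R b b b (cb_dag b) (cb_alg b).

Section dsum_operators.
Variables (R : realType) (I : choiceType) (H : I -> hilbertType R).

Fact dsum_proj_linear i : linear (fun x : dsum H => x i).
Proof. by []. Qed.
Fact dsum_proj_continuous i : continuous (fun x : dsum H => x i).
Proof.
pose f : {linear dsum H -> H i} := HB.pack (fun x : dsum H => x i)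
  (GRing.isLinear.Build R[i] (dsum H) (H i) *:%R (fun x : dsum H => x i) (@dsum_proj_linear i)).
apply: (@bounded_linear_continuous _ _ _ f); apply/linear_boundedP.
near=> r => x; apply: (@le_trans _ _ (1 * `|x|)); last first.
  by rewrite ler_wpM2r//; near: r; exact: nbhs_pinfty_ge.
rewrite mul1r -(@ler_pXn2r _ 2)// ?nnegrE// dsum_normK.
exact: dsum_coord_le.
Unshelve. all: by end_near. Qed.
Definition dsum_proj i : bop (dsum H) (H i) :=
  Bop (@dsum_proj_linear i) (@dsum_proj_continuous i).

Lemma dsum_incl_sum i (x : H i) (A : {fset I}) :
  \sum_(j <- A) `|dfwith (fun j => 0 : H j) i x j| ^+ 2 <= `|x| ^+ 2.
Proof.
have [iA|iA] := boolP (i \in A).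
  rewrite (big_fsetD1 i)//= dfwithin big_seq big1 ?addr0// => j.
  rewrite !inE => /andP[ji _]; rewrite dfwithout 1?eq_sym//.
  by rewrite normr0 expr0n.
rewrite big_seq big1 ?exprn_ge0// => j jA.
rewrite dfwithout ?normr0 ?expr0n//.
by apply: contraNneq iA => ->.
Qed.

Definition dsum_incl_fun i (x : H i) : dsum H :=
  DSum (ex_intro _ (`|x| ^+ 2) (dsum_incl_sum x)).

Fact dsum_incl_linear i : linear (@dsum_incl_fun i).
Proof.
move=> c x y; apply: dsumP => j /=.
have [<-|ij] := eqVneq i j; first by rewrite !dfwithin.
by rewrite !dfwithout// scaler0 addr0.
Qed.
Fact dsum_incl_continuous i : continuous (@dsum_incl_fun i).
Proof.
pose f : {linear H i -> dsum H} := HB.pack (@dsum_incl_fun i)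
  (GRing.isLinear.Build R[i] (H i) (dsum H) *:%R (@dsum_incl_fun i) (@dsum_incl_linear i)).
apply: (@bounded_linear_continuous _ _ _ f); apply/linear_boundedP.
near=> r => x; apply: (@le_trans _ _ (1 * `|x|)); last first.
  by rewrite ler_wpM2r//; near: r; exact: nbhs_pinfty_ge.
rewrite mul1r -(@ler_pXn2r _ 2)// ?nnegrE// dsum_normK.
by apply: dsum_inner_le => A; exact: dsum_incl_sum.
Unshelve. all: by end_near. Qed.
Definition dsum_incl i : bop (H i) (dsum H) :=
  Bop (@dsum_incl_linear i) (@dsum_incl_continuous i).

Definition dsum_ops (Z : hilbertType R) (alpha : forall i, set (bop Z (H i))) :
    set (bop Z (dsum H)) :=
  cspan [set T : bop Z (dsum H) | exists xi : forall i, bop Z (H i),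
    [/\ forall i, alpha i (xi i), finite_set [set i | xi i != 0] &
        forall zeta i, T zeta i = xi i zeta]].
End dsum_operators.

Definition dsum_bimod (R : realType) (a b : cbase R) (I : choiceType)
    (M : I -> bimod a b) : bimod a b :=
  @BiMod R a b (dsum (fun i => bm_space (M i)))
    (dsum_ops (fun i => bm_left (M i))) (dsum_ops (fun i => bm_right (M i))).

Definition bimod_incl (R : realType) (a b : cbase R) (I : choiceType)
    (M : I -> bimod a b) (i : I) : bop (M i) (dsum_bimod M) :=
  dsum_incl (fun i => bm_space (M i)) i.

Definition bimod_proj (R : realType) (a b : cbase R) (I : choiceType)
    (M : I -> bimod a b) (i : I) : bop (dsum_bimod M) (M i) :=
  dsum_proj (fun i => bm_space (M i)) i.

(* Main.v *)
(* All maps in the proposition are prescribed on total families of vectors, so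
   everything reduces to comparing inner products of elementary tensors.  The
   one analytic input is a Schur product theorem: if the Gram operators
   xi_i^* y xi_j (with y positive) commute with the eta_k^* eta_l, then
   sum_(i,j) <xi_i zeta_i | y xi_j eta_i^* eta_j zeta_j> >= 0.
   With y = 1 it says that the kernel defining the relative tensor product is
   positive; with y = |A|^2 - A^* A it bounds |xi>_1, |eta>_2 and the operators
   S (x) T.

   Since |xi>_1^* |xi'>_1 = rho_gamma(xi^* xi') and symmetrically for |eta>_2,
   associativity amounts to rho_gamma(xi^* xi') commuting with
   rho_delta(theta^* theta') on K.  For direct sums, the operators
   iota_i (x) iota_j are isometries with orthogonal ranges that together span
   the tensor product of the sums.  Module structures are compared on
   generators, using identities such as (S (x) T) |eta>_2 = |T eta>_2 S. *)
Require Import Defs.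
From HB Require Import structures.
From mathcomp Require Import all_boot all_order all_algebra finmap complex.
From mathcomp Require Import all_classical all_reals all_analysis summability.
From mathcomp Require Import ring.
Import Order.TTheory GRing.Theory Num.Theory.
Import numFieldNormedType.Exports.
Local Open Scope classical_set_scope.
Local Open Scope ring_scope.
Set Implicit Arguments.
Unset Strict Implicit.
Unset Printing Implicit Defensive.

(** A standard proof of the Schur product theorem takes the square root of the Gram matrix
    [(xi_i^* y xi_j)], whose entries still commute with every [eta_p^* eta_q]. Here no square root
    is formed: [y] is lowered step by step by multiples of [E T E], where [T] is the sum of the
    [xi_k xi_k^*]. Such a correction factors through the operators [xi_k^* E xi_j], which keep the
    commutation property, so it contributes a sum of square norms to the form, and the remaining
    part is made small. A second obstacle is that adjoints, kets, [rho] and tensor products of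
    operators are chosen by [xget]: nothing is known about them before a solution of the defining
    equation is constructed. Adjoints come from the Riesz theorem; the other solutions are traced
    back to operators prescribed on a total family and bounded on its linear combinations. Totality
    also gives uniqueness, which identifies the chosen operator with any solution at hand. *)

Section inner_product.
Variables (R : realType) (H : hilbertType R).
Implicit Types (x y z : H) (a : R[i]).

Lemma innerDl x y z : inner (x + y) z = inner x z + inner y z.
Proof. exact: (semiDl innerDr innerC). Qed.
Lemma innerZl a x y : inner (a *: x) y = a^* * inner x y.
Proof. exact: (semiZl innerZr innerC). Qed.
Lemma inner0r x : inner x 0 = 0.
Proof. exact: (semi0r innerZr). Qed.
Lemma inner0l x : inner 0 x = 0.
Proof. by rewrite innerC inner0r rmorph0. Qed.
Lemma innerNr x y : inner x (- y) = - inner x y.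
Proof. exact: (semiNr innerZr). Qed.
Lemma innerNl x y : inner (- x) y = - inner x y.
Proof. exact: (semiNl innerZr innerC). Qed.
Lemma innerBr x y z : inner x (y - z) = inner x y - inner x z.
Proof. by rewrite innerDr innerNr. Qed.
Lemma innerBl x y z : inner (x - y) z = inner x z - inner y z.
Proof. by rewrite innerDl innerNl. Qed.

Lemma inner_sumr I (r : seq I) (P : pred I) (F : I -> H) x :
  inner x (\sum_(i <- r | P i) F i) = \sum_(i <- r | P i) inner x (F i).
Proof.
by elim/big_rec2: _ => [|i y z _ <-]; rewrite ?inner0r ?innerDr.
Qed.

Lemma inner_suml I (r : seq I) (P : pred I) (F : I -> H) x :
  inner (\sum_(i <- r | P i) F i) x = \sum_(i <- r | P i) inner (F i) x.
Proof.
by elim/big_rec2: _ => [|i y z _ <-]; rewrite ?inner0l ?innerDl.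
Qed.

Lemma inner_ext x y : (forall z, inner z x = inner z y) -> x = y.
Proof.
move=> h; apply/eqP; rewrite -subr_eq0 -normr_eq0 -sqrf_eq0 -inner_norm.
by rewrite innerBr h subrr.
Qed.

Lemma inner_real x : (inner x x)^* = inner x x.
Proof. by rewrite -innerC. Qed.

Lemma inner_sum_sum (T T' : Type) (f : T -> H) (g : T' -> H) u v :
  inner (\sum_(p <- u) p.1 *: f p.2) (\sum_(q <- v) q.1 *: g q.2) =
  \sum_(p <- u) \sum_(q <- v) p.1^* * q.1 * inner (f p.2) (g q.2).
Proof.
rewrite inner_suml; apply: eq_bigr => p _; rewrite inner_sumr.
by apply: eq_bigr => q _; rewrite innerZl innerZr mulrA.
Qed.
End inner_product.

(** * Approximation in norm and construction of bounded operators *)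

Lemma closure_normP (R : realType) (V : normedModType R[i]) (A : set V) (x : V) :
  closure A x <-> forall e : R[i], 0 < e -> exists2 y, A y & `|x - y| < e.
Proof.
split=> [Ax e e0|h B].
  have [y [Ay]] := Ax _ (nbhsx_ballx x e e0).
  by rewrite -ball_normE/=; exists y.
rewrite -nbhs_ballE => -[e/= e0 eB]; have [y Ay xy] := h e e0.
by exists y; split => //; apply: eB; rewrite -ball_normE.
Qed.

Lemma le_small (R : realType) (x M : R[i]) :
  0 <= M -> 0 <= x -> (forall e : R[i], 0 < e -> x <= e * M) -> x = 0.
Proof.
move=> M0 x0 h; apply/eqP; rewrite eq_le x0 andbT.
have M1 : 0 < M + 1 by rewrite ltr_wpDl.
rewrite real_leNgt ?ger0_real//; apply/negP => xp.
have := h (x / (M + 1)); rewrite divr_gt0// => /(_ isT).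
rewrite mulrAC ler_pdivlMr// ler_pM2l//.
by rewrite gerDl ler10.
Qed.

Lemma norm_eq0_small (R : realType) (V : normedModType R[i]) (x : V) (M : R[i]) :
  0 <= M -> (forall e : R[i], 0 < e -> `|x| <= e * M) -> x = 0.
Proof. by move=> M0 h; apply/normr0_eq0/(le_small M0). Qed.

Section bounded_maps.
Variables (R : realType) (H K : hilbertType R).

Lemma mk_bop (f : H -> K) (M : R[i]) : 0 <= M ->
  linear f -> (forall x, `|f x| <= M * `|x|) ->
  exists T : bop H K, forall x, T x = f x.
Proof.
move=> M0 f_lin fM.
pose g : {linear H -> K} := HB.pack f (GRing.isLinear.Build R[i] H K *:%R f f_lin).
suff cf : continuous f by exists (Bop f_lin cf).
apply: (@bounded_linear_continuous _ _ _ g); apply/linear_boundedP.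
near=> r => x; apply: le_trans (fM x) _.
rewrite ler_wpM2r//; near: r; apply: nbhs_pinfty_ge; exact: ger0_real.
Unshelve. all: by end_near. Qed.
End bounded_maps.

(** * The Riesz representation theorem and adjoints *)

Section riesz.
Variables (R : realType) (H : hilbertType R) (f : H -> R[i]) (M : R[i]).
Hypothesis f_lin : forall a x y, f (a *: x + y) = a * f x + f y.
Hypothesis fM : forall x, `|f x| <= M * `|x|.
Hypothesis M0 : 0 <= M.

Let G x : R[i] := f x + (f x)^* - inner x x.
Let g x : R := complex.Re (G x).

Let gE x : (g x)%:C%C = G x.
Proof.
rewrite /g RRe_real// CrealE /G rmorphB rmorphD/= conjCK (addrC (f x)).
by rewrite -innerC.
Qed.

Let G_le x : G x <= M ^+ 2.
Proof.
rewrite /G inner_norm.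
have h : f x + (f x)^* <= M * `|x| *+ 2.
  have -> : f x + (f x)^* = 'Re (f x) *+ 2.
    by rewrite ReE -mulr_natr divfK ?pnatr_eq0.
  rewrite lerMn2r/=; apply: le_trans (fM x).
  apply: le_trans (leif_normC_Re_Creal (f x)).1.
  by rewrite real_ler_norm ?Creal_Re.
rewrite -subr_ge0.
have -> : M ^+ 2 - (f x + (f x)^* - `|x| ^+ 2) =
   (M - `|x|) ^+ 2 + (M * `|x| *+ 2 - (f x + (f x)^*)) by ring.
rewrite addr_ge0 ?subr_ge0// real_exprn_even_ge0// realB ?normr_real//.
exact: ger0_real.
Qed.

(* An almost maximiser u of x |-> 2 Re f x - |x|^2 almost represents f. *)
Let riesz_approx (e : R[i]) : 0 < e ->
  exists u, forall x, `|inner u x - f x| <= e * `|x|.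
Proof.
move=> e0.
have := gtr0_real (exprn_gt0 2 e0) => /complex_realP[r re].
have r0 : 0 < r by rewrite -ltcR -re exprn_gt0.
have hs : has_sup (range g).
  split; first by exists (g 0), 0.
  exists (complex.Re (M ^+ 2)) => _ [x _ <-].
  rewrite -lecR gE RRe_real ?G_le// ger0_real// exprn_ge0//.
have [_ [u _ <-] gu] := sup_adherent r0 hs.
exists u => x; have [->|x0] := eqVneq x 0.
  have f0 : f 0 = 0.
    by have := f_lin (-1) 0 0; rewrite scaler0 addr0 mulN1r addNr.
  by rewrite inner0r f0 subrr !normr0 mulr0.
set w := inner u x - f x.
pose n2 := inner x x.
have n0 : 0 < n2 by rewrite /n2 inner_norm exprn_gt0// normr_gt0.
(* This [t] maximises [G (t *: x + u)]; the gain over [G u] is [|w|^2 / |x|^2], which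
   near-maximality of [u] keeps below [e ^+ 2]. *)
pose t := - n2^-1 * w^*.
have Gt : G (t *: x + u) = G u + n2^-1 * (w * w^*).
  have n2c : (n2^-1)^* = n2^-1 by rewrite /n2 fmorphV/= inner_real.
  have tc : t^* = - n2^-1 * w by rewrite /t rmorphM rmorphN/= n2c conjCK.
  rewrite /G f_lin rmorphD rmorphM/= innerDr !innerDl !innerZr !innerZl.
  rewrite (innerC u x) tc -/n2.
  have -> : f x = inner u x - w by rewrite /w; ring.
  rewrite rmorphB/=.
  have -> : - n2^-1 * w * n2 = - w by field; exact: lt0r_neq0.
  by rewrite /t; ring.
have h : G (t *: x + u) <= (sup (range g))%:C%C.
  by rewrite -gE lecR; apply: (sup_upper_bound hs); exists (t *: x + u).
have h2 : (sup (range g))%:C%C < G u + e ^+ 2.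
  by rewrite re -gE -rmorphD/= ltcR -ltrBlDr.
have := le_lt_trans h h2; rewrite Gt ltrD2l => h3.
rewrite -(@ler_pXn2r _ 2)// ?nnegrE ?mulr_ge0 ?(ltW e0)//.
rewrite normCK exprMn -inner_norm -ler_pdivrMr// mulrC; exact: ltW.
Qed.

(** The approximate representers form a Cauchy sequence: the square norm of [u m - u n] is the
    difference of two representation errors at that same vector. Their limit represents [f]
    exactly. *)
Lemma riesz : exists y, forall x, f x = inner y x.
Proof.
have ex (n : nat) : exists u, forall x, `|inner u x - f x| <= n.+1%:R^-1 * `|x|.
  by apply: riesz_approx; rewrite invr_gt0.
have [u uP] := choice ex.
have uB m n : `|u m - u n| <= m.+1%:R^-1 + n.+1%:R^-1.
  have [->|x0] := eqVneq (u m - u n) 0.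
    by rewrite normr0 addr_ge0// invr_ge0.
  rewrite -(@ler_pM2r _ `|u m - u n|) ?normr_gt0//.
  rewrite -expr2 -inner_norm -[leLHS]ger0_norm ?inner_ge0//.
  rewrite {1}innerBl.
  rewrite (_ : _ - _ = (inner (u m) (u m - u n) - f (u m - u n)) -
                       (inner (u n) (u m - u n) - f (u m - u n))); last by ring.
  by apply: le_trans (ler_normB _ _) _; rewrite mulrDl lerD.
have [l /cvgrPdist_lt lP] : exists l : H, u @ \oo --> l.
  apply: hilbert_cvg => e e0; have e20 : 0 < e / 2 by rewrite divr_gt0.
  have [N NP] := complex_small e20; exists N => m n Nm Nn.
  apply: le_lt_trans (uB m n) _.
  by rewrite [ltRHS]splitr; apply: ltrD; apply: NP.
exists l => x; apply/eqP; rewrite eq_sym -subr_eq0; apply/eqP.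
apply: (@norm_eq0_small R R[i]^o _ (2 * `|x|)); first by rewrite mulr_ge0.
move=> e e0.
have [N NP] := complex_small e0; have [N' _ N'P] := lP e e0.
pose n := maxn N N'.
rewrite (_ : _ - _ = inner (l - u n) x + (inner (u n) x - f x)); last first.
  by rewrite innerBl; ring.
apply: le_trans (ler_normD _ _) _.
rewrite mulrA mulrDr mulr1 mulrDl lerD//.
  apply: le_trans (inner_CS _ _) _; rewrite ler_wpM2r//.
  by apply/ltW/N'P; rewrite /= leq_maxr.
apply: le_trans (uP n x) _; rewrite ler_wpM2r//.
by apply/ltW/NP; rewrite leq_maxl.
Qed.
End riesz.

Section adjoints.
Variables (R : realType).
Implicit Types H K L : hilbertType R.

(** The Riesz theorem yields the value of the adjoint at each vector; linearity follows because a
    vector is determined by its inner products. *)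
Lemma adjointE H K (T : bop H K) x y : inner (adjoint T y) x = inner y (T x).
Proof.
suff ex : exists S : bop K H, forall x y, inner (S y) x = inner y (T x).
  exact: (xgetPex 0 ex x y).
have ex1 y' : exists z, forall x', inner y' (T x') = inner z x'.
  apply: (@riesz _ _ _ (`|y'| * opnorm T)) => [a u v|u|].
  - by rewrite linearP innerDr innerZr.
  - apply: le_trans (inner_CS _ _) _; rewrite -mulrA ler_wpM2l//; exact: opnormP.
  - by rewrite mulr_ge0// opnorm_ge0.
have [f fP] := choice ex1.
have [|||S SP] := @mk_bop _ K H f (opnorm T); first exact: opnorm_ge0.
- move=> a u v; apply: inner_ext => z.
  rewrite innerDr innerZr !(innerC (f _) z) -!fP innerDl innerZl.
  by rewrite rmorphD rmorphM/= conjCK.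
(* The bound comes from [|f u|^2 = <u, T (f u)>] after division by [|f u|]. *)
- move=> u; have [->|fu0] := eqVneq (f u) 0; first by rewrite normr0 mulr_ge0 ?opnorm_ge0.
  rewrite -(@ler_pM2r _ `|f u|) ?normr_gt0//.
  rewrite -expr2 -inner_norm -fP -[leLHS]ger0_norm; last by rewrite fP inner_ge0.
  apply: le_trans (inner_CS _ _) _.
  by rewrite [leRHS]mulrAC -mulrA mulrCA mulrC mulrA ler_wpM2r// mulrC opnormP.
by exists S => x' y'; rewrite SP -fP.
Qed.

Lemma adjointEr H K (T : bop H K) x y : inner x (adjoint T y) = inner (T x) y.
Proof. by rewrite innerC adjointE -innerC. Qed.

Lemma adjoint_eq H K (T : bop H K) (S : bop K H) :
  (forall x y, inner (S y) x = inner y (T x)) -> adjoint T = S.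
Proof.
move=> h; apply: bopP => y; apply: inner_ext => x.
by rewrite innerC adjointE -h -innerC.
Qed.

Lemma adjointK H K (T : bop H K) : adjoint (adjoint T) = T.
Proof. by apply: adjoint_eq => x y; rewrite adjointEr. Qed.

Lemma adjoint_comp H K L (S : bop K L) (T : bop H K) :
  adjoint (bop_comp S T) = bop_comp (adjoint T) (adjoint S).
Proof. by apply: adjoint_eq => x y /=; rewrite !adjointE. Qed.

Lemma adjoint_normK H K (T : bop H K) x : inner x (adjoint T (T x)) = `|T x| ^+ 2.
Proof. by rewrite adjointEr inner_norm. Qed.
End adjoints.

(** * Closed spans and extension of isometries *)

Section closed_spans.
Variable R : realType.
Implicit Types V W : normedModType R[i].

Lemma closed_normP V (A : set V) :
  (forall x, (forall e : R[i], 0 < e -> exists2 y, A y & `|x - y| < e) -> A x) ->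
  closed A.
Proof. by move=> h x /closure_normP /h. Qed.

Lemma lspan_incl V (Y : set V) x : Y x -> lspan Y x.
Proof.
move=> Yx; exists 1%N, (fun=> 1), (fun=> x); split=> //.
by rewrite big_ord1 scale1r.
Qed.

Lemma lspan_min V (Y P : set V) : P 0 ->
  (forall c x y, P x -> P y -> P (c *: x + y)) -> Y `<=` P -> lspan Y `<=` P.
Proof.
move=> P0 PD YP _ [n [c [y [Yy ->]]]].
elim/big_rec: _ => // i x _ Px; apply: PD => //; exact: YP.
Qed.

Lemma lspanP V (Y : set V) c x y :
  lspan Y x -> lspan Y y -> lspan Y (c *: x + y).
Proof.
move=> [n [a [u [Yu ->]]]] [m [b [v [Yv ->]]]].
exists (n + m)%N,
  (fun i => match fintype.split i with inl j => c * a j | inr k => b k end),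
  (fun i => match fintype.split i with inl j => u j | inr k => v k end).
split=> [i|]; first by case: fintype.split.
rewrite big_split_ord/=; congr (_ + _); last first.
  by apply: eq_bigr => i _; rewrite (unsplitK (inr _)).
rewrite scaler_sumr; apply: eq_bigr => i _.
by rewrite (unsplitK (inl _)) scalerA.
Qed.

Lemma lspan0 V (Y : set V) : lspan Y 0.
Proof.
by exists 0%N, (fun=> 0), (fun=> 0); split=> [[]//|]; rewrite big_ord0.
Qed.

Lemma cspan_incl V (Y : set V) : Y `<=` cspan Y.
Proof. by move=> x /lspan_incl; exact: subset_closure. Qed.

Lemma closed_subspaceT V : closed_subspace [set: V].
Proof. by split=> //; exact: closedT. Qed.

Lemma closed_subspace0 V : closed_subspace [set (0 : V)].
Proof.
split=> [|//|c x y -> ->]; last by rewrite scaler0 addr0.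
apply: closed_normP => x h; apply: (@norm_eq0_small _ _ _ 1) => // e /h [_ ->].
by rewrite subr0 mulr1 => /ltW.
Qed.

Lemma closed_subspace_cspan V (Y : set V) : closed_subspace (cspan Y).
Proof.
split; [exact: closed_closure|exact/subset_closure/lspan0|].
move=> c x y /closure_normP hx /closure_normP hy; apply/closure_normP => e e0.
have c0 : 0 < `|c| + 1 by rewrite ltr_wpDl.
have e20 : 0 < e / 2 by rewrite divr_gt0.
have [x' Yx' xx'] := hx _ (divr_gt0 e20 c0); have [y' Yy' yy'] := hy _ e20.
exists (c *: x' + y'); first exact: lspanP.
rewrite opprD addrACA -scalerBr; apply: le_lt_trans (ler_normD _ _) _.
rewrite [ltRHS]splitr ler_ltD// normrZ.
apply: (@le_trans _ _ ((`|c| + 1) * `|x - x'|)); first by rewrite ler_wpM2r// lerDl.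
by rewrite mulrC -ler_pdivlMr// ltW.
Qed.

Lemma cspan_min V (Y P : set V) : closed_subspace P -> Y `<=` P -> cspan Y `<=` P.
Proof.
move=> [cP P0 PD] YP x /closure_normP h; apply/cP/closure_normP => e /h[y yY ?].
by exists y => //; exact: lspan_min yY.
Qed.

Lemma cspan_mono V (Y Y' : set V) : Y `<=` cspan Y' -> cspan Y `<=` cspan Y'.
Proof. by apply: cspan_min; exact: closed_subspace_cspan. Qed.

Lemma cspan_eq V (Y Y' : set V) :
  Y `<=` cspan Y' -> Y' `<=` cspan Y -> cspan Y = cspan Y'.
Proof. by move=> h h'; apply/seteqP; split; exact: cspan_mono. Qed.

Lemma total_sub V (Y Y' : set V) : cspan Y = setT -> Y `<=` cspan Y' ->
  cspan Y' = setT.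
Proof.
move=> YT YY'; apply/seteqP; split=> // x _.
by apply: (cspan_mono YY'); rewrite YT.
Qed.

(* [f] needs to be linear and bounded on [B] only: this matters for |xi>_1,
   which is 0 for xi outside of beta. *)
Lemma cspan_map_on V W (B Y : set V) (P : set W) (f : V -> W) (M : R[i]) :
  closed_subspace B -> 0 <= M ->
  (forall c x y, B x -> B y -> f (c *: x + y) = c *: f x + f y) ->
  (forall x, B x -> `|f x| <= M * `|x|) ->
  closed_subspace P -> Y `<=` B -> (forall y, Y y -> P (f y)) ->
  forall x, cspan Y x -> P (f x).
Proof.
move=> [cB B0 BD] M0 f_lin fM [cP P0 PD] YB YP x Yx.
(* The preimage of [P] alone need not be closed, since [f] is uncontrolled off [B]; its part inside
   the closed set [B] is. *)
suff : (B `&` f @^-1` P) x by move=> [].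
apply: cspan_min x Yx; last by move=> y Yy; split; [exact: YB | exact: YP].
split.
- apply: closed_normP => x h.
  have Bx : B x by apply/cB/closure_normP => e /h[y [By _] ?]; exists y.
  split=> //; apply/cP/closure_normP => e e0.
  have M1 : 0 < M + 1 by rewrite ltr_wpDl.
  have [y [By Py] xy] := h _ (divr_gt0 e0 M1).
  exists (f y) => //.
  have Bxy : B (x - y) by rewrite addrC -scaleN1r; exact: BD.
  have -> : f x - f y = f (x - y).
    by rewrite (addrC x) -(scaleN1r y) f_lin// scaleN1r addrC.
  apply: le_lt_trans (fM _ Bxy) _.
  apply: (@le_lt_trans _ _ ((M + 1) * `|x - y|)); first by rewrite ler_wpM2r// lerDl.
  by rewrite mulrC -ltr_pdivlMr.
- split=> //=; have -> : f 0 = 0; last by [].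
  by have := f_lin (-1) 0 0 B0 B0; rewrite scaler0 addr0 scaleN1r addNr.
- by move=> c x y [Bx Px] [By Py]; split; [exact: BD | rewrite /= f_lin//; exact: PD].
Qed.

Lemma cspan_map V W (Y : set V) (P : set W) (f : V -> W) (M : R[i]) :
  0 <= M -> linear f -> (forall x, `|f x| <= M * `|x|) ->
  closed_subspace P -> (forall y, Y y -> P (f y)) ->
  forall x, cspan Y x -> P (f x).
Proof.
move=> M0 f_lin fM cP YP; apply: (cspan_map_on (@closed_subspaceT V) M0) => //.
by move=> c x y _ _; exact: f_lin.
Qed.
End closed_spans.

Section bop_spans.
Variables (R : realType).
Implicit Types H K L : hilbertType R.

Lemma bop_comp_linearl H K L (T : bop H K) : linear (fun S : bop K L => bop_comp S T).
Proof. by move=> a S S'; exact: bopP. Qed.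

Lemma bop_comp_linearr H K L (S : bop K L) : linear (fun T : bop H K => bop_comp S T).
Proof. by move=> a T T'; apply: bopP => x /=; rewrite linearP. Qed.

Lemma opnorm_comp H K L (S : bop K L) (T : bop H K) :
  opnorm (bop_comp S T) <= opnorm S * opnorm T.
Proof.
apply: opnorm_le => [|x x1 /=]; first by rewrite mulr_ge0 ?opnorm_ge0.
apply: le_trans (opnormP _ _) _; rewrite ler_wpM2l ?opnorm_ge0//.
exact: opnorm_ge.
Qed.

Lemma cspan_compl H K L (Y : set (bop H K)) (P : set (bop H L)) (S : bop K L) :
  closed_subspace P -> (forall T, Y T -> P (bop_comp S T)) ->
  forall T, cspan Y T -> P (bop_comp S T).
Proof.
apply: (cspan_map (opnorm_ge0 S)); first exact: bop_comp_linearr.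
by move=> T; exact: opnorm_comp.
Qed.

Lemma cspan_app H K (Y : set H) (P : set K) (S : bop H K) :
  closed_subspace P -> (forall x, Y x -> P (S x)) ->
  forall x, cspan Y x -> P (S x).
Proof.
apply: (cspan_map (opnorm_ge0 S)); first by move=> a x y; rewrite linearP.
exact: opnormP.
Qed.

Lemma bop_eq_total H K (Y : set H) (S T : bop H K) : cspan Y = setT ->
  (forall x, Y x -> S x = T x) -> S = T.
Proof.
move=> YT h; apply: bopP => x; apply/eqP; rewrite -subr_eq0; apply/eqP.
apply: (@cspan_app _ _ Y _ (S - T) (closed_subspace0 K)); last by rewrite YT.
by move=> y /h /= ->; rewrite subrr.
Qed.

Lemma inner_eq_total H (Y : set H) (x y : H) : cspan Y = setT ->
  (forall z, Y z -> inner z x = inner z y) -> x = y.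
Proof.
move=> YT h; apply: inner_ext => z; rewrite (innerC x) (innerC y); congr (_^*).
apply/eqP; rewrite -subr_eq0 -innerBl; apply/eqP.
apply: (@cspan_map _ _ _ Y _ (inner (x - y)) `|x - y| _ _ _ (closed_subspace0 _)).
- by [].
- by move=> a u v; rewrite innerDr innerZr.
- by move=> u; exact: inner_CS.
- by move=> u /h e; rewrite /= innerBl (innerC u x) (innerC u y) e subrr.
- by rewrite YT.
Qed.
End bop_spans.

Lemma le_approx (R : realType) (x y M : R[i]) : 0 <= x -> 0 <= y -> 0 <= M ->
  (forall e : R[i], 0 < e -> x <= y + e * M) -> x <= y.
Proof.
move=> x0 y0 M0 h; rewrite real_leNgt ?ger0_real//; apply/negP => xy.
have M1 : 0 < M + 1 by rewrite ltr_wpDl.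
have := h ((x - y) / (M + 1)); rewrite divr_gt0 ?subr_gt0// => /(_ isT).
rewrite -lerBlDl mulrAC ler_pdivlMr// ler_pM2l ?subr_gt0//.
by rewrite gerDl ler10.
Qed.

(** * Operators prescribed on a total family *)

Section extension.
Variables (R : realType) (H K : hilbertType R) (T : Type) (f : T -> H) (g : T -> K).
Hypothesis f_total : cspan (range f) = setT.

Let F (u : seq (R[i] * T)) := \sum_(p <- u) p.1 *: f p.2.
Let G (u : seq (R[i] * T)) := \sum_(p <- u) p.1 *: g p.2.
Let scale (a : R[i]) (u : seq (R[i] * T)) := [seq (a * p.1, p.2) | p <- u].

Let FD a u v : F (scale a u ++ v) = a *: F u + F v.
Proof.
rewrite /F big_cat big_map scaler_sumr; congr (_ + _).
by apply: eq_bigr => p _; rewrite scalerA.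
Qed.

Let GD a u v : G (scale a u ++ v) = a *: G u + G v.
Proof.
rewrite /G big_cat big_map scaler_sumr; congr (_ + _).
by apply: eq_bigr => p _; rewrite scalerA.
Qed.

Let approx x (e : R[i]) : 0 < e -> exists u, `|x - F u| < e.
Proof.
move=> e0; have : cspan (range f) x by rewrite f_total.
move=> /closure_normP /(_ e e0)[y fy xy].
suff [u yu] : exists u, y = F u by exists u; rewrite -yu.
move: {x xy} y fy; apply: lspan_min.
- by exists [::]; rewrite /F big_nil.
- by move=> c _ _ [u ->] [v ->]; exists (scale c u ++ v); rewrite FD.
- by move=> _ [t _ <-]; exists [:: (1, t)]; rewrite /F big_seq1 scale1r.
Qed.

(** Extension by continuity, carried out on the closure [rel] of the set of pairs [(F u, G u)]. The
    norm bound passes to [rel] and makes it the graph of a function, so it does not matter that a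
    vector has many representations as a combination of the [f t]. *)
Lemma bop_extend (M : R[i]) : 0 <= M ->
  (forall u : seq (R[i] * T), `|\sum_(p <- u) p.1 *: g p.2| <=
     M * `|\sum_(p <- u) p.1 *: f p.2|) ->
  exists2 X : bop H K, (forall t, X (f t) = g t) & opnorm X <= M.
Proof.
move=> M0 h.
pose rel x y := forall e : R[i], 0 < e -> exists u, `|x - F u| < e /\ `|y - G u| < e.
have relE x : exists y, rel x y.
  have ex (n : nat) : exists v, `|x - F v| < n.+1%:R^-1.
    by apply: approx; rewrite invr_gt0.
  have [u uP] := choice ex.
  have M1 : 0 < M + 1 by rewrite ltr_wpDl.
  have GB m n : `|G (u m) - G (u n)| <= (M + 1) * (m.+1%:R^-1 + n.+1%:R^-1).
    have -> : G (u m) - G (u n) = G (scale (-1) (u n) ++ u m).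
      by rewrite GD scaleN1r addrC.
    apply: le_trans (h _) _; rewrite -/(F _) FD scaleN1r.
    apply: ler_pM => //; first by rewrite lerDl.
    have -> : - F (u n) + F (u m) = (x - F (u n)) - (x - F (u m)).
      by rewrite opprB [RHS]addrC addrA subrK addrC.
    apply: le_trans (ler_normB _ _) _; rewrite addrC.
    by apply: lerD; exact: ltW.
  have [y /cvgrPdist_lt yP] : exists y : K, (G \o u) @ \oo --> y.
    apply: hilbert_cvg => e e0.
    have e20 : 0 < e / (M + 1) / 2 by rewrite !divr_gt0.
    have [N NP] := complex_small e20; exists N => m n Nm Nn.
    apply: le_lt_trans (GB m n) _; rewrite mulrC -ltr_pdivlMr//.
    by rewrite [ltRHS]splitr; apply: ltrD; apply: NP.
  exists y => e e0; have [N NP] := complex_small e0; have [N' _ N'P] := yP e e0.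
  pose n := maxn N N'; exists (u n); split.
    by apply: lt_trans (uP n) (NP _ _); rewrite leq_maxl.
  by apply: N'P; rewrite /= leq_maxr.
have relD a x y x' y' : rel x y -> rel x' y' -> rel (a *: x + x') (a *: y + y').
  move=> r r' e e0; have a0 : 0 < `|a| + 1 by rewrite ltr_wpDl.
  have e20 : 0 < e / 2 by rewrite divr_gt0.
  have [u [ux uy]] := r _ (divr_gt0 e20 a0); have [v [vx vy]] := r' _ e20.
  have aux (V : normedModType R[i]) (p q s t : V) :
      `|p - q| < e / 2 / (`|a| + 1) -> `|s - t| < e / 2 ->
      `|a *: p + s - (a *: q + t)| < e.
    move=> pq st; rewrite opprD addrACA -scalerBr.
    apply: le_lt_trans (ler_normD _ _) _; rewrite [ltRHS]splitr ler_ltD// normrZ.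
    apply: (@le_trans _ _ ((`|a| + 1) * `|p - q|)); first by rewrite ler_wpM2r// lerDl.
    by rewrite mulrC -ler_pdivlMr// ltW.
  by exists (scale a u ++ v); rewrite FD GD; split; exact: aux.
have relM x y : rel x y -> `|y| <= M * `|x|.
  move=> r; apply: (@le_approx _ _ _ (1 + M)); rewrite ?mulr_ge0 ?addr_ge0// => e e0.
  have [u [ux uy]] := r e e0.
  have Gu : `|G u| <= M * (`|x| + e).
    apply: le_trans (h u) _; rewrite ler_wpM2l// -/(F u).
    have -> : F u = x - (x - F u) by rewrite opprB addrCA subrr addr0.
    by apply: le_trans (ler_normB _ _) _; rewrite lerD2l ltW.
  have -> : y = (y - G u) + G u by rewrite subrK.
  apply: le_trans (ler_normD _ _) _; apply: le_trans (lerD (ltW uy) Gu) _.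
  by rewrite (_ : e + _ = M * `|x| + e * (1 + M))//; ring.
have [X XP] := choice relE.
have relu x y y' : rel x y -> rel x y' -> y = y'.
  move=> r r'; have := relM _ _ (relD (-1) _ _ _ _ r' r).
  rewrite !scaleN1r addNr normr0 mulr0 normr_le0 addrC subr_eq0.
  by move=> /eqP.
have [||Y YX] := @mk_bop _ H K X M M0.
- by move=> a x y; apply: relu (XP _) (relD _ _ _ _ _ (XP _) (XP _)).
- by move=> x; exact: relM.
exists Y => [t|].
- rewrite YX; apply: relu (XP _) _ => e e0; exists [:: (1, t)].
  by rewrite /F /G !big_seq1 !scale1r !subrr !normr0.
- apply: opnorm_le => // x x1; rewrite YX; apply: le_trans (relM _ _ (XP x)) _.
  by rewrite ler_piMr.
Qed.

(** Equal inner products of the generators give equal norms of all their linear combinations, hence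
    the bound 1 in [bop_extend]. *)
Lemma bop_isometry : (forall s t, inner (g s) (g t) = inner (f s) (f t)) ->
  exists X : bop H K, forall t, X (f t) = g t.
Proof.
move=> h; have [|X XP _] := @bop_extend 1 ler01; last by exists X.
move=> u; rewrite mul1r -(@ler_pXn2r _ 2)// ?nnegrE// -!inner_norm !inner_sum_sum.
rewrite le_eqVlt; apply/orP; left; apply/eqP.
by apply: eq_bigr => p _; apply: eq_bigr => q _; rewrite h.
Qed.

Lemma bop_unitary (X : bop H K) : cspan (range g) = setT ->
  (forall s t, inner (g s) (g t) = inner (f s) (f t)) ->
  (forall t, X (f t) = g t) ->
  unitary X /\ (forall t, adjoint X (g t) = f t).
Proof.
move=> g_total h XP.
have aX t : adjoint X (g t) = f t.
  apply: (inner_eq_total f_total) => _ [s _ <-].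
  by rewrite adjointEr XP h.
split=> //; split.
- by apply: (bop_eq_total f_total) => _ [t _ <-] /=; rewrite XP aX.
- by apply: (bop_eq_total g_total) => _ [t _ <-] /=; rewrite aX XP.
Qed.
End extension.

(** * A Schur product theorem *)

Lemma bop_sumE (R : realType) (H K : hilbertType R) I (r : seq I) (P : pred I)
    (F : I -> bop H K) x :
  (\sum_(i <- r | P i) F i) x = \sum_(i <- r | P i) F i x.
Proof. by elim/big_rec2: _ => [//|i y z _ <-]. Qed.

Definition positive_bop (R : realType) (H : hilbertType R) (y : bop H H) : Prop :=
  (forall u v, inner (y u) v = inner u (y v)) /\ (forall u, 0 <= inner u (y u)).

Lemma inner_le_opnorm (R : realType) (H : hilbertType R) (y : bop H H) u :
  positive_bop y -> inner u (y u) <= opnorm y * inner u u.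
Proof.
move=> [_ y0]; rewrite -[leLHS]ger0_norm//; apply: le_trans (inner_CS _ _) _.
by rewrite inner_norm expr2 mulrA mulrC ler_wpM2r// opnormP.
Qed.

(* For 0 <= y and 0 <= T with c |y| |T| <= 1, the recursion
   E_0 = y, E_(n+1) = E_n - c E_n T E_n is a decreasing sequence of positive
   operators; the bounded partial sums of c <E_n x, T E_n x> force
   <E_n x, T E_n x> to be small for some n.  This replaces functional calculus. *)
Section decreasing_iteration.
Variables (R : realType) (H : hilbertType R) (y T : bop H H) (c : R[i]).
Hypotheses (yP : positive_bop y) (TP : positive_bop T).
Hypotheses (c0 : 0 < c) (cyT : c * opnorm y * opnorm T <= 1).

Fixpoint decr n : bop H H :=
  if n is m.+1 then decr m - c *: bop_comp (decr m) (bop_comp T (decr m)) else y.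

Lemma decrS n x : decr n.+1 x = decr n x - c *: decr n (T (decr n x)).
Proof. by []. Qed.

Let cr : c^* = c. Proof. exact/conj_Creal/ger0_real/ltW. Qed.

Lemma decr_sym n u v : inner (decr n u) v = inner u (decr n v).
Proof.
elim: n u v => [|n IH] u v; first exact: yP.1.
rewrite !decrS innerBl innerBr innerZl innerZr cr IH; congr (_ - _ * _).
by rewrite IH TP.1 IH.
Qed.

Lemma inner_decrS n u :
  inner u (decr n.+1 u) = inner u (decr n u) - c * inner (decr n u) (T (decr n u)).
Proof. by rewrite decrS innerBr innerZr decr_sym. Qed.

(** Cauchy-Schwarz for the form [<u, E v>] gives [E^2 <= |y| E]. Hence
    [c E T E <= c |T| E^2 <= c |y| |T| E <= E], and subtracting [c E T E] leaves a positive
    operator. *)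
Lemma decr_bounds n u : 0 <= inner u (decr n u) <= inner u (y u).
Proof.
elim: n u => [|n IH] u; first by rewrite yP.2 lexx.
rewrite inner_decrS; apply/andP; split; last first.
  apply: le_trans (_ : inner u (decr n u) <= _); last by case/andP: (IH u).
  by rewrite lerBlDr lerDl mulr_ge0 ?(ltW c0)// TP.2.
set E := decr n.
have E0 v : 0 <= inner v (E v) by case/andP: (IH v).
have EE : inner (E u) (E u) <= opnorm y * inner u (E u).
  have CS := @semi_CS _ H (fun a b => inner a (E b)).
  have {}CS : `|inner u (E (E u))| ^+ 2 <= inner u (E u) * inner (E u) (E (E u)).
    apply: CS => // [a b d|k a b|a b].
    - by rewrite linearD innerDr.
    - by rewrite linearZ innerZr.
    - by rewrite -decr_sym innerC.
  rewrite -decr_sym -/E ger0_norm ?inner_ge0// in CS.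
  have [->|Eu0] := eqVneq (inner (E u) (E u)) 0; first by rewrite mulr_ge0 ?opnorm_ge0.
  have Eup : 0 < inner (E u) (E u) by rewrite lt0r Eu0 inner_ge0.
  rewrite -(@ler_pM2r _ (inner (E u) (E u)))// -expr2; apply: le_trans CS _.
  rewrite -mulrA mulrCA ler_wpM2l//; apply: le_trans (inner_le_opnorm _ yP).
  by case/andP: (IH (E u)).
rewrite subr_ge0; apply: le_trans (_ : c * (opnorm T * (opnorm y * inner u (E u))) <= _).
  rewrite ler_wpM2l ?(ltW c0)//; apply: le_trans (inner_le_opnorm _ TP) _.
  by rewrite ler_wpM2l ?opnorm_ge0.
rewrite (_ : c * _ = c * opnorm y * opnorm T * inner u (E u)); last by ring.
by rewrite ler_piMl.
Qed.

Lemma decr_sum n u :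
  \sum_(m < n) c * inner (decr m u) (T (decr m u)) <= inner u (y u).
Proof.
have -> : \sum_(m < n) c * inner (decr m u) (T (decr m u)) =
    inner u (y u) - inner u (decr n u).
  elim: n => [|n IH]; first by rewrite big_ord0 subrr.
  by rewrite big_ord_recr/= IH inner_decrS opprB addrA addrAC.
by rewrite lerBlDr lerDl; case/andP: (decr_bounds n u).
Qed.

(** If the sum stayed above [e] for every [n], then adding up [N.+1] of these sums, each weighted by
    [c], would exceed the bound that [decr_sum] gives uniformly in [N]. One index [n] thus serves
    all vectors of [xs] at once. *)
Lemma decr_small (xs : seq H) (e : R[i]) : 0 < e ->
  exists n, \sum_(x <- xs) inner (decr n x) (T (decr n x)) < e.
Proof.
move=> e0; apply: contrapT => hn.
have h n : e <= \sum_(x <- xs) inner (decr n x) (T (decr n x)).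
  rewrite real_leNgt; [|exact: gtr0_real|].
    by apply/negP => ?; apply: hn; exists n.
  by apply: ger0_real; rewrite sumr_ge0// => x _; exact: TP.2.
pose B := \sum_(x <- xs) inner x (y x).
have B0 : 0 <= B by rewrite sumr_ge0// => x _; exact: yP.2.
have B1 : 0 < B + 1 by rewrite ltr_wpDl.
have [N NP] := complex_small (divr_gt0 (mulr_gt0 c0 e0) B1).
have := NP N (leqnn N); rewrite ltr_pdivlMr// mulrC ltr_pdivrMr// => h1.
have : c * e * N.+1%:R <= B.
  apply: le_trans (_ : \sum_(m < N.+1) c * \sum_(x <- xs) inner (decr m x) (T (decr m x)) <= _).
    rewrite mulr_natr -[in leLHS](card_ord N.+1) -sumr_const; apply: ler_sum => m _.
    by rewrite ler_wpM2l ?(ltW c0).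
  under eq_bigr do rewrite mulr_sumr.
  by rewrite exchange_big/=; apply: ler_sum => x _; exact: decr_sum.
move=> h2; have := lt_le_trans h1 h2.
by rewrite gtrDl ltr10.
Qed.
End decreasing_iteration.

Section schur.
Variables (R : realType) (Z H K : hilbertType R) (I : Type) (s : seq I).
Variables (xi : I -> bop Z H) (zeta : I -> Z) (eta : I -> bop Z K) (y : bop H H).
Hypothesis yP : positive_bop y.
Hypothesis comm : forall i j p q z,
  adjoint (xi i) (y (xi j (adjoint (eta p) (eta q z)))) =
  adjoint (eta p) (eta q (adjoint (xi i) (y (xi j z)))).

Let T : bop H H := \sum_(k <- s) bop_comp (xi k) (adjoint (xi k)).

Let TE x : T x = \sum_(k <- s) xi k (adjoint (xi k) x).
Proof. by rewrite /T bop_sumE. Qed.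

Let inner_T u v : inner u (T v) = \sum_(k <- s) inner (adjoint (xi k) u) (adjoint (xi k) v).
Proof. by rewrite TE inner_sumr; apply: eq_bigr => k _; rewrite adjointE. Qed.

Let TP : positive_bop T.
Proof.
split=> [u v|u]; last by rewrite inner_T sumr_ge0// => k _; exact: inner_ge0.
rewrite innerC !inner_T rmorph_sum/=; apply: eq_bigr => k _.
by rewrite -innerC.
Qed.

(** The added 1 keeps [c] defined and positive when [y] or [T] vanishes. *)
Let c : R[i] := (opnorm y * opnorm T + 1)^-1.

Let c0 : 0 < c.
Proof. by rewrite invr_gt0 ltr_wpDl// mulr_ge0 ?opnorm_ge0. Qed.

Let cyT : c * opnorm y * opnorm T <= 1.
Proof.
have d0 : 0 < opnorm y * opnorm T + 1 by rewrite ltr_wpDl// mulr_ge0 ?opnorm_ge0.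
by rewrite -mulrA mulrC ler_pdivrMr// mul1r lerDl.
Qed.

Let E := decr y T c.

(** This is why [T] is built from the [xi k]: passing from [E n] to [E n.+1] changes [xi_i^* E xi_j]
    by a multiple of the sum over [k] of [(xi_i^* E xi_k) (xi_k^* E xi_j)], and both factors commute
    with [eta_p^* eta_q] by induction. *)
Let decr_comm n i j p q z :
  adjoint (xi i) (E n (xi j (adjoint (eta p) (eta q z)))) =
  adjoint (eta p) (eta q (adjoint (xi i) (E n (xi j z)))).
Proof.
elim: n i j z => [|n IH] i j z; first exact: comm.
rewrite /E !decrS -/E !linearB !linearZ/= IH; congr (_ + _ *: - _).
rewrite !TE !linear_sum; apply: eq_bigr => k _ /=.
by rewrite IH IH.
Qed.

Let form n := \sum_(i <- s) \sum_(j <- s)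
  inner (xi i (zeta i)) (E n (xi j (adjoint (eta i) (eta j (zeta j))))).

Let g n k i := adjoint (xi k) (E n (xi i (zeta i))).

(** By symmetry one factor [E n] moves to the left of the inner product, and [decr_comm] lets
    [eta_i^* eta_j] act last. Each summand becomes [<eta_i g_ki, eta_j g_kj>], and the double sum
    over [i] and [j] is a square norm. *)
Let formS n :
  form n - form n.+1 = c * \sum_(k <- s) `|\sum_(i <- s) eta i (g n k i)| ^+ 2.
Proof.
rewrite /form -sumrB mulr_sumr.
under eq_bigr do rewrite -sumrB.
transitivity (\sum_(i <- s) \sum_(j <- s) \sum_(k <- s)
    c * inner (eta i (g n k i)) (eta j (g n k j))).
  apply: eq_bigr => i _; apply: eq_bigr => j _.
  rewrite -innerBr /E decrS opprB addrC subrK innerZr -/E.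
  rewrite -(decr_sym yP TP c0) inner_T mulr_sumr; apply: eq_bigr => k _.
  by rewrite -/E decr_comm adjointEr.
under eq_bigr do rewrite exchange_big/=.
rewrite exchange_big/=; apply: eq_bigr => k _.
rewrite -inner_norm inner_suml mulr_sumr; apply: eq_bigr => i _.
by rewrite inner_sumr mulr_sumr.
Qed.

(* Let F_n be the sum below with E_n in place of y.  Then F_n - F_(n+1) is the
   square norm computed in [formS], and F_n is arbitrarily small for some n
   because the vectors xi_k^* E_n xi_i zeta_i are. *)
Lemma schur_positive : 0 <= \sum_(i <- s) \sum_(j <- s)
  inner (xi i (zeta i)) (y (xi j (adjoint (eta i) (eta j (zeta j))))).
Proof.
apply: complex_approx_ge0 => e e0.
pose w i j := `|adjoint (eta i) (eta j (zeta j))|.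
pose W := \sum_(i <- s) \sum_(j <- s) w i j ^+ 2.
have W0 : 0 <= W by do 2!(rewrite sumr_ge0// => ? _); rewrite exprn_ge0// normr_ge0.
have W1 : 0 < W + 1 by rewrite ltr_wpDl.
(* [t] is the weight in the inequality [amgm] below: it makes [t * W] at most [e / 2], and the
   threshold [t * (e / 2)] compensates the factor [t^-1] of the other term. *)
pose t := e / 2 / (W + 1).
have t0 : 0 < t by rewrite !divr_gt0.
have te0 : 0 < t * (e / 2) by rewrite mulr_gt0// divr_gt0.
have [n hn0] := decr_small yP TP c0 cyT [seq xi i (zeta i) | i <- s] te0; move: hn0.
rewrite big_map -/E => hn.
(* The nonnegative approximant of [form 0] telescopes into the square norms of [formS]; the error is
   [form n]. *)
exists (form 0 - form n).
  elim: n {hn} => [|n IH]; first by rewrite subrr.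
  rewrite (_ : form 0 - form n.+1 = (form 0 - form n) + (form n - form n.+1)); last by ring.
  by rewrite addr_ge0// formS mulr_ge0 ?(ltW c0)// sumr_ge0.
rewrite (_ : _ - _ = form n); last by rewrite opprB addrC subrK.
pose a i j := `|adjoint (xi j) (E n (xi i (zeta i)))|.
have amgm (u v : R[i]) : 0 <= u -> 0 <= v -> u * v <= t^-1 * u ^+ 2 + t * v ^+ 2.
  move=> u0 v0; rewrite -subr_ge0.
  rewrite (_ : _ - _ = t^-1 * (u - t * v) ^+ 2 + u * v); last first.
    by field; exact: lt0r_neq0.
  have d0 : 0 <= (u - t * v) ^+ 2.
    by rewrite real_exprn_even_ge0// realB ?ger0_real// mulr_ge0// ltW.
  by rewrite addr_ge0// mulr_ge0// invr_ge0 ltW.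
apply: (@le_lt_trans _ _ (\sum_(i <- s) \sum_(j <- s)
    (t^-1 * a i j ^+ 2 + t * w i j ^+ 2))).
  apply: le_trans (ler_norm_sum _ _ _) _; apply: ler_sum => i _.
  apply: le_trans (ler_norm_sum _ _ _) _; apply: ler_sum => j _.
  rewrite -(decr_sym yP TP c0) -/E -adjointE; apply: le_trans (inner_CS _ _) _.
  exact: amgm.
under eq_bigr do rewrite big_split/= -!mulr_sumr.
rewrite big_split/= -!mulr_sumr [ltRHS]splitr; apply: ltr_leD.
  rewrite mulrC ltr_pdivrMr// [ltRHS]mulrC; apply: le_lt_trans hn.
  apply: ler_sum => i _; rewrite inner_T; apply: ler_sum => k _.
  by rewrite inner_norm.
rewrite -/W /t mulrAC ler_pdivrMr// ler_wpM2l ?lerDl//.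
by rewrite divr_ge0// ltW.
Qed.
End schur.

Section schur_contraction.
Variables (R : realType) (Z H H' K : hilbertType R) (I : Type).
Variables (A : bop H H') (xi : I -> bop Z H) (zeta : I -> Z) (eta : I -> bop Z K).
Hypothesis comm : forall i j p q z,
  adjoint (xi i) (xi j (adjoint (eta p) (eta q z))) =
  adjoint (eta p) (eta q (adjoint (xi i) (xi j z))).
Hypothesis commA : forall i j p q z,
  adjoint (xi i) (adjoint A (A (xi j (adjoint (eta p) (eta q z))))) =
  adjoint (eta p) (eta q (adjoint (xi i) (adjoint A (A (xi j z))))).

(* [schur_positive] for the operator |A|^2 - A^* A. *)
Lemma schur_contraction (s : seq I) :
  \sum_(i <- s) \sum_(j <- s)
    inner (A (xi i (zeta i))) (A (xi j (adjoint (eta i) (eta j (zeta j))))) <=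
  opnorm A ^+ 2 * \sum_(i <- s) \sum_(j <- s)
    inner (xi i (zeta i)) (xi j (adjoint (eta i) (eta j (zeta j)))).
Proof.
pose y : bop H H := opnorm A ^+ 2 *: bop_id H - bop_comp (adjoint A) A.
have yE x : y x = opnorm A ^+ 2 *: x - adjoint A (A x) by [].
have cn : (opnorm A ^+ 2)^* = opnorm A ^+ 2.
  by apply/conj_Creal/ger0_real; rewrite exprn_ge0 ?opnorm_ge0.
have yP : positive_bop y.
  split=> [u v|u].
    by rewrite !yE innerBl innerBr innerZl innerZr cn adjointE adjointEr.
  rewrite yE innerBr innerZr adjoint_normK inner_norm -exprMn subr_ge0.
  by rewrite ler_pXn2r ?nnegrE ?mulr_ge0 ?opnorm_ge0// opnormP.
rewrite -subr_ge0 mulr_sumr -sumrB.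
rewrite (eq_bigr (fun i => \sum_(j <- s)
    inner (xi i (zeta i)) (y (xi j (adjoint (eta i) (eta j (zeta j))))))).
  apply: schur_positive yP _ => i j p q z.
  by rewrite !yE !linearB !linearZ/= comm commA.
move=> i _; rewrite mulr_sumr -sumrB; apply: eq_bigr => j _.
by rewrite yE innerBr innerZr adjointEr.
Qed.
End schur_contraction.

(** * Relative tensor products *)

Section kernel_total.
Variables (R : realType) (T : choiceType) (k : T -> T -> R[i]).

Lemma completion_in_linear (V : prehilbertType R) a (x y : V) :
  completion_in (a *: x + y) = a *: completion_in x + completion_in y.
Proof.
apply/sep_ext => w; rewrite !(sep_reprE, semi_formD, semi_formZ)/=.
apply/cauchy_formP => /=; under eq_fun do rewrite innerDr innerZr.
by apply: cvgD; [apply: cvgMr|]; exact: cauchy_form_cvg.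
Qed.

(** Classes of formal combinations already lie in the linear span, and the class of a Cauchy
    sequence is the limit of its terms. *)
Lemma kernel_point_total : cspan (range (kernel_point k)) = setT.
Proof.
apply/seteqP; split=> // x _.
have lin (v : Defs.separated (formal_space k)) : lspan (range (kernel_point k)) (completion_in v).
  elim/sep_ind: v => u; elim: u => [|[a t] u IH].
    have -> : completion_in (@sep_class R (formal_space k) [::]) = 0.
      have := @completion_in_linear (Defs.separated (formal_space k)) (-1) 0 0.
      by rewrite scaler0 addr0 scaleN1r addNr.
    exact: lspan0.
  have -> : completion_in (@sep_class R (formal_space k) ((a, t) :: u)) =
      a *: kernel_point k t + completion_in (@sep_class R (formal_space k) u).
    rewrite /kernel_point -completion_in_linear; congr completion_in.
    apply: sep_ext => w; rewrite !(sep_reprE, semi_formD, semi_formZ).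
    rewrite -(formal_formZ k) -(formal_formD k) /=.
    by rewrite /formal_scale/= mulr1.
  by apply: lspanP IH; apply: lspan_incl; exists t.
elim/sep_ind: x => u; apply/closure_normP => e e0.
have e20 : 0 < e / 2 by rewrite divr_gt0.
have [N NP] := cauchy_seqP u e20.
exists (completion_in (u N)); first exact: lin.
apply: (@le_lt_trans _ _ (e / 2)); last by rewrite ltr_pdivrMr// ltr_pMr// ltr1n.
apply: (@completion_norm_le _ _ u (cauchy_cst (u N))); first exact: ltW.
by exists N => // n /= Nn; apply/ltW/NP.
Qed.
End kernel_total.

Lemma adjoint_id (R : realType) (H : hilbertType R) : adjoint (bop_id H) = bop_id H.
Proof. exact: adjoint_eq. Qed.

(** * Frames: elementary tensors characterised by their inner products *)

Section frames.
Variable R : realType.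

Definition gram_comm (Z H K : hilbertType R) (beta : set (bop Z H))
    (gamma : set (bop Z K)) : Prop :=
  forall xi xi' eta eta', beta xi -> beta xi' -> gamma eta -> gamma eta' ->
  forall z, adjoint xi (xi' (adjoint eta (eta' z))) =
            adjoint eta (eta' (adjoint xi (xi' z))).

Lemma gram_commC (Z H K : hilbertType R) (beta : set (bop Z H))
  (gamma : set (bop Z K)) : gram_comm beta gamma -> gram_comm gamma beta.
Proof. by move=> h eta eta' xi xi' *; rewrite h. Qed.

(* Interchanging the roles of beta and gamma in a frame exchanges |xi>_1 and
   |eta>_2, so that each statement about one of them yields the other. *)
Record frame (Z H K W : hilbertType R) (beta : set (bop Z H))
    (gamma : set (bop Z K)) (e : bop Z H -> Z -> bop Z K -> W) : Prop := Frame {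
  frame_total1 : cspan (set_app beta) = setT;
  frame_total2 : cspan (set_app gamma) = setT;
  frame_comm : gram_comm beta gamma;
  frame_inner : forall xi zeta eta xi' zeta' eta',
    beta xi -> gamma eta -> beta xi' -> gamma eta' ->
    inner (e xi zeta eta) (e xi' zeta' eta') =
    inner zeta (adjoint xi (xi' (adjoint eta (eta' zeta'))));
  frame_total : cspan [set w | exists xi zeta eta,
    [/\ beta xi, gamma eta & w = e xi zeta eta]] = setT
}.

Lemma frame_flip (Z H K W : hilbertType R) (beta : set (bop Z H))
    (gamma : set (bop Z K)) (e : bop Z H -> Z -> bop Z K -> W) :
  frame beta gamma e -> frame gamma beta (fun eta zeta xi => e xi zeta eta).
Proof.
case=> t1 t2 c ei et; split=> //.
- exact: gram_commC.
- by move=> eta zeta xi eta' zeta' xi' *; rewrite ei// c.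
- apply: total_sub et _ => w [xi [zeta [eta [bxi geta we]]]].
  by apply: cspan_incl; exists eta, zeta, xi.
Qed.

Section frame_theory.
Variables (Z H K W : hilbertType R) (beta : set (bop Z H)).
Variables (gamma : set (bop Z K)) (e : bop Z H -> Z -> bop Z K -> W).
Hypothesis fr : frame beta gamma e.

Lemma frame_ext (V : hilbertType R) (X Y : bop W V) :
  (forall xi zeta eta, beta xi -> gamma eta ->
     X (e xi zeta eta) = Y (e xi zeta eta)) -> X = Y.
Proof.
move=> h; apply: (bop_eq_total (frame_total fr)).
by move=> _ [xi [zeta [eta [bxi geta ->]]]]; exact: h.
Qed.

Lemma frame_ext2 (V : hilbertType R) (X Y : bop K V) :
  (forall eta zeta, gamma eta -> X (eta zeta) = Y (eta zeta)) -> X = Y.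
Proof.
move=> h; apply: (bop_eq_total (frame_total2 fr)).
by move=> _ [eta geta [zeta _ <-]]; exact: h.
Qed.

(** Apply [schur_contraction] with [A := xi] and with the identity of [Z] as the whole first family:
    its left side is then the square norm of a combination of elementary tensors [e xi zeta eta],
    its right side [|xi|^2] times that of the same combination of the vectors [eta zeta]. *)
Lemma frame_ket1 xi : beta xi -> exists2 X : bop K W,
  forall zeta eta, gamma eta -> X (eta zeta) = e xi zeta eta & opnorm X <= opnorm xi.
Proof.
move=> bxi.
pose T := {t : Z * bop Z K | gamma t.2}.
pose f (t : T) := (sval t).2 (sval t).1.
pose g (t : T) := e xi (sval t).1 (sval t).2.
have fT : cspan (range f) = setT.
  apply: total_sub (frame_total2 fr) _ => _ [eta geta [zeta _ <-]].
  by apply: cspan_incl; exists (exist _ (zeta, eta) geta).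
have [|X XP Xn] := @bop_extend _ _ _ _ f g fT (opnorm xi) (opnorm_ge0 _).
  move=> u; rewrite -(@ler_pXn2r _ 2)// ?nnegrE ?mulr_ge0 ?opnorm_ge0//.
  rewrite exprMn -!inner_norm !inner_sum_sum.
  have := @schur_contraction _ _ _ _ _ (R[i] * T)%type xi (fun=> bop_id Z)
    (fun p => p.1 *: (sval p.2).1) (fun p => (sval p.2).2) _ _ u.
  set A := (X in X <= _); set B := (X in _ <= _ * X) => h.
  suff [-> ->] : \sum_(p <- u) \sum_(q <- u) (p.1)^* * q.1 * inner (g p.2) (g q.2) = A
    /\ \sum_(p <- u) \sum_(q <- u) (p.1)^* * q.1 * inner (f p.2) (f q.2) = B.
    apply: h => [i j p q z|i j p q z]; first by rewrite adjoint_id.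
    by rewrite adjoint_id/= (frame_comm fr)//; [exact: (svalP p.2)|exact: (svalP q.2)].
  split; apply: eq_bigr => p _; apply: eq_bigr => q _ /=.
  - rewrite (frame_inner fr)//; [|exact: (svalP p.2)|exact: (svalP q.2)].
    by rewrite adjointEr !linearZ/= innerZl innerZr mulrA.
  - by rewrite !linearZ/= innerZl innerZr mulrA adjointEr.
by exists X => // zeta eta geta; rewrite (XP (exist _ (zeta, eta) geta)).
Qed.

Definition is_ket (xi : bop Z H) (X : bop K W) : Prop :=
  forall zeta eta, gamma eta -> X (eta zeta) = e xi zeta eta.

Lemma is_ket_uniq xi X Y : is_ket xi X -> is_ket xi Y -> X = Y.
Proof. by move=> hX hY; apply: frame_ext2 => eta zeta geta; rewrite hX// hY. Qed.

(** A frame does not assume [e] to be linear in its first argument; linearity is recovered from the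
    inner products with a total family. *)
Lemma is_ket_linear a xi xi' X Y Z' : (forall a xi xi', beta xi -> beta xi' -> beta (a *: xi + xi')) ->
  beta xi -> beta xi' ->
  is_ket xi X -> is_ket xi' Y -> is_ket (a *: xi + xi') Z' -> Z' = a *: X + Y.
Proof.
move=> bD bxi bxi' hX hY hZ; apply: frame_ext2 => eta zeta geta /=.
rewrite hX// hY// hZ//; apply: (inner_eq_total (frame_total fr)).
move=> _ [xi0 [zeta0 [eta0 [bxi0 geta0 ->]]]].
rewrite innerDr innerZr !(frame_inner fr)//; last exact: bD.
by rewrite /= linearP/= innerDr innerZr.
Qed.

Lemma is_ket_gram xi xi' X Y : beta xi -> beta xi' -> is_ket xi X -> is_ket xi' Y ->
  forall eta zeta, gamma eta -> adjoint X (Y (eta zeta)) = eta (adjoint xi (xi' zeta)).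
Proof.
move=> bxi bxi' hX hY eta zeta geta; apply: (inner_eq_total (frame_total2 fr)).
move=> _ [eta0 geta0 [zeta0 _ <-]].
by rewrite adjointEr hX// hY// (frame_inner fr)// (frame_comm fr)// adjointEr.
Qed.
End frame_theory.

(** The bound [|T| |S|] needs two contractions. The first removes [T] with the [S xi] as one family
    and the [eta] as the other, the second removes [S]. The intermediate form mixes [beta2] with
    [gamma1], whence the commutation hypothesis between them. *)
Lemma frame_op (Z H1 H2 K1 K2 W1 W2 : hilbertType R)
    (beta1 : set (bop Z H1)) (beta2 : set (bop Z H2))
    (gamma1 : set (bop Z K1)) (gamma2 : set (bop Z K2))
    (e1 : bop Z H1 -> Z -> bop Z K1 -> W1) (e2 : bop Z H2 -> Z -> bop Z K2 -> W2)
    (S : bop H1 H2) (T : bop K1 K2) :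
  frame beta1 gamma1 e1 -> frame beta2 gamma2 e2 -> gram_comm beta2 gamma1 ->
  (forall xi, beta1 xi -> beta2 (bop_comp S xi)) ->
  (forall eta, gamma1 eta -> gamma2 (bop_comp T eta)) ->
  exists X : bop W1 W2, forall xi zeta eta, beta1 xi -> gamma1 eta ->
    X (e1 xi zeta eta) = e2 (bop_comp S xi) zeta (bop_comp T eta).
Proof.
move=> fr1 fr2 c21 Sb Tg.
pose I := {t : bop Z H1 * Z * bop Z K1 | beta1 t.1.1 /\ gamma1 t.2}.
pose x (t : I) := (sval t).1.1; pose z (t : I) := (sval t).1.2.
pose n (t : I) := (sval t).2.
have bx t : beta1 (x t) by case: t => -[[? ?] ?] [].
have gn t : gamma1 (n t) by case: t => -[[? ?] ?] [].
pose f (t : I) := e1 (x t) (z t) (n t).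
pose g (t : I) := e2 (bop_comp S (x t)) (z t) (bop_comp T (n t)).
have fT : cspan (range f) = setT.
  apply: total_sub (frame_total fr1) _ => _ [xi [zeta [eta [bxi geta ->]]]].
  by apply: cspan_incl; exists (exist _ (xi, zeta, eta) (conj bxi geta)).
have M0 : 0 <= opnorm T * opnorm S by rewrite mulr_ge0 ?opnorm_ge0.
have [|X XP _] := @bop_extend _ _ _ _ f g fT _ M0; last first.
  by exists X => xi zeta eta bxi geta; rewrite (XP (exist _ (xi, zeta, eta) (conj bxi geta))).
move=> u; rewrite -(@ler_pXn2r _ 2)// ?nnegrE ?mulr_ge0 ?opnorm_ge0//.
rewrite !exprMn -!inner_norm !inner_sum_sum.
have h1 := @schur_contraction _ _ _ _ _ (R[i] * I)%type T (fun p => n p.2)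
    (fun p => p.1 *: z p.2) (fun p => bop_comp S (x p.2)) _ _ u.
have h2 := @schur_contraction _ _ _ _ _ (R[i] * I)%type S (fun p => x p.2)
    (fun p => p.1 *: z p.2) (fun p => n p.2) _ _ u.
move: h1; set A := (X in X <= _); set B := (X in _ <= _ * X) => h1.
move: h2; set C := (X in X <= _); set D := (X in _ <= _ * X) => h2.
have -> : \sum_(p <- u) \sum_(q <- u) (p.1)^* * q.1 * inner (g p.2) (g q.2) = A.
  apply: eq_bigr => p _; apply: eq_bigr => q _.
  rewrite !linearZ/= innerZl innerZr mulrA; congr (_ * _).
  rewrite (frame_inner fr2); [|exact: Sb|exact: Tg|exact: Sb|exact: Tg].
  rewrite (frame_comm fr2); [|exact: Sb|exact: Sb|exact: Tg|exact: Tg].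
  by rewrite adjointEr.
have -> : \sum_(p <- u) \sum_(q <- u) (p.1)^* * q.1 * inner (f p.2) (f q.2) = D.
  apply: eq_bigr => p _; apply: eq_bigr => q _.
  rewrite !linearZ/= innerZl innerZr mulrA; congr (_ * _).
  by rewrite (frame_inner fr1)// adjointEr.
(* Both are the intermediate form for [(S xi, eta)], written once with the [eta] and once with the
   [S xi] in the role of the contracted family. *)
have BC : B = C.
  apply: eq_bigr => p _; apply: eq_bigr => q _.
  have Sx t v : S (x t v) = bop_comp S (x t) v by [].
  rewrite -adjointEr !Sx -[RHS]adjointEr c21//; exact: Sb.
rewrite -mulrA; apply: le_trans (h1 _ _) _.
- by move=> i j p q v; rewrite -c21//; exact: Sb.
- move=> i j p q v.
  have nT t w : adjoint (n t) (adjoint T w) = adjoint (bop_comp T (n t)) w.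
    by rewrite adjoint_comp.
  have nT' t w : T (n t w) = bop_comp T (n t) w by [].
  by rewrite !nT !nT' -(frame_comm fr2)//; [exact: Sb|exact: Sb|exact: Tg|exact: Tg].
rewrite BC ler_wpM2l ?exprn_ge0 ?opnorm_ge0//; apply: h2 => i j p q v.
  exact: (frame_comm fr1).
have xS t w : adjoint (x t) (adjoint S w) = adjoint (bop_comp S (x t)) w.
  by rewrite adjoint_comp.
have xS' t w : S (x t w) = bop_comp S (x t) w by [].
by rewrite !xS !xS' c21//; exact: Sb.
Qed.

End frames.

(** * The separated completion as a frame *)

Section rtensor_theory.
Variables (R : realType) (Z H K : hilbertType R).
Variables (beta : set (bop Z H)) (gamma : set (bop Z K)).
Hypotheses (beta_total : cspan (set_app beta) = setT).
Hypotheses (gamma_total : cspan (set_app gamma) = setT).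
Hypothesis comm : gram_comm beta gamma.

Lemma rt_kernel_positive : positive_kernel (@rt_kernel R Z H K beta gamma).
Proof.
split=> [[[xi z] eta] [[xi' z'] eta']|u].
  rewrite /rt_kernel/= -innerC adjointE -adjointEr adjointE -adjointEr.
  by rewrite comm//; exact: set_valP.
have := @schur_positive _ _ _ _ (R[i] * (set_type beta * Z * set_type gamma))%type u
  (fun p => val p.2.1.1) (fun p => p.1 *: p.2.1.2) (fun p => val p.2.2) (bop_id H).
set A := (X in 0 <= X) => h.
suff -> : formal_form (@rt_kernel R Z H K beta gamma) u u = A.
  apply: h => [|i j p q v]; last by rewrite /= comm//; exact: set_valP.
  by split=> // v; exact: inner_ge0.
apply: eq_bigr => -[a [[xi z] eta]] _; apply: eq_bigr => -[a' [[xi' z'] eta']] _ /=.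
by rewrite !linearZ/= innerZl innerZr mulrA adjointEr.
Qed.

Lemma rt_elemE (xi : beta) zeta (eta : gamma) :
  rt_elem beta gamma (val xi) zeta (val eta) =
  kernel_point (@rt_kernel _ _ _ _ beta gamma) (xi, zeta, eta).
Proof. by rewrite /rt_elem !valK. Qed.

Lemma rt_frame : frame beta gamma (rt_elem beta gamma).
Proof.
split=> // [xi zeta eta xi' zeta' eta' bxi geta bxi' geta'|].
  have := kernel_point_inner
    (SigSub (mem_set bxi), zeta, SigSub (mem_set geta))
    (SigSub (mem_set bxi'), zeta', SigSub (mem_set geta')) rt_kernel_positive.
  by rewrite -!rt_elemE.
apply: total_sub (kernel_point_total _) _ => _ [[[xi zeta] eta] _ <-].
apply: cspan_incl; exists (val xi), zeta, (val eta); rewrite rt_elemE.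
by split=> //; exact: set_valP.
Qed.

Lemma rt_ket1P xi : beta xi ->
  is_ket gamma (rt_elem beta gamma) xi (rt_ket1 beta gamma xi).
Proof.
move=> bxi; have [X hX _] := frame_ket1 rt_frame bxi.
exact: (xgetPex 0 (ex_intro _ X hX)).
Qed.

Lemma rt_ket2P eta : gamma eta ->
  is_ket beta (fun eta zeta xi => rt_elem beta gamma xi zeta eta) eta
    (rt_ket2 beta gamma eta).
Proof.
move=> geta; have [X hX _] := frame_ket1 (frame_flip rt_frame) geta.
have hX' : exists X : bop H (rtensor beta gamma), forall xi zeta, beta xi ->
    X (xi zeta) = rt_elem beta gamma xi zeta eta.
  by exists X => xi zeta; exact: hX.
by move=> zeta xi; apply: (xgetPex 0 hX').
Qed.

Lemma opnorm_ket1 xi : beta xi -> opnorm (rt_ket1 beta gamma xi) <= opnorm xi.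
Proof.
move=> bxi; have [X hX] := frame_ket1 rt_frame bxi.
by rewrite (is_ket_uniq rt_frame (rt_ket1P bxi) hX).
Qed.

Lemma opnorm_ket2 eta : gamma eta -> opnorm (rt_ket2 beta gamma eta) <= opnorm eta.
Proof.
move=> geta; have [X hX] := frame_ket1 (frame_flip rt_frame) geta.
by rewrite (is_ket_uniq (frame_flip rt_frame) (rt_ket2P geta) hX).
Qed.

Lemma rt_ket1D a xi xi' :
  (forall a xi xi', beta xi -> beta xi' -> beta (a *: xi + xi')) ->
  beta xi -> beta xi' -> rt_ket1 beta gamma (a *: xi + xi') =
    a *: rt_ket1 beta gamma xi + rt_ket1 beta gamma xi'.
Proof.
move=> bD bxi bxi'.
by apply: (is_ket_linear rt_frame bD bxi bxi') => //; apply: rt_ket1P => //; exact: bD.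
Qed.

Lemma rt_ket2D a eta eta' :
  (forall a eta eta', gamma eta -> gamma eta' -> gamma (a *: eta + eta')) ->
  gamma eta -> gamma eta' -> rt_ket2 beta gamma (a *: eta + eta') =
    a *: rt_ket2 beta gamma eta + rt_ket2 beta gamma eta'.
Proof.
move=> gD geta geta'.
by apply: (is_ket_linear (frame_flip rt_frame) gD geta geta') => //; apply: rt_ket2P => //; exact: gD.
Qed.

(** For iterated tensor products and direct sums, [xi] is itself only a limit of combinations of
    generators. Since the ket depends linearly and contractively on [xi] in [beta], membership in
    [P] can be tested on those generators. *)
Lemma cspan_ket1 (V : hilbertType R) (Y : set (bop Z H)) (P : set (bop V (rtensor beta gamma)))
    (d : bop V K) : closed_subspace beta -> Y `<=` beta -> closed_subspace P ->
  (forall xi, Y xi -> P (bop_comp (rt_ket1 beta gamma xi) d)) ->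
  forall xi, cspan Y xi -> P (bop_comp (rt_ket1 beta gamma xi) d).
Proof.
move=> cb Yb cP; have [_ _ bD] := cb.
apply: (@cspan_map_on _ _ _ beta Y P (fun xi => bop_comp (rt_ket1 beta gamma xi) d) (opnorm d)) => //.
- exact: opnorm_ge0.
- by move=> a x y bx by_; rewrite rt_ket1D// bop_comp_linearl.
- move=> x bx; apply: le_trans (opnorm_comp _ _) _.
  by rewrite mulrC ler_wpM2l ?opnorm_ge0// opnorm_ket1.
Qed.

Lemma cspan_ket2 (V : hilbertType R) (Y : set (bop Z K)) (P : set (bop V (rtensor beta gamma)))
    (d : bop V H) : closed_subspace gamma -> Y `<=` gamma -> closed_subspace P ->
  (forall eta, Y eta -> P (bop_comp (rt_ket2 beta gamma eta) d)) ->
  forall eta, cspan Y eta -> P (bop_comp (rt_ket2 beta gamma eta) d).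
Proof.
move=> cb Yb cP; have [_ _ bD] := cb.
apply: (@cspan_map_on _ _ _ gamma Y P (fun xi => bop_comp (rt_ket2 beta gamma xi) d) (opnorm d)) => //.
- exact: opnorm_ge0.
- by move=> a x y bx by_; rewrite rt_ket2D// bop_comp_linearl.
- move=> x bx; apply: le_trans (opnorm_comp _ _) _.
  by rewrite mulrC ler_wpM2l ?opnorm_ge0// opnorm_ket2.
Qed.
End rtensor_theory.

Lemma bop_compA (R : realType) (H1 H2 H3 H4 : hilbertType R)
    (f : bop H3 H4) (g : bop H2 H3) (h : bop H1 H2) :
  bop_comp f (bop_comp g h) = bop_comp (bop_comp f g) h.
Proof. exact: bopP. Qed.

(** * Gram conditions and the representations rho *)

Section pre_modules.
Variable R : realType.

(* The part of the module axioms on which the construction of the relative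
   tensor product depends.  It passes to tensor products and direct sums, so
   iterated tensor products need not be shown to be C*-modules first. *)
Record pre_module (Z H : hilbertType R) (D : set (bop Z Z)) (beta : set (bop Z H)) :
    Prop := PreModule {
  pre_closed : closed_subspace beta;
  pre_total : cspan (set_app beta) = setT;
  pre_gram : forall xi xi', beta xi -> beta xi' -> D (bop_comp (adjoint xi) xi')
}.

Lemma pre_gram_comm (Z H K : hilbertType R) (D E : set (bop Z Z))
    (beta : set (bop Z H)) (gamma : set (bop Z K)) :
  (forall x y, D x -> E y -> bop_comp x y = bop_comp y x) ->
  pre_module D beta -> pre_module E gamma -> gram_comm beta gamma.
Proof.
move=> DE pb pg xi xi' eta eta' bxi bxi' geta geta' z.
have := DE _ _ (pre_gram pb bxi bxi') (pre_gram pg geta geta').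
by move=> /(congr1 (fun T : bop Z Z => T z)).
Qed.

(** The Gram condition is extended one variable at a time: directly in the right one, which enters
    linearly, and through adjoints in the left one, which enters conjugate linearly. *)
Lemma pre_module_cspan (Z H : hilbertType R) (D : set (bop Z Z)) (Y : set (bop Z H)) :
  closed_subspace D -> (forall x, D x -> D (adjoint x)) ->
  cspan (set_app Y) = setT ->
  (forall y y', Y y -> Y y' -> D (bop_comp (adjoint y) y')) ->
  pre_module D (cspan Y).
Proof.
move=> cD Dadj Yt Yg; split; first exact: closed_subspace_cspan.
  apply: total_sub Yt _ => _ [y Yy [x _ <-]]; apply: cspan_incl.
  by exists y; [exact: cspan_incl | exists x].
have h y z : Y y -> cspan Y z -> D (bop_comp (adjoint y) z).
  by move=> Yy; apply: (cspan_compl cD) => z'; exact: Yg.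
move=> z z' Yz; move: z'; apply: (cspan_compl cD) => y Yy.
by rewrite -(adjointK y) -adjoint_comp; apply/Dadj/h.
Qed.

Lemma cmodule_pre (b : cbase R) (H : hilbertType R) (beta : set (bop b H)) :
  is_cmodule beta -> pre_module (cb_alg b) beta.
Proof.
case=> cb tb _ gb; split=> // xi xi' bxi bxi'; rewrite -gb; apply: cspan_incl.
by exists (adjoint xi); [exists xi | exists xi'].
Qed.

Definition right_pre_module (a b : cbase R) (M : bimod a b) :=
  pre_module (cb_alg b) (bm_right M).
Definition left_pre_module (a b : cbase R) (M : bimod a b) :=
  pre_module (cb_dag a) (bm_left M).

Lemma cbimod_right (a b : cbase R) (M : cbimod a b) : right_pre_module M.
Proof. by have [_ h _ _] := cbimodP M; exact: cmodule_pre. Qed.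

Lemma cbimod_left (a b : cbase R) (M : cbimod a b) : left_pre_module M.
Proof. by have [h _ _ _] := cbimodP M; exact: (@cmodule_pre (cbase_op a)). Qed.

Lemma cbimod_rho_left (a b : cbase R) (M : cbimod a b) x d :
  cb_alg a x -> bm_right M d -> bm_right M (bop_comp (rho_left M x) d).
Proof.
move=> ax Md; have [_ _ <- _] := cbimodP M; apply: cspan_incl.
by exists (rho_left M x); [exists x | exists d].
Qed.

Lemma cbimod_rho_right (a b : cbase R) (M : cbimod a b) x d :
  cb_dag b x -> bm_left M d -> bm_left M (bop_comp (rho_right M x) d).
Proof.
move=> ax Md; have [_ _ _ <-] := cbimodP M; apply: cspan_incl.
by exists (rho_right M x); [exists x | exists d].
Qed.

(** The solution [X] is supplied by the context: a Gram operator of two kets, or a unit isomorphism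
    composed with a ket. *)
Lemma rhoE (b : cbase R) (H : hilbertType R) (beta : set (bop b H)) (x : bop b b) (X : bop H H) :
  cspan (set_app beta) = setT ->
  (forall xi zeta, beta xi -> X (xi zeta) = xi (x zeta)) -> rho beta x = X.
Proof.
move=> tb hX; apply: (bop_eq_total tb) => _ [xi bxi [zeta _ <-]].
have ex : exists T : bop H H, forall xi zeta, beta xi -> T (xi zeta) = xi (x zeta).
  by exists X.
by rewrite hX//; apply: (xgetPex 0 ex).
Qed.
End pre_modules.

(** * Kets and module structures on tensor products *)

Section tensor_theory.
Variables (R : realType) (a b c : cbase R) (M : bimod a b) (N : bimod b c).
Hypotheses (Mr : right_pre_module M) (Nl : left_pre_module N).

Let comm : gram_comm (bm_right M) (bm_left N).
Proof. exact: pre_gram_comm (@cb_commute _ b) Mr Nl. Qed.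

Lemma tensor_frame : frame (bm_right M) (bm_left N) (elem M N).
Proof. exact: rt_frame (pre_total Mr) (pre_total Nl) comm. Qed.

Lemma ket1E xi zeta eta : bm_right M xi -> bm_left N eta ->
  ket1 M N xi (eta zeta) = elem M N xi zeta eta.
Proof. by move=> bxi; apply: (rt_ket1P (pre_total Mr) (pre_total Nl) comm bxi). Qed.

Lemma ket2E xi zeta eta : bm_right M xi -> bm_left N eta ->
  ket2 M N eta (xi zeta) = elem M N xi zeta eta.
Proof. by move=> bxi geta; apply: (rt_ket2P (pre_total Mr) (pre_total Nl) comm geta). Qed.

Lemma ket1_gram xi xi' eta zeta : bm_right M xi -> bm_right M xi' -> bm_left N eta ->
  adjoint (ket1 M N xi) (ket1 M N xi' (eta zeta)) = eta (adjoint xi (xi' zeta)).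
Proof.
move=> bxi bxi' geta.
apply: (is_ket_gram tensor_frame bxi bxi') => //;
  exact: (rt_ket1P (pre_total Mr) (pre_total Nl) comm).
Qed.

Lemma ket2_gram eta eta' xi zeta : bm_left N eta -> bm_left N eta' -> bm_right M xi ->
  adjoint (ket2 M N eta) (ket2 M N eta' (xi zeta)) = xi (adjoint eta (eta' zeta)).
Proof.
move=> bxi bxi' geta.
apply: (is_ket_gram (frame_flip tensor_frame) bxi bxi') => //;
  exact: (rt_ket2P (pre_total Mr) (pre_total Nl) comm).
Qed.

Lemma ket1_rho xi xi' : bm_right M xi -> bm_right M xi' ->
  bop_comp (adjoint (ket1 M N xi)) (ket1 M N xi') =
  rho_left N (bop_comp (adjoint xi) xi').
Proof.
move=> bxi bxi'; apply/esym/(@rhoE _ (cbase_op b)); first exact: pre_total Nl.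
by move=> eta zeta geta; exact: ket1_gram.
Qed.

Lemma ket2_rho eta eta' : bm_left N eta -> bm_left N eta' ->
  bop_comp (adjoint (ket2 M N eta)) (ket2 M N eta') =
  rho_right M (bop_comp (adjoint eta) eta').
Proof.
move=> bxi bxi'; apply/esym/rhoE; first exact: pre_total Mr.
by move=> eta0 zeta geta; exact: ket2_gram.
Qed.

Lemma tensor_cspan_ket1 (V : hilbertType R) (Y : set (bop b M))
    (P : set (bop V (tensor M N))) (d : bop V N) :
  Y `<=` bm_right M -> closed_subspace P ->
  (forall xi, Y xi -> P (bop_comp (ket1 M N xi) d)) ->
  forall xi, cspan Y xi -> P (bop_comp (ket1 M N xi) d).
Proof.
apply: (cspan_ket1 (pre_total Mr) (pre_total Nl) comm); exact: pre_closed Mr.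
Qed.

Lemma tensor_cspan_ket2 (V : hilbertType R) (Y : set (bop b N))
    (P : set (bop V (tensor M N))) (d : bop V M) :
  Y `<=` bm_left N -> closed_subspace P ->
  (forall eta, Y eta -> P (bop_comp (ket2 M N eta) d)) ->
  forall eta, cspan Y eta -> P (bop_comp (ket2 M N eta) d).
Proof.
apply: (cspan_ket2 (pre_total Mr) (pre_total Nl) comm); exact: pre_closed Nl.
Qed.

Lemma tensor_rightI xi d : bm_right M xi -> bm_right N d ->
  bm_right (tensor M N) (bop_comp (ket1 M N xi) d).
Proof.
by move=> bxi bd; apply: cspan_incl; exists (ket1 M N xi); [exists xi | exists d].
Qed.

Lemma tensor_leftI eta d : bm_left N eta -> bm_left M d ->
  bm_left (tensor M N) (bop_comp (ket2 M N eta) d).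
Proof.
by move=> bxi bd; apply: cspan_incl; exists (ket2 M N eta); [exists eta | exists d].
Qed.

(** The Gram operator of [|xi>_1 d] and [|xi'>_1 d'] is [d^* rho(xi^* xi') d'], so it lies in
    [cb_alg c] as soon as [rho] maps [bm_right N] into itself. *)
Lemma tensor_right_pre : right_pre_module N ->
  (forall x d, cb_alg b x -> bm_right N d ->
     bm_right N (bop_comp (rho_left N x) d)) -> right_pre_module (tensor M N).
Proof.
move=> Nr rhoN; have [cC _ adjC] := cb_alg_cstar c.
apply: pre_module_cspan => //.
  apply: total_sub (frame_total tensor_frame) _ => _ [xi [zeta [eta [bxi geta ->]]]].
  rewrite -ket1E//; move: (eta zeta) => x; have : cspan (set_app (bm_right N)) x.
    by rewrite (pre_total Nr).
  apply: (cspan_app (closed_subspace_cspan _)) => _ [d Nd [z _ <-]].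
  apply: cspan_incl; exists (bop_comp (ket1 M N xi) d); last by exists z.
  by exists (ket1 M N xi); [exists xi | exists d].
move=> _ _ [_ [xi bxi <-] [d Nd <-]] [_ [xi' bxi' <-] [d' Nd' <-]].
rewrite adjoint_comp -bop_compA (bop_compA (adjoint _) _ d') ket1_rho//.
apply: (pre_gram Nr Nd); apply: rhoN => //.
exact: (pre_gram Mr).
Qed.

Lemma tensor_left_pre : left_pre_module M ->
  (forall x d, cb_dag b x -> bm_left M d ->
     bm_left M (bop_comp (rho_right M x) d)) -> left_pre_module (tensor M N).
Proof.
move=> Ml rhoM; have [cC _ adjC] := cb_dag_cstar a.
apply: pre_module_cspan => //.
  apply: total_sub (frame_total tensor_frame) _ => _ [xi [zeta [eta [bxi geta ->]]]].
  rewrite -ket2E//; move: (xi zeta) => x; have : cspan (set_app (bm_left M)) x.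
    by rewrite (pre_total Ml).
  apply: (cspan_app (closed_subspace_cspan _)) => _ [d Nd [z _ <-]].
  apply: cspan_incl; exists (bop_comp (ket2 M N eta) d); last by exists z.
  by exists (ket2 M N eta); [exists eta | exists d].
move=> _ _ [_ [xi bxi <-] [d Nd <-]] [_ [xi' bxi' <-] [d' Nd' <-]].
rewrite adjoint_comp -bop_compA (bop_compA (adjoint _) _ d') ket2_rho//.
apply: (pre_gram Ml Nd); apply: rhoM => //.
exact: (pre_gram Nl).
Qed.
End tensor_theory.

(** * Tensor products of morphisms *)

Section op_tensor_theory.
Variables (R : realType) (a b c : cbase R).

Section op_tensor_pre.
Variables (M1 M2 : bimod a b) (N1 N2 : bimod b c).
Hypotheses (M1r : right_pre_module M1) (M2r : right_pre_module M2).
Hypotheses (N1l : left_pre_module N1) (N2l : left_pre_module N2).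
Variables (S : bop M1 M2) (T : bop N1 N2).
Hypothesis Sr : forall xi, bm_right M1 xi -> bm_right M2 (bop_comp S xi).
Hypothesis Tl : forall eta, bm_left N1 eta -> bm_left N2 (bop_comp T eta).

Lemma op_tensorP : is_op_tensor S T (op_tensor S T).
Proof.
apply: (xgetPex 0).
apply: (frame_op (tensor_frame M1r N1l) (tensor_frame M2r N2l) _ Sr Tl).
exact: pre_gram_comm (@cb_commute _ b) M2r N1l.
Qed.

Variable X : bop (tensor M1 N1) (tensor M2 N2).
Hypothesis XP : is_op_tensor S T X.

Lemma op_tensor_uniq : op_tensor S T = X.
Proof.
apply: (frame_ext (tensor_frame M1r N1l)) => xi zeta eta bxi geta.
by rewrite XP// op_tensorP.
Qed.

Lemma op_tensor_ket2 eta : bm_left N1 eta ->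
  bop_comp X (ket2 M1 N1 eta) = bop_comp (ket2 M2 N2 (bop_comp T eta)) S.
Proof.
move=> geta; apply: (bop_eq_total (pre_total M1r)) => _ [xi bxi [zeta _ <-]] /=.
rewrite ket2E// XP// -ket2E//; first exact: Sr.
exact: Tl.
Qed.

Lemma op_tensor_ket1 xi : bm_right M1 xi ->
  bop_comp X (ket1 M1 N1 xi) = bop_comp (ket1 M2 N2 (bop_comp S xi)) T.
Proof.
move=> bxi; apply: (bop_eq_total (pre_total N1l)) => _ [eta geta [zeta _ <-]] /=.
rewrite ket1E// XP// -ket1E//; first exact: Sr.
exact: Tl.
Qed.

Lemma op_tensor_left : (forall d, bm_left M1 d -> bm_left M2 (bop_comp S d)) ->
  forall d, bm_left (tensor M1 N1) d -> bm_left (tensor M2 N2) (bop_comp X d).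
Proof.
move=> Sl; apply: (cspan_compl (closed_subspace_cspan _)).
move=> _ [_ [eta geta <-] [d ad <-]].
rewrite bop_compA op_tensor_ket2// -bop_compA.
by apply: tensor_leftI; [exact: Tl | exact: Sl].
Qed.

Lemma op_tensor_right : (forall d, bm_right N1 d -> bm_right N2 (bop_comp T d)) ->
  forall d, bm_right (tensor M1 N1) d -> bm_right (tensor M2 N2) (bop_comp X d).
Proof.
move=> Trr; apply: (cspan_compl (closed_subspace_cspan _)).
move=> _ [_ [eta geta <-] [d ad <-]].
rewrite bop_compA op_tensor_ket1// -bop_compA.
by apply: tensor_rightI; [exact: Sr | exact: Trr].
Qed.

(** The two hypotheses make the elementary tensors of [S^* xi] and [T^* eta] genuine ones instead of
    the default 0. With this lemma the adjoint half of the morphism property is an instance of the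
    direct half. *)
Lemma op_tensor_adjoint :
  (forall xi, bm_right M2 xi -> bm_right M1 (bop_comp (adjoint S) xi)) ->
  (forall eta, bm_left N2 eta -> bm_left N1 (bop_comp (adjoint T) eta)) ->
  is_op_tensor (adjoint S) (adjoint T) (adjoint X).
Proof.
move=> Sr' Tl' xi zeta eta bxi geta.
apply: (inner_eq_total (frame_total (tensor_frame M1r N1l))).
move=> _ [xi0 [zeta0 [eta0 [bxi0 geta0 ->]]]].
rewrite adjointEr XP// (frame_inner (tensor_frame M2r N2l))//; [|exact: Sr|exact: Tl].
rewrite (frame_inner (tensor_frame M1r N1l))//; [|exact: Sr'|exact: Tl'].
by rewrite !adjoint_comp.
Qed.
End op_tensor_pre.

Lemma op_tensor_morphism (M1 M2 : bimod a b) (N1 N2 : bimod b c)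
    (S : bop M1 M2) (T : bop N1 N2) :
  right_pre_module M1 -> right_pre_module M2 -> left_pre_module N1 -> left_pre_module N2 ->
  is_morphism S -> is_morphism T ->
  is_op_tensor S T (op_tensor S T) /\ is_morphism (op_tensor S T).
Proof.
move=> M1r M2r N1l N2l [Sl Sl' Sr Sr'] [Tl Tl' Tr Tr'].
have XP := op_tensorP M1r M2r N1l N2l Sr Tl.
have XP' := op_tensor_adjoint M1r M2r N1l N2l Sr Tl XP Sr' Tl'.
split=> //; split.
- exact: op_tensor_left XP Sl.
- exact: op_tensor_left XP' Sl'.
- exact: op_tensor_right XP Tr.
- exact: op_tensor_right XP' Tr'.
Qed.
End op_tensor_theory.

(** * Isomorphisms and their inverses *)

Section isomorphisms.
Variable R : realType.

(** By [cspan_compl] the preimage equals its own closed span. *)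
Lemma closed_subspace_preim (H K L : hilbertType R) (P : set (bop H L)) (S : bop K L) :
  closed_subspace P -> closed_subspace [set T : bop H K | P (bop_comp S T)].
Proof.
move=> cP; set A := [set T | _]; suff <- : cspan A = A.
  exact: closed_subspace_cspan.
by apply/seteqP; split; [exact: cspan_compl | exact: cspan_incl].
Qed.

(** It turns each identity for a unitary on generators into one for the inverse, so the condition on
    the adjoint needs no second computation. *)
Lemma unitary_adjoint (H K V : hilbertType R) (X : bop H K) (f : bop V H) (g : bop V K) :
  unitary X -> bop_comp X f = g -> bop_comp (adjoint X) g = f.
Proof. by move=> [XX _] <-; rewrite bop_compA XX; exact: bopP. Qed.

Lemma is_isomorphism_adjoint (a b : cbase R) (M N : bimod a b) (X : bop M N) :
  is_isomorphism X -> is_isomorphism (adjoint X).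
Proof.
move=> [[XX XX'] [h1 h2 h3 h4]]; split; split; rewrite ?adjointK //.
Qed.
End isomorphisms.

(** * Associativity and units *)

Section associativity.
Variables (R : realType) (a b c d : cbase R).
Variables (H : cbimod a b) (K : cbimod b c) (L : cbimod c d).

Let Hr := cbimod_right H.
Let Kl := cbimod_left K.
Let Kr := cbimod_right K.
Let Ll := cbimod_left L.
Let HKr : right_pre_module (tensor H K).
Proof. by apply: tensor_right_pre => // *; exact: cbimod_rho_left. Qed.
Let KLl : left_pre_module (tensor K L).
Proof. by apply: tensor_left_pre => // *; exact: cbimod_rho_right. Qed.

Let HK := tensor H K.
Let KL := tensor K L.

(** The Gram operator of two kets [|theta>_2] is right multiplication by [theta^* theta'] on module
    elements; [|xi>_1 k] is such an element of [HK] whenever [k] is one of [K]. *)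
Lemma ket2_gram_ket1 xi theta theta' : bm_right H xi -> bm_left L theta -> bm_left L theta' ->
  bop_comp (bop_comp (adjoint (ket2 HK L theta)) (ket2 HK L theta')) (ket1 H K xi) =
  bop_comp (ket1 H K xi) (bop_comp (adjoint (ket2 K L theta)) (ket2 K L theta')).
Proof.
move=> bxi lt lt'; apply: (bop_eq_total (pre_total Kr)) => _ [k Kk [z _ <-]] /=.
rewrite (ket2_gram Kr Ll)//.
by apply: (@ket2_gram _ _ _ _ HK L HKr Ll theta theta' (bop_comp (ket1 H K xi) k)) => //;
  exact: tensor_rightI.
Qed.

Lemma ket1_gram_ket2 xi xi' theta : bm_right H xi -> bm_right H xi' -> bm_left L theta ->
  bop_comp (bop_comp (adjoint (ket1 H KL xi)) (ket1 H KL xi')) (ket2 K L theta) =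
  bop_comp (ket2 K L theta) (bop_comp (adjoint (ket1 H K xi)) (ket1 H K xi')).
Proof.
move=> bxi bxi' lt; apply: (bop_eq_total (pre_total Kl)) => _ [k Kk [z _ <-]] /=.
rewrite (ket1_gram Hr Kl)//.
by apply: (@ket1_gram _ _ _ _ H KL Hr KLl xi xi' (bop_comp (ket2 K L theta) k)) => //;
  exact: tensor_leftI.
Qed.

(** On a vector [k z] the second Gram operator acts inside, on [z], whereas the first acts outside,
    as a [rho_left] that maps [bm_right K] into itself. *)
Lemma ket_grams_commute xi xi' theta theta' :
  bm_right H xi -> bm_right H xi' -> bm_left L theta -> bm_left L theta' ->
  bop_comp (bop_comp (adjoint (ket1 H K xi)) (ket1 H K xi'))
    (bop_comp (adjoint (ket2 K L theta)) (ket2 K L theta')) =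
  bop_comp (bop_comp (adjoint (ket2 K L theta)) (ket2 K L theta'))
    (bop_comp (adjoint (ket1 H K xi)) (ket1 H K xi')).
Proof.
move=> bxi bxi' lt lt'; set A := bop_comp (adjoint _) (ket1 _ _ _).
have rA k : bm_right K k -> bm_right K (bop_comp A k).
  move=> Kk; rewrite /A ket1_rho//; apply: cbimod_rho_left => //.
  exact: (pre_gram Hr).
apply: (bop_eq_total (pre_total Kr)) => _ [k Kk [z _ <-]].
have e w : A (k w) = bop_comp A k w by [].
rewrite -[LHS]/(A (adjoint (ket2 K L theta) (ket2 K L theta' (k z)))).
rewrite -[RHS]/(adjoint (ket2 K L theta) (ket2 K L theta' (A (k z)))).
by rewrite (ket2_gram Kr Ll)// !e (ket2_gram Kr Ll)//; exact: rA.
Qed.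

Let T := {t : bop b H * K * bop c L | bm_right H t.1.1 /\ bm_left L t.2}.
Let f (t : T) := ket2 HK L (sval t).2 (ket1 H K (sval t).1.1 (sval t).1.2).
Let g (t : T) := ket1 H KL (sval t).1.1 (ket2 K L (sval t).2 (sval t).1.2).

Let f_total : cspan (range f) = setT.
Proof.
apply: total_sub (frame_total (tensor_frame HKr Ll)) _.
move=> _ [Xi [zeta [theta [bXi lt ->]]]]; rewrite -ket2E//.
move: (Xi zeta) => x.
have : cspan [set w | exists xi zeta eta,
    [/\ bm_right H xi, bm_left K eta & w = elem H K xi zeta eta]] x.
  by rewrite (frame_total (tensor_frame Hr Kl)).
apply: (cspan_app (closed_subspace_cspan _)) => _ [xi [z [eta [bxi geta ->]]]].
rewrite -ket1E//; apply: cspan_incl.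
by exists (exist _ (xi, eta z, theta) (conj bxi lt)).
Qed.

Let g_total : cspan (range g) = setT.
Proof.
apply: total_sub (frame_total (tensor_frame Hr KLl)) _.
move=> _ [xi [zeta [Th [bxi lt ->]]]]; rewrite -ket1E//.
move: (Th zeta) => x.
have : cspan [set w | exists k zeta theta,
    [/\ bm_right K k, bm_left L theta & w = elem K L k zeta theta]] x.
  by rewrite (frame_total (tensor_frame Kr Ll)).
apply: (cspan_app (closed_subspace_cspan _)) => _ [k [z [theta [Kk lth ->]]]].
rewrite -ket2E//; apply: cspan_incl.
by exists (exist _ (xi, k z, theta) (conj bxi lth)).
Qed.

(** Pulling out the outer kets and then the inner ones leaves [<w, _ w'>] with the product of the
    same two Gram operators on [K], in one order for each bracketing. *)
Let fg_inner s t : inner (g s) (g t) = inner (f s) (f t).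
Proof.
case: s t => -[[xi w] th] [bxi lth] [[[xi' w'] th'] [bxi' lth']].
rewrite /f /g /= -[LHS]adjointEr -[RHS]adjointEr.
have := ket2_gram_ket1 bxi' lth lth' => /(congr1 (fun X : bop K HK => X w')) /= ->.
have := ket1_gram_ket2 bxi bxi' lth' => /(congr1 (fun X : bop K KL => X w')) /= ->.
rewrite -[LHS]adjointEr -[RHS]adjointEr.
have := ket_grams_commute bxi bxi' lth lth'.
by move=> /(congr1 (fun X : bop K K => X w')) /= ->.
Qed.

Let assoc (V : bop (tensor HK L) (tensor H KL)) :=
  unitary V /\ forall xi omega theta, bm_right H xi -> bm_left L theta ->
    V (ket2 HK L theta (ket1 H K xi omega)) = ket1 H KL xi (ket2 K L theta omega).

Lemma assoc_exists : exists! V, assoc V.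
Proof.
have [V VP] := bop_isometry f_total fg_inner.
have [VU _] := bop_unitary f_total g_total fg_inner VP.
exists V; split.
  by split=> // xi w th bxi lth; rewrite (VP (exist _ (xi, w, th) (conj bxi lth))).
move=> V' [_ V'P]; apply: (bop_eq_total f_total) => _ [t _ <-].
by rewrite VP V'P//; case: (svalP t).
Qed.

Lemma assoc_ket2 V theta eta : assoc V -> bm_left L theta -> bm_left K eta ->
  bop_comp V (bop_comp (ket2 HK L theta) (ket2 H K eta)) =
  ket2 H KL (bop_comp (ket2 K L theta) eta).
Proof.
move=> [_ VP] lth keta; apply: (bop_eq_total (pre_total Hr)) => _ [xi bxi [z _ <-]] /=.
rewrite ket2E// -ket1E// VP// (ket2E Hr KLl)//; last exact: tensor_leftI.
by rewrite -(ket1E Hr KLl)//; exact: tensor_leftI.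
Qed.

Lemma assoc_ket1 V xi k : assoc V -> bm_right H xi -> bm_right K k ->
  bop_comp V (ket1 HK L (bop_comp (ket1 H K xi) k)) =
  bop_comp (ket1 H KL xi) (ket1 K L k).
Proof.
move=> [_ VP] bxi Kk; apply: (bop_eq_total (pre_total Ll)) => _ [th lth [z _ <-]] /=.
rewrite (ket1E HKr Ll)//; last exact: tensor_rightI.
rewrite -(ket2E HKr Ll)//; last exact: tensor_rightI.
by rewrite /= VP// ket2E// -ket1E.
Qed.

(** [assoc_ket2] and [assoc_ket1] match generators of both module structures. Depending on the
    bracketing, the factor that is only given as a limit is the right factor of the composite or the
    argument of the ket. *)
Lemma assoc_isomorphism V : assoc V -> is_isomorphism V.
Proof.
move=> Va; have [VU VP] := Va; split=> //; split.
- apply: (cspan_compl (closed_subspace_cspan _)) => _ [_ [th lth <-] [x Hx <-]].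
  rewrite bop_compA; move: x Hx; apply: (cspan_compl (closed_subspace_cspan _)).
  move=> _ [_ [eta keta <-] [x Hx <-]].
  rewrite -bop_compA (bop_compA (ket2 _ _ _)) bop_compA assoc_ket2//.
  by apply: tensor_leftI => //; exact: tensor_leftI.
(* [Th] is only a limit of combinations of [|theta>_2 eta], so the argument of the ket has to be
   approximated. *)
- apply: (cspan_compl (closed_subspace_cspan _)) => _ [_ [Th lTh <-] [x Hx <-]].
  have h := @tensor_cspan_ket2 _ _ _ _ H KL Hr KLl _ _
    [set X | bm_left (tensor HK L) (bop_comp (adjoint V) X)] x (@cspan_incl _ _ _).
  apply: (h _ _ Th lTh); first exact/closed_subspace_preim/closed_subspace_cspan.
  move=> _ [_ [th lth <-] [eta keta <-]]; rewrite /mkset.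
  rewrite bop_compA (unitary_adjoint VU (assoc_ket2 Va lth keta)) -bop_compA.
  by apply: tensor_leftI => //; exact: tensor_leftI.
- apply: (cspan_compl (closed_subspace_cspan _)) => _ [_ [Xi bXi <-] [x Lx <-]].
  have h := @tensor_cspan_ket1 _ _ _ _ HK L HKr Ll _ _
    [set X | bm_right (tensor H KL) (bop_comp V X)] x (@cspan_incl _ _ _).
  apply: (h _ _ Xi bXi); first exact/closed_subspace_preim/closed_subspace_cspan.
  move=> _ [_ [xi bxi <-] [k Kk <-]]; rewrite /mkset.
  rewrite bop_compA assoc_ket1// -bop_compA.
  by apply: tensor_rightI => //; exact: tensor_rightI.
- apply: (cspan_compl (closed_subspace_cspan _)) => _ [_ [xi bxi <-] [x Hx <-]].
  rewrite bop_compA; move: x Hx; apply: (cspan_compl (closed_subspace_cspan _)).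
  move=> _ [_ [k Kk <-] [x Lx <-]].
  rewrite -bop_compA (bop_compA (ket1 _ _ _)) bop_compA.
  rewrite (unitary_adjoint VU (assoc_ket1 Va bxi Kk)).
  by apply: tensor_rightI => //; exact: tensor_rightI.
Qed.
End associativity.

(** * Units *)

Section unit_module.
Variables (R : realType).

Lemma unit_right (b : cbase R) : right_pre_module (unit_bimod b).
Proof.
have [cB mB aB] := cb_alg_cstar b; split=> //; first exact: cb_alg_nondeg.
by move=> x y bx by_; apply: mB => //; exact: aB.
Qed.

Lemma unit_left (b : cbase R) : left_pre_module (unit_bimod b).
Proof.
have [cB mB aB] := cb_dag_cstar b; split=> //; first exact: cb_dag_nondeg.
by move=> x y bx by_; apply: mB => //; exact: aB.
Qed.

Lemma bop_comp_eval (H K L : hilbertType R) (f : bop K L) (g : bop H K)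
  (h : bop H L) : bop_comp f g = h -> forall x, f (g x) = h x.
Proof. by move=> <-. Qed.

(** The map preserves inner products because [xi^* xi'] commutes with [y^*]. Composed with [|xi>_1]
    it is [xi], and with [|y>_2] it is [rho_right H y]. The module structures therefore correspond
    through [[beta B] = beta] and the invariance of the left module under [rho_right]. *)
Lemma right_unit (a b : cbase R) (H : cbimod a b) :
  exists X : bop (tensor H (unit_bimod b)) H, is_isomorphism X /\
     forall xi zeta y, bm_right H xi -> cb_dag b y ->
       X (elem H (unit_bimod b) xi zeta y) = xi (y zeta) /\
       xi (y zeta) = rho_right H y (xi zeta).
Proof.
have Hr := cbimod_right H; have Ul := unit_left b; set U := unit_bimod b.
have [_ Hcr rhoL rhoR] := cbimodP H; have [_ _ HB _] := Hcr.
have [_ _ adjB] := cb_dag_cstar b.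
pose T := {t : bop b H * b * bop b b | bm_right H t.1.1 /\ cb_dag b t.2}.
pose f (t : T) := elem H U (sval t).1.1 (sval t).1.2 (sval t).2.
pose g (t : T) := (sval t).1.1 ((sval t).2 (sval t).1.2).
have f_total : cspan (range f) = setT.
  apply: total_sub (frame_total (tensor_frame Hr Ul)) _.
  move=> _ [xi [z [y [bxi by_ ->]]]]; apply: cspan_incl.
  by exists (exist _ (xi, z, y) (conj bxi by_)).
have g_total : cspan (range g) = setT.
  apply: total_sub (pre_total Hr) _ => _ [xi bxi [z _ <-]].
  have : cspan (set_app (cb_dag b)) z by rewrite cb_dag_nondeg.
  apply: (cspan_app (closed_subspace_cspan _)) => _ [y by_ [z' _ <-]].
  by apply: cspan_incl; exists (exist _ (xi, z', y) (conj bxi by_)).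
have fg s t : inner (g s) (g t) = inner (f s) (f t).
  case: s t => -[[xi z] y] [bxi by_] [[[xi' z'] y'] [bxi' by']].
  rewrite /f /g /= (frame_inner (tensor_frame Hr Ul))//.
  rewrite -adjointEr -adjointEr; congr inner.
  have := cb_commute (pre_gram Hr bxi bxi') (adjB _ by_).
  by move=> /bop_comp_eval /= ->.
have [X XP] := bop_isometry f_total fg.
have [XU _] := bop_unitary f_total g_total fg XP.
have XE xi z y : bm_right H xi -> cb_dag b y -> X (elem H U xi z y) = xi (y z).
  by move=> bxi by_; rewrite (XP (exist _ (xi, z, y) (conj bxi by_))).
have X2 y : cb_dag b y -> bop_comp X (ket2 H U y) = rho_right H y.
  move=> by_; apply/esym/rhoE; first exact: pre_total Hr.
  by move=> xi z bxi /=; rewrite (ket2E Hr Ul)// XE.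
have X1 xi : bm_right H xi -> bop_comp X (ket1 H U xi) = xi.
  move=> bxi; apply: (bop_eq_total (cb_dag_nondeg b)) => _ [y by_ [z _ <-]] /=.
  by rewrite (ket1E Hr Ul)// XE.
exists X; split; last first.
  move=> xi z y bxi by_; split; first exact: XE.
  by rewrite -X2//= (ket2E Hr Ul)// XE.
split=> //; split.
- apply: (cspan_compl (pre_closed (cbimod_left H))) => _ [_ [y by_ <-] [x Hx <-]].
  by rewrite bop_compA X2//; exact: cbimod_rho_right.
- rewrite -{1}rhoR; apply: (cspan_compl (closed_subspace_cspan _)).
  move=> _ [_ [y by_ <-] [x Hx <-]].
  rewrite bop_compA (unitary_adjoint XU (X2 _ by_)).
  exact: tensor_leftI.
- apply: (cspan_compl (pre_closed Hr)) => _ [_ [xi bxi <-] [x Hx <-]].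
  rewrite bop_compA X1// -HB; apply: cspan_incl.
  by exists xi => //; exists x.
- rewrite -{1}HB; apply: (cspan_compl (closed_subspace_cspan _)).
  move=> _ [xi bxi [x Hx <-]].
  rewrite bop_compA (unitary_adjoint XU (X1 _ bxi)).
  exact: tensor_rightI.
Qed.

Lemma left_unit (b c : cbase R) (K : cbimod b c) :
  exists X : bop (tensor (unit_bimod b) K) K, is_isomorphism X /\
     forall x zeta eta, cb_alg b x -> bm_left K eta ->
       X (elem (unit_bimod b) K x zeta eta) = eta (x zeta) /\
       eta (x zeta) = rho_left K x (eta zeta).
Proof.
have Kl := cbimod_left K; have Ur := unit_right b; set U := unit_bimod b.
have [Kcl _ rhoL rhoR] := cbimodP K; have [_ _ KB _] := Kcl.
have [_ _ adjB] := cb_alg_cstar b.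
pose T := {t : bop b b * b * bop b K | cb_alg b t.1.1 /\ bm_left K t.2}.
pose f (t : T) := elem U K (sval t).1.1 (sval t).1.2 (sval t).2.
pose g (t : T) := (sval t).2 ((sval t).1.1 (sval t).1.2).
have f_total : cspan (range f) = setT.
  apply: total_sub (frame_total (tensor_frame Ur Kl)) _.
  move=> _ [xi [z [y [bxi by_ ->]]]]; apply: cspan_incl.
  by exists (exist _ (xi, z, y) (conj bxi by_)).
have g_total : cspan (range g) = setT.
  apply: total_sub (pre_total Kl) _ => _ [eta keta [z _ <-]].
  have : cspan (set_app (cb_alg b)) z by rewrite cb_alg_nondeg.
  apply: (cspan_app (closed_subspace_cspan _)) => _ [y by_ [z' _ <-]].
  by apply: cspan_incl; exists (exist _ (y, z', eta) (conj by_ keta)).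
have fg s t : inner (g s) (g t) = inner (f s) (f t).
  case: s t => -[[x z] eta] [bx keta] [[[x' z'] eta'] [bx' keta']].
  rewrite /f /g /= (frame_inner (tensor_frame Ur Kl))//.
  rewrite -adjointEr -adjointEr; congr inner; congr (adjoint x _).
  have := cb_commute bx' (pre_gram Kl keta keta').
  by move=> /bop_comp_eval /= ->.
have [X XP] := bop_isometry f_total fg.
have [XU _] := bop_unitary f_total g_total fg XP.
have XE x z eta : cb_alg b x -> bm_left K eta -> X (elem U K x z eta) = eta (x z).
  by move=> bx keta; rewrite (XP (exist _ (x, z, eta) (conj bx keta))).
have X1 x : cb_alg b x -> bop_comp X (ket1 U K x) = rho_left K x.
  move=> bx; apply/esym/(@rhoE _ (cbase_op b)); first exact: pre_total Kl.
  by move=> eta z keta /=; rewrite (ket1E Ur Kl)// XE.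
have X2 eta : bm_left K eta -> bop_comp X (ket2 U K eta) = eta.
  move=> keta; apply: (bop_eq_total (cb_alg_nondeg b)) => _ [x bx [z _ <-]] /=.
  by rewrite (ket2E Ur Kl)// XE.
exists X; split; last first.
  move=> x z eta bx keta; split; first exact: XE.
  by rewrite -X1//= (ket1E Ur Kl)// XE.
split=> //; split.
- apply: (cspan_compl (pre_closed Kl)) => _ [_ [eta keta <-] [x Ux <-]].
  rewrite bop_compA X2// -KB; apply: cspan_incl.
  by exists eta => //; exists x.
- rewrite -{1}KB; apply: (cspan_compl (closed_subspace_cspan _)).
  move=> _ [eta keta [x Ux <-]].
  rewrite bop_compA (unitary_adjoint XU (X2 _ keta)).
  exact: tensor_leftI.
- apply: (cspan_compl (pre_closed (cbimod_right K))) => _ [_ [x bx <-] [k Kk <-]].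
  by rewrite bop_compA X1//; exact: cbimod_rho_left.
- rewrite -{1}rhoL; apply: (cspan_compl (closed_subspace_cspan _)).
  move=> _ [_ [x bx <-] [k Kk <-]].
  rewrite bop_compA (unitary_adjoint XU (X1 _ bx)).
  exact: tensor_rightI.
Qed.
End unit_module.

Lemma bop0E (R : realType) (H K : hilbertType R) x : (0 : bop H K) x = 0.
Proof. by []. Qed.

Lemma bop_comp0l (R : realType) (H K L : hilbertType R) (f : bop H K) :
  bop_comp (0 : bop K L) f = 0.
Proof. by apply: bopP => x. Qed.

(** * Direct sums *)

Section direct_sum_operators.
Variables (R : realType) (I : choiceType) (H : I -> hilbertType R).

Lemma dsum_inner_incl (x : dsum H) i (y : H i) :
  inner x (dsum_incl H i y) = inner (x i) y.
Proof.
apply: dsum_innerP; apply/cvgrPdist_lt => e e0.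
exists [fset i]%fset => // A /= iA; rewrite partial_sumE.
have iA' : i \in A by rewrite (fsubsetP iA)// inE.
rewrite (big_fsetD1 i)//= dfwithin big_seq big1 ?addr0 ?subrr ?normr0// => j.
by rewrite !inE => /andP[ji _]; rewrite dfwithout 1?eq_sym// inner0r.
Qed.

Lemma adjoint_incl i : adjoint (dsum_incl H i) = dsum_proj H i.
Proof. by apply: adjoint_eq => x y; rewrite dsum_inner_incl. Qed.

Lemma dsum_proj_incl i : bop_comp (dsum_proj H i) (dsum_incl H i) = bop_id (H i).
Proof. by apply: bopP => x /=; rewrite dfwithin. Qed.

Lemma dsum_proj_incl0 i j : i != j -> bop_comp (dsum_proj H i) (dsum_incl H j) = 0.
Proof. by move=> ij; apply: bopP => x /=; rewrite dfwithout// eq_sym. Qed.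

(** By Pythagoras the square distance from [x] to a finite partial sum is [<x, x>] minus the
    corresponding partial sum of the series defining [<x, x>]. *)
Lemma dsum_cvg (x : dsum H) :
  partial_sum (fun i => dsum_incl H i (x i)) @ totally --> x.
Proof.
pose u (A : {fset I}) := \sum_(i <- A) dsum_incl H i (x i).
pose S (A : {fset I}) := \sum_(i <- A) inner (x i) (x i).
have uE A : partial_sum (fun i => dsum_incl H i (x i)) A = u A by rewrite partial_sumE.
have xu A : inner x (u A) = S A.
  by rewrite inner_sumr; apply: eq_bigr => i _; rewrite dsum_inner_incl.
have ux A : inner (u A) x = S A.
  rewrite innerC xu rmorph_sum; apply: eq_bigr => i _; exact: inner_real.
have uu A : inner (u A) (u A) = S A.
  rewrite {2}/u inner_sumr big_seq [RHS]big_seq; apply: eq_bigr => i iA.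
  rewrite dsum_inner_incl; congr inner.
  rewrite -[LHS]/(dsum_proj H i (u A)) linear_sum/=.
  rewrite (big_fsetD1 i)//= dfwithin big_seq big1 ?addr0// => j.
  by rewrite !inE => /andP[ji _]; rewrite dfwithout.
have xuE A : `|x - u A| ^+ 2 = inner x x - S A.
  by rewrite -inner_norm innerBr !innerBl xu ux uu subrr subr0.
have Sx := @dsum_inner_cvg _ _ _ x x.
apply/cvgrPdist_lt => e e0.
move/cvgrPdist_lt: Sx => /(_ _ (exprn_gt0 2 e0)); apply: filterS => A.
rewrite uE partial_sumE -/(S A) -[dsum_inner x x]/(inner x x) -xuE => h.
rewrite -(@ltr_pXn2r _ 2)// ?nnegrE ?(ltW e0)//.
by apply: le_lt_trans h; rewrite ger0_norm// exprn_ge0.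
Qed.

Lemma dsum_total : cspan [set x | exists i y, x = dsum_incl H i y] = setT.
Proof.
set Y := [set x | _]; apply/seteqP; split=> // x _.
have [cl c0 cD] := closed_subspace_cspan Y.
apply: cl; apply/closure_normP => e e0.
move/cvgrPdist_lt: (@dsum_cvg x) => /(_ _ e0) [A _ AP].
exists (\sum_(i <- A) dsum_incl H i (x i)); last first.
  by have := AP A; rewrite partial_sumE; apply=> /=.
elim/big_rec: _ => // i y _ cy; rewrite -[dsum_incl H i _]scale1r; apply: cD => //.
by apply: cspan_incl; exists i, (x i).
Qed.

Variable Z : hilbertType R.
Variable alpha : forall i, set (bop Z (H i)).
Arguments alpha : clear implicits.
Hypothesis alpha0 : forall i, alpha i 0.

Definition incl_ops : set (bop Z (dsum H)) :=
  [set T | exists i, exists2 xi, alpha i xi & T = bop_comp (dsum_incl H i) xi].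

(** A finitely supported family is the sum of its components; conversely one component is completed
    to a family by zeros, which lie in every [alpha i]. Later arguments then meet generators with a
    single index only. *)
Lemma dsum_opsE : dsum_ops alpha = cspan incl_ops.
Proof.
apply: cspan_eq.
- move=> T [xi [axi fxi TE]].
  have [_ c0 cD] := closed_subspace_cspan incl_ops.
  pose F := fset_set [set i | xi i != 0].
  have -> : T = \sum_(i <- F) bop_comp (dsum_incl H i) (xi i).
    apply: bopP => z; rewrite bop_sumE; apply: dsumP => i; rewrite TE.
    rewrite -[RHS]/(dsum_proj H i (\sum_(j <- F) dsum_incl H j (xi j z))) linear_sum/=.
    have [iF|iF] := boolP (i \in F).
      rewrite (big_fsetD1 i)//= dfwithin big_seq big1 ?addr0// => j.
      by rewrite !inE => /andP[ji _]; rewrite dfwithout.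
    rewrite big_seq big1 => [|j jF].
      move: iF; rewrite /F in_fset_set// notin_setE /= => /negP.
      by rewrite negbK => /eqP ->.
    by rewrite dfwithout//; apply: contraNneq iF => <-.
  elim/big_rec: _ => // i S _ cS; rewrite -[bop_comp _ _]scale1r; apply: cD => //.
  by apply: cspan_incl; exists i, (xi i).
- move=> _ [i [xi axi ->]]; apply: cspan_incl.
  exists (dfwith (fun j => 0 : bop Z (H j)) i xi); split.
  + by move=> j; have [<-|ij] := eqVneq i j; rewrite ?dfwithin ?dfwithout.
  + apply: (@sub_finite_set _ _ [set i]) => // j /=.
    by have [<-//|ij] := eqVneq i j; rewrite dfwithout ?eqxx.
  + move=> z j /=; have [<-|ij] := eqVneq i j; first by rewrite !dfwithin.
    by rewrite !dfwithout.
Qed.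

Lemma incl_ops_total : (forall i, cspan (set_app (alpha i)) = setT) ->
  cspan (set_app incl_ops) = setT.
Proof.
move=> at_; apply: total_sub dsum_total _ => _ [i [x ->]].
have : cspan (set_app (alpha i)) x by rewrite at_.
apply: (cspan_app (closed_subspace_cspan _)) => _ [xi axi [z _ <-]].
apply: cspan_incl; exists (bop_comp (dsum_incl H i) xi); last by exists z.
by exists i, xi.
Qed.

Lemma dsum_pre (D : set (bop Z Z)) : closed_subspace D ->
  (forall x, D x -> D (adjoint x)) -> (forall i, pre_module D (alpha i)) ->
  pre_module D (dsum_ops alpha).
Proof.
move=> cD adjD ap; rewrite dsum_opsE; apply: pre_module_cspan => //.
  by apply: incl_ops_total => i; exact: pre_total (ap i).
move=> _ _ [i [xi axi ->]] [j [xi' axi' ->]].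
rewrite adjoint_comp -bop_compA (bop_compA (adjoint (dsum_incl _ _))) adjoint_incl.
have [ij|ij] := eqVneq i j; last first.
  rewrite dsum_proj_incl0//; suff -> : bop_comp (adjoint xi) (bop_comp 0 xi') = 0.
    by have [] := cD.
  by apply: bopP => z /=; rewrite linear0.
subst j; rewrite dsum_proj_incl.
rewrite (_ : bop_comp (bop_id (H i)) xi' = xi'); last exact: bopP.
exact: (pre_gram (ap i) axi axi').
Qed.
End direct_sum_operators.

Section direct_sum_unitary.
Variables (R : realType) (I : choiceType) (W : I -> hilbertType R) (V : hilbertType R).
Variable U : forall i, bop (W i) V.
Hypothesis U_isometry : forall i, bop_comp (adjoint (U i)) (U i) = bop_id (W i).
Hypothesis U_orth : forall i j, i != j -> bop_comp (adjoint (U i)) (U j) = 0.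
Hypothesis U_total : cspan [set v | exists i w, v = U i w] = setT.

(** The isometry and orthogonality relations of the [U i] are those of the canonical inclusions, so
    both total families have the same inner products. *)
Lemma dsum_unitary : exists2 Phi : bop (dsum W) V, unitary Phi &
  forall i, bop_comp Phi (dsum_incl W i) = U i.
Proof.
pose f (t : {i & W i}) := dsum_incl W (tag t) (tagged t).
pose g (t : {i & W i}) := U (tag t) (tagged t).
have f_total : cspan (range f) = setT.
  apply: total_sub (dsum_total W) _ => _ [i [w ->]].
  by apply: cspan_incl; exists (existT _ i w).
have g_total : cspan (range g) = setT.
  apply: total_sub U_total _ => _ [i [w ->]].
  by apply: cspan_incl; exists (existT _ i w).
have fg s t : inner (g s) (g t) = inner (f s) (f t).
  case: s t => i v [j w].
  rewrite -[LHS]/(inner (U i v) (U j w)).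
  rewrite -[RHS]/(inner (dsum_incl W i v) (dsum_incl W j w)).
  rewrite -[LHS]adjointEr -[RHS]adjointEr adjoint_incl.
  have [ij|ij] := eqVneq i j.
    subst j; rewrite (bop_comp_eval (U_isometry i)).
    by rewrite (bop_comp_eval (dsum_proj_incl W i)).
  by rewrite (bop_comp_eval (U_orth ij)) (bop_comp_eval (dsum_proj_incl0 W ij)).
have [Phi PhiP] := bop_isometry f_total fg.
have [PhiU _] := bop_unitary f_total g_total fg PhiP.
exists Phi => // i; apply: bopP => w.
exact: (PhiP (existT _ i w)).
Qed.
End direct_sum_unitary.

Section direct_sum_modules.
Variables (R : realType) (a b : cbase R) (I : choiceType) (M : I -> bimod a b).
Hypotheses (Mr : forall i, right_pre_module (M i)) (Ml : forall i, left_pre_module (M i)).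

Lemma dsum_right : bm_right (dsum_bimod M) = cspan (incl_ops (fun i => bm_right (M i))).
Proof. by apply: dsum_opsE => i; have [] := pre_closed (Mr i). Qed.

Lemma dsum_left : bm_left (dsum_bimod M) = cspan (incl_ops (fun i => bm_left (M i))).
Proof. by apply: dsum_opsE => i; have [] := pre_closed (Ml i). Qed.

Lemma dsum_right_pre : right_pre_module (dsum_bimod M).
Proof.
have [cB _ aB] := cb_alg_cstar b; apply: dsum_pre => // i.
by have [] := pre_closed (Mr i).
Qed.

Lemma dsum_left_pre : left_pre_module (dsum_bimod M).
Proof.
have [cB _ aB] := cb_dag_cstar a; apply: dsum_pre => // i.
by have [] := pre_closed (Ml i).
Qed.

Lemma incl_morphism i : is_morphism (bimod_incl M i).
Proof.
have aux (Z : hilbertType R) (al : forall i, set (bop Z (M i))) :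
    (forall i, al i 0) -> closed_subspace (al i) ->
    (forall xi, al i xi -> cspan (incl_ops al) (bop_comp (dsum_incl _ i) xi)) /\
    (forall xi, cspan (incl_ops al) xi -> al i (bop_comp (adjoint (dsum_incl _ i)) xi)).
  move=> al0 cal; split=> [xi axi|].
    by apply: cspan_incl; exists i, xi.
  apply: (cspan_compl cal) => _ [j [xi axi ->]]; rewrite adjoint_incl bop_compA.
  have [ij|ij] := eqVneq i j; last first.
    rewrite dsum_proj_incl0//; rewrite (_ : bop_comp _ _ = 0)//.
    exact: bopP.
  subst j; rewrite dsum_proj_incl.
  by rewrite (_ : bop_comp (bop_id _) xi = xi)//; exact: bopP.
have [r1 r2] := aux b (fun i => bm_right (M i))
  (fun i => let: And3 _ h _ := pre_closed (Mr i) in h) (pre_closed (Mr i)).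
have [l1 l2] := aux a (fun i => bm_left (M i))
  (fun i => let: And3 _ h _ := pre_closed (Ml i) in h) (pre_closed (Ml i)).
by split; rewrite ?dsum_right ?dsum_left.
Qed.
End direct_sum_modules.

(** * Distributivity of the tensor product over direct sums *)

Section tensor_direct_sum.
Variables (R : realType) (a b c : cbase R) (I J : choiceType).
Variables (Hs : I -> cbimod a b) (Ks : J -> cbimod b c).

Let Hsum := dsum_bimod (fun i => Hs i).
Let Ksum := dsum_bimod (fun j => Ks j).
Let HK (p : I * J) := tensor (Hs p.1) (Ks p.2).
Let HKsum := dsum_bimod HK.

Let Hr i := cbimod_right (Hs i).
Let Hl i := cbimod_left (Hs i).
Let Kr j := cbimod_right (Ks j).
Let Kl j := cbimod_left (Ks j).
Let Hsr : right_pre_module Hsum. Proof. exact: dsum_right_pre Hr. Qed.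
Let Ksl : left_pre_module Ksum. Proof. exact: dsum_left_pre Kl. Qed.
Let iH i : bop (Hs i) Hsum := bimod_incl (fun i => Hs i) i.
Let iK j : bop (Ks j) Ksum := bimod_incl (fun j => Ks j) j.
Let iHm i : is_morphism (iH i) := incl_morphism Hr Hl i.
Let iKm j : is_morphism (iK j) := incl_morphism Kr Kl j.

Let U (p : I * J) : bop (HK p) (tensor Hsum Ksum) := op_tensor (iH p.1) (iK p.2).

Let Up p : is_op_tensor (iH p.1) (iK p.2) (U p) /\ is_morphism (U p).
Proof. exact: op_tensor_morphism. Qed.

Let Ua p : is_op_tensor (adjoint (iH p.1)) (adjoint (iK p.2)) (adjoint (U p)).
Proof.
have [_ _ r1 r2] := iHm p.1; have [l1 l2 _ _] := iKm p.2.
exact: op_tensor_adjoint (Up p).1 _ _.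
Qed.

Let U_isometry p : bop_comp (adjoint (U p)) (U p) = bop_id (HK p).
Proof.
have [_ _ r1 r2] := iHm p.1; have [l1 l2 _ _] := iKm p.2.
apply: (frame_ext (tensor_frame (Hr p.1) (Kl p.2))) => xi z eta bxi keta /=.
rewrite (Up p).1// Ua; [|exact: r1|exact: l1].
by congr elem; apply: bopP => x /=; rewrite adjoint_incl/= dfwithin.
Qed.

Let U_orth p q : p != q -> bop_comp (adjoint (U p)) (U q) = 0.
Proof.
move=> pq; have [_ _ r1 r2] := iHm q.1; have [l1 l2 _ _] := iKm q.2.
have [_ _ r1' r2'] := iHm p.1; have [l1' l2' _ _] := iKm p.2.
apply: (frame_ext (tensor_frame (Hr q.1) (Kl q.2))) => xi z eta bxi keta /=.
rewrite (Up q).1// Ua; [|exact: r1|exact: l1].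
(* One leg of this elementary tensor is 0; that the tensor then vanishes is read off its square
   norm. *)
apply/eqP; rewrite -normr_eq0 -sqrf_eq0 -inner_norm.
rewrite (frame_inner (tensor_frame (Hr p.1) (Kl p.2)));
  [|exact/r2'/r1|exact/l2'/l1|exact/r2'/r1|exact/l2'/l1].
have [p1|p1] := eqVneq p.1 q.1; last first.
  have -> : bop_comp (adjoint (iH p.1)) (bop_comp (iH q.1) xi) = 0.
    by rewrite bop_compA adjoint_incl dsum_proj_incl0// bop_comp0l.
  by rewrite bop0E linear0 inner0r.
have p2 : p.2 != q.2.
  by apply: contraNneq pq => p2; rewrite [p]surjective_pairing p1 p2 -surjective_pairing.
have -> : bop_comp (adjoint (iK p.2)) (bop_comp (iK q.2) eta) = 0.
  by rewrite bop_compA adjoint_incl dsum_proj_incl0// bop_comp0l.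
by rewrite bop0E !linear0 inner0r.
Qed.

(** The legs are decomposed in turn: [|Th>_2] is applied to a vector of the first sum, which is
    approximated by generators, and then [|iota_i xi>_1] to a vector of the second. *)
Let U_total : cspan [set v | exists p w, v = U p w] = setT.
Proof.
apply: total_sub (frame_total (tensor_frame Hsr Ksl)) _.
move=> _ [Xi [zeta [Th [bXi lTh ->]]]]; rewrite -(ket2E Hsr Ksl)//.
have : cspan (set_app (incl_ops (fun i => bm_right (Hs i)))) (Xi zeta).
  by rewrite incl_ops_total// => i; exact: pre_total (Hr i).
apply: (cspan_app (closed_subspace_cspan _)) => _ [_ [i [xi bxi ->]] [z _ <-]].
have iH_xi : bm_right Hsum (bop_comp (iH i) xi) by have [_ _ h _] := iHm i; exact: h.
rewrite (ket2E Hsr Ksl _ iH_xi)// -(ket1E Hsr Ksl)//.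
have : cspan (set_app (incl_ops (fun j => bm_left (Ks j)))) (Th z).
  by rewrite incl_ops_total// => j; exact: pre_total (Kl j).
apply: (cspan_app (closed_subspace_cspan _)) => _ [_ [j [eta keta ->]] [z' _ <-]].
have iK_eta : bm_left Ksum (bop_comp (iK j) eta) by have [h _ _ _] := iKm j; exact: h.
rewrite (ket1E Hsr Ksl)//; apply: cspan_incl; exists (i, j), (elem (Hs i) (Ks j) xi z' eta).
by rewrite (Up (i, j)).1.
Qed.

(** [Psi] is the adjoint of the unitary [Phi] that restricts to [U p] on each summand. Its component
    at [p] is [U p] adjoint, the tensor product of the projections, and the series for [Phi] is the
    image of [dsum_cvg] under a continuous map. *)
Lemma tensor_dsum :
  exists (Phi : bop HKsum (tensor Hsum Ksum)) (Psi : bop (tensor Hsum Ksum) HKsum),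
     [/\ is_isomorphism Phi, is_isomorphism Psi,
         bop_comp Psi Phi = bop_id _ & bop_comp Phi Psi = bop_id _] /\
     (forall omega : HKsum,
        partial_sum (fun p : I * J =>
          op_tensor (bimod_incl (fun i => Hs i) p.1) (bimod_incl (fun j => Ks j) p.2)
            (omega p)) @ totally --> Phi omega) /\
     (forall (omega : tensor Hsum Ksum) (p : I * J),
        Psi omega p =
        op_tensor (bimod_proj (fun i => Hs i) p.1) (bimod_proj (fun j => Ks j) p.2)
          omega).
Proof.
have [Phi PhiU PhiP] := dsum_unitary U_isometry U_orth U_total.
have HKl p : left_pre_module (HK p).
  by apply: (tensor_left_pre (Hr p.1) (Kl p.2)) => // *; exact: cbimod_rho_right.
have HKr p : right_pre_module (HK p).
  by apply: (tensor_right_pre (Hr p.1) (Kl p.2)) => // *; exact: cbimod_rho_left.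
have PhiU' p := unitary_adjoint PhiU (PhiP p).
have iso : @is_isomorphism _ _ _ HKsum (tensor Hsum Ksum) Phi.
  split=> //; split.
  - rewrite (dsum_left HKl); apply: (cspan_compl (closed_subspace_cspan _)).
    by move=> _ [p [x px ->]]; rewrite bop_compA PhiP; have [_ [h _ _ _]] := Up p; exact: h.
  - apply: (cspan_compl (pre_closed (dsum_left_pre HKl))) => _ [_ [Th lTh <-] [A HA <-]].
    rewrite bop_compA; move: A HA; rewrite (dsum_left Hl).
    apply: (cspan_compl (pre_closed (dsum_left_pre HKl))) => _ [i [x Hx ->]].
    rewrite -bop_compA; move: Th lTh; rewrite (dsum_left Kl) => Th lTh.
    have h := @tensor_cspan_ket2 _ _ _ _ Hsum Ksum Hsr Ksl _ _
      [set X | bm_left HKsum (bop_comp (adjoint Phi) X)] (bop_comp (iH i) x) _ _ _ Th lTh.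
    apply: h.
    + by rewrite (dsum_left Kl); exact: cspan_incl.
    + exact/closed_subspace_preim/(pre_closed (dsum_left_pre HKl)).
    move=> _ [j [eta keta ->]]; rewrite /mkset.
    have [_ _ iHr _] := iHm i; have [iKl _ _ _] := iKm j.
    (* The ket of an included vector composed with an inclusion equals [U (i, j)] composed with a
       ket of the summands, and the inverse of [Phi] takes [U (i, j)] to the inclusion of that
       summand. *)
    have e := op_tensor_ket2 (Hr i) Hsr (Kl j) Ksl iHr iKl (Up (i, j)).1 keta.
    rewrite (bop_compA (ket2 _ _ _)) -e -(bop_compA (U (i, j))).
    rewrite (bop_compA (adjoint Phi)) (PhiU' (i, j)).
    have [h _ _ _] := incl_morphism HKr HKl (i, j); apply: h.
    exact: tensor_leftI.
  - rewrite (dsum_right HKr); apply: (cspan_compl (closed_subspace_cspan _)).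
    by move=> _ [p [x px ->]]; rewrite bop_compA PhiP; have [_ [_ _ h _]] := Up p; exact: h.
  - apply: (cspan_compl (pre_closed (dsum_right_pre HKr))) => _ [_ [Xi bXi <-] [A KA <-]].
    rewrite bop_compA; move: A KA; rewrite (dsum_right Kr).
    apply: (cspan_compl (pre_closed (dsum_right_pre HKr))) => _ [j [x Kx ->]].
    rewrite -bop_compA; move: Xi bXi; rewrite (dsum_right Hr) => Xi bXi.
    have h := @tensor_cspan_ket1 _ _ _ _ Hsum Ksum Hsr Ksl _ _
      [set X | bm_right HKsum (bop_comp (adjoint Phi) X)] (bop_comp (iK j) x) _ _ _ Xi bXi.
    apply: h.
    + by rewrite (dsum_right Hr); exact: cspan_incl.
    + exact/closed_subspace_preim/(pre_closed (dsum_right_pre HKr)).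
    move=> _ [i [xi bxi ->]]; rewrite /mkset.
    have [_ _ iHr _] := iHm i; have [iKl _ _ _] := iKm j.
    have e := op_tensor_ket1 (Hr i) Hsr (Kl j) Ksl iHr iKl (Up (i, j)).1 bxi.
    rewrite (bop_compA (ket1 _ _ _)) -e -(bop_compA (U (i, j))).
    rewrite (bop_compA (adjoint Phi)) (PhiU' (i, j)).
    have [_ _ h _] := incl_morphism HKr HKl (i, j); apply: h.
    exact: tensor_rightI.
exists Phi, (adjoint Phi); split; last split.
- by split=> //; [exact: is_isomorphism_adjoint|have [] := PhiU|have [] := PhiU].
- move=> omega.
  rewrite (_ : partial_sum _ = Phi \o partial_sum (fun p => dsum_incl HK p (omega p))).
    exact: cvg_comp (@dsum_cvg _ _ HK omega) (bop_continuous Phi omega).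
  apply/funext => A /=; rewrite !partial_sumE linear_sum; apply: eq_bigr => p _.
  exact/esym/(bop_comp_eval (PhiP p)).
- move=> omega p; rewrite -[LHS]/(dsum_proj HK p (adjoint Phi omega)).
  rewrite -adjoint_incl.
  rewrite (bop_comp_eval (esym (adjoint_comp Phi (dsum_incl HK p)))) PhiP.
  have [_ _ _ r2] := iHm p.1; have [_ l2 _ _] := iKm p.2; have Uap := Ua p.
  rewrite /iH /iK /bimod_incl !adjoint_incl in r2 l2 Uap.
  by rewrite (op_tensor_uniq Hsr (Hr p.1) Ksl (Kl p.2) r2 l2 Uap).
Qed.
End tensor_direct_sum.

Theorem proposition2p13 (R : realType) (a b c d : cbase R)
    (H H1 H2 : cbimod a b) (K K1 K2 : cbimod b c) (L : cbimod c d)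
    (I J : choiceType) (Hs : I -> cbimod a b) (Ks : J -> cbimod b c) :
  (* (i) *)
  (forall (S : bop H1 H2) (T : bop K1 K2), is_morphism S -> is_morphism T ->
     is_op_tensor S T (op_tensor S T) /\ is_morphism (op_tensor S T)) /\
  (* (ii) *)
  (let assoc (V : bop (tensor (tensor H K) L) (tensor H (tensor K L))) :=
     unitary V /\
     forall xi omega theta, bm_right H xi -> bm_left L theta ->
       V (ket2 (tensor H K) L theta (ket1 H K xi omega)) =
       ket1 H (tensor K L) xi (ket2 K L theta omega) in
   (exists! V, assoc V) /\ (forall V, assoc V -> is_isomorphism V)) /\
  (* (iii) *)
  (exists X : bop (tensor H (unit_bimod b)) H, is_isomorphism X /\
     forall xi zeta y, bm_right H xi -> cb_dag b y ->
       X (elem H (unit_bimod b) xi zeta y) = xi (y zeta) /\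
       xi (y zeta) = rho_right H y (xi zeta)) /\
  (exists X : bop (tensor (unit_bimod b) K) K, is_isomorphism X /\
     forall x zeta eta, cb_alg b x -> bm_left K eta ->
       X (elem (unit_bimod b) K x zeta eta) = eta (x zeta) /\
       eta (x zeta) = rho_left K x (eta zeta)) /\
  (* (iv) *)
  (let Hsum := dsum_bimod (fun i => Hs i) in
   let Ksum := dsum_bimod (fun j => Ks j) in
   let HKsum := dsum_bimod (fun p : I * J => tensor (Hs p.1) (Ks p.2)) in
   exists (Phi : bop HKsum (tensor Hsum Ksum)) (Psi : bop (tensor Hsum Ksum) HKsum),
     [/\ is_isomorphism Phi, is_isomorphism Psi,
         bop_comp Psi Phi = bop_id _ & bop_comp Phi Psi = bop_id _] /\
     (forall omega : HKsum,
        partial_sum (fun p : I * J =>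
          op_tensor (bimod_incl (fun i => Hs i) p.1) (bimod_incl (fun j => Ks j) p.2)
            (omega p)) @ totally --> Phi omega) /\
     (forall (omega : tensor Hsum Ksum) (p : I * J),
        Psi omega p =
        op_tensor (bimod_proj (fun i => Hs i) p.1) (bimod_proj (fun j => Ks j) p.2)
          omega)).

Proof.
split.
  by move=> S T; apply: op_tensor_morphism;
    [exact: cbimod_right..|exact: cbimod_left|exact: cbimod_left].
split; first by split; [exact: assoc_exists | exact: assoc_isomorphism].
split; first exact: right_unit.
split; [exact: left_unit | exact: tensor_dsum].
Qed.
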